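(* Let $k$ be an algebraically closed field of characteristic $0$ with finite transcendence degree over $\mathbb{Q}$. Let $f: \mathbb{A}^N\to \mathbb{A}^N$, $N\geq 1$, be a dominant endomorphism over $k$ of the form $(x_1,\dots,x_N)\mapsto (f_1(x_1),\dots, f_N(x_N))$. Then $(\mathbb{A}^N,f)$ satisfies the AZD-property. Moreover, if $\deg f_i\geq 2$ for every $i=1,\dots,N$, then $(\mathbb{A}^N,f)$ satisfies the SAZD-property.
   Context: A variety is a reduced separated scheme of finite type over a field. Adelic topology. For a prime $p$, $\mathbb{C}_p$ is the completion of $\overline{\mathbb{Q}_p}$; also $\mathbb{C}_\infty:=\mathbb{C}$. Let $X$ be a variety over $k$. Choose a subfield $K_0\subseteq k$ finitely generated over $\mathbb{Q}$ with $\overline{K_0}=k$ such that $X$ is defined over $K_0$, i.e. $X=X_{K_0}\times_{\mathrm{Spec}\,K_0}\mathrm{Spec}\,k$. For a finite extension $K/K_0$ inside $k$ put $X_K=X_{K_0}\times_{\mathrm{Spec}\,K_0}\mathrm{Spec}\,K$. Let $\mathcal{I}_K$ be the set of field embeddings $\tau:K\hookrightarrow\mathbb{C}_{p_\tau}$ with $p_\tau$ a prime or $\infty$. For $\tau\in\mathcal{I}_K$, let $\mathcal{I}_\tau$ be the set of field embeddings $\overline{\tau}:k\hookrightarrow\mathbb{C}_{p_\tau}$ extending $\tau$; each induces an injection $\phi_{\overline\tau}:X(k)\hookrightarrow X_K(\mathbb{C}_{p_\tau})$. For $U\subseteq X_K(\mathbb{C}_{p_\tau})$ open in the $p_\tau$-adic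 topology (complex topology if $p_\tau=\infty$), put $X_K(\tau,U)=\bigcup_{\overline\tau\in\mathcal{I}_\tau}\phi_{\overline\tau}^{-1}(U)\subseteq X(k)$. A basic adelic subset of $X(k)$ over $K$ is a finite intersection $\bigcap_{i=1}^m X_K(\tau_i,U_i)$ of such sets (the $\tau_i$ not necessarily distinct). A general adelic subset of $X(k)$ (over $K$) is a set $\pi(B)$ where $\pi:Y\to X$ is a flat morphism of varieties (defined over $K$) and $B$ is a basic adelic subset of $Y(k)$ (over $K$). An adelic open subset of $X(k)$ is a union of general adelic subsets; these form the adelic topology on $X(k)$, which does not depend on the choice of $K_0$. For an irreducible variety $X$ over $k$ and a dominant rational self-map $f:X\dashrightarrow X$, $k(X)^f=\{H\in k(X): H\circ f=H\}$. The orbit $O_f(x)=\{f^n(x):n\ge0\}$ of $x\in X(k)$ is well-defined if $f$ is well-defined at $f^n(x)$ for all $n\ge0$. $(X,f)$ satisfies the SAZD-property if there is a nonempty adelic open subset $A\subseteq X(k)$ such that for every $x\in A$ the orbit $O_f(x)$ is well-defined and Zariski dense in $X$. $(X,f)$ satisfies the AZD-property if either $k(X)^f\ne k$ or it satisfies the SAZD-property. *)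

(* Defs.v *)
From mathcomp Require Import all_boot all_order all_algebra.
From mathcomp Require Import fraction complex mpoly reals.

Set Implicit Arguments.
Unset Strict Implicit.
Unset Printing Implicit Defensive.

Import Order.TTheory GRing.Theory Num.Theory.
Local Open Scope ring_scope.
Local Open Scope quotient_scope.

(* Varieties over K are defined through their functors of points
   (Demazure-Gabriel): a scheme over K is a Zariski sheaf on commutative
   K-algebras which is covered by open affine subfunctors.  Rings may be zero,
   hence [comPzRingType]. *)

Record kalg (K : fieldType) := KAlg {
  kring :> comPzRingType;
  kstr : {rmorphism K -> kring} }.

Record khom (K : fieldType) (A B : kalg K) := KHom {
  kmap :> {rmorphism A -> B};
  kmapK : forall c, kmap (kstr A c) = kstr B c }.

(* The functor laws are stated up to pointwise equality of morphisms. *)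
Record kfunctor (K : fieldType) := KFunctor {
  pt :> kalg K -> Type;
  act : forall A B : kalg K, khom A B -> pt A -> pt B;
  act_id : forall (A : kalg K) (h : khom A A) (x : pt A),
    h =1 id -> act h x = x;
  act_comp : forall (A B C : kalg K) (g : khom B C) (h : khom A B)
      (gh : khom A C) (x : pt A),
    gh =1 (fun a => g (h a)) -> act gh x = act g (act h x) }.

Record kmor (K : fieldType) (Y X : kfunctor K) := KMor {
  mor :> forall A : kalg K, Y A -> X A;
  mor_nat : forall (A B : kalg K) (h : khom A B) (y : Y A),
    mor (act h y) = act h (mor y) }.

(* The family [h e], for [e] in [E], generates the unit ideal of [B]. *)
Definition unit_ideal (A B : comPzRingType) (h : A -> B) (E : A -> Prop) :=
  exists2 s : seq (B * A), forall p, p \in s -> E p.2 &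
    \sum_(p <- s) p.1 * h p.2 = 1.

Definition is_localization (A B : comPzRingType) (f : A) (l : A -> B) :=
  [/\ exists b, l f * b = 1,
      forall b, exists n a, b * l f ^+ n = l a &
      forall a, l a = 0 -> exists n, f ^+ n * a = 0].

Section Schemes.
Variables (K : fieldType) (X : kfunctor K).

(* By the Yoneda lemma [u : X A] is a morphism Spec A -> X; this says that it is
   an open immersion, i.e. a monomorphism whose pullback along each morphism
   Spec T -> X is the complement of the zero locus of some subset of T. *)
Definition affine_open (A : kalg K) (u : X A) :=
  (forall (T : kalg K) (h h' : khom A T), act h u = act h' u -> h =1 h') /\
  (forall (T : kalg K) (x : X T), exists E : T -> Prop,
     forall (T' : kalg K) (g : khom T T'),
       (exists h : khom A T', act h u = act g x) <-> unit_ideal g E).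

(* Matching on the overlap of D(f_i) and D(f_j) is tested in all algebras T'
   receiving both localizations, rather than in the localization at f_i f_j,
   which is universal among them. *)
Definition zariski_sheaf :=
  forall (T : kalg K) (r : nat) (f : 'I_r -> T) (Tf : 'I_r -> kalg K)
    (l : forall i, khom T (Tf i)) (x : forall i, X (Tf i)),
    unit_ideal id (fun t => exists i, t = f i) ->
    (forall i, is_localization (f i) (l i)) ->
    (forall i j (T' : kalg K) (a : khom (Tf i) T') (b : khom (Tf j) T'),
       (forall t, a (l i t) = b (l j t)) -> act a (x i) = act b (x j)) ->
    exists! y : X T, forall i, act (l i) y = x i.

Definition covering (I : Type) (A : I -> kalg K) (u : forall i, X (A i)) :=
  forall (L : fieldType) (s : {rmorphism K -> L}) (x : X (KAlg s)),
    exists i (h : khom (A i) (KAlg s)), act h (u i) = x.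

Definition fg_algebra (A : kalg K) :=
  exists s : seq A, forall S : {pred A},
    subring_closed S -> (forall c, kstr A c \in S) ->
    {subset s <= S} -> forall a, a \in S.

(* This includes that X is a scheme: it is covered by affine opens. *)
Definition finite_type_scheme :=
  zariski_sheaf /\
  exists (n : nat) (A : 'I_n -> kalg K) (u : forall i, X (A i)),
    [/\ forall i, affine_open (u i), forall i, fg_algebra (A i) & covering u].

(* The diagonal is a closed immersion. *)
Definition separated :=
  forall (T : kalg K) (x y : X T), exists E : T -> Prop,
    forall (T' : kalg K) (g : khom T T'),
      act g x = act g y <-> forall e, E e -> g e = 0.

Definition reduced :=
  forall (A : kalg K) (u : X A), affine_open u ->
    forall (a : A) n, a ^+ n = 0 -> a = 0.

Definition is_variety := [/\ finite_type_scheme, separated & reduced].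

End Schemes.

(* [tensor_null h s]: the tensor \sum_(p <- s) p.1 \otimes p.2 vanishes in
   B \otimes_A M, tested on the biadditive A-balanced maps out of B x M. *)
Definition tensor_null (A B : comPzRingType) (h : A -> B) (M : lmodType A)
    (s : seq (B * M)) :=
  forall (G : zmodType) (b : B -> M -> G),
    (forall x y m, b (x + y) m = b x m + b y m) ->
    (forall x m n, b x (m + n) = b x m + b x n) ->
    (forall a x m, b (h a * x) m = b x (a *: m)) ->
    \sum_(p <- s) b p.1 p.2 = 0.

Definition flat_ring_map (A B : comPzRingType) (h : A -> B) :=
  forall (M' M : lmodType A) (u : {linear M' -> M}), injective u ->
  forall s : seq (B * M'),
    tensor_null h [seq (p.1, u p.2) | p <- s] -> tensor_null h s.

(* Flatness on all pairs of affine opens Spec A of Y and Spec B of X such that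
   Spec A is mapped into Spec B. *)
Definition flat_morphism (K : fieldType) (Y X : kfunctor K) (pi : kmor Y X) :=
  forall (A B : kalg K) (u : Y A) (v : X B),
    affine_open u -> affine_open v ->
    forall h : khom B A, act h v = pi A u -> flat_ring_map h.

Section AffineSpace.
Variables (K : fieldType) (N : nat).

Let pt_aff (A : kalg K) : Type := 'rV[A]_N.
Let act_aff (A B : kalg K) (h : khom A B) (x : pt_aff A) : pt_aff B :=
  map_mx h x.

Fact aff_act_id (A : kalg K) (h : khom A A) (x : pt_aff A) :
  h =1 id -> act_aff h x = x.
Proof. by move=> hE; apply/rowP => i; rewrite mxE hE. Qed.

Fact aff_act_comp (A B C : kalg K) (g : khom B C) (h : khom A B)
    (gh : khom A C) (x : pt_aff A) :
  gh =1 (fun a => g (h a)) -> act_aff gh x = act_aff g (act_aff h x).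
Proof. by move=> hE; apply/rowP => i; rewrite !mxE hE. Qed.

Definition affine_space : kfunctor K := KFunctor aff_act_id aff_act_comp.

End AffineSpace.

Section Completions.
Variable R : realType.

Definition is_absval (F : fieldType) (v : F -> R) :=
  [/\ forall x, 0 <= v x, forall x, v x = 0 <-> x = 0,
      {morph v : x y / x * y} & forall x y, v (x + y) <= v x + v y].

Definition padic_abs (p : nat) (q : rat) : R :=
  if q == 0 then 0
  else p%:R ^ ((logn p `|denq q|%N)%:Z - (logn p `|numq q|%N)%:Z).

Definition converges_to (F : fieldType) (v : F -> R) (x : nat -> F) (l : F) :=
  forall e, 0 < e -> exists n, forall i, (n <= i)%N -> v (x i - l) < e.

Definition cauchy_seq (F : fieldType) (v : F -> R) (x : nat -> F) :=
  forall e, 0 < e ->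
    exists n, forall i j, (n <= i)%N -> (n <= j)%N -> v (x i - x j) < e.

Definition is_completion (F E : fieldType) (vF : F -> R) (vE : E -> R)
    (j : F -> E) :=
  [/\ forall x, vE (j x) = vF x,
      forall y e, 0 < e -> exists x, vE (y - j x) < e &
      forall x, cauchy_seq vE x -> exists l, converges_to vE x l].

(* Q -> Q_p -> algebraic closure of Q_p -> C_p; such a tower is unique up to
   isometric isomorphism. *)
Record Cp_tower (p : nat) := CpTower {
  Qp : fieldType;
  Qp_abs : Qp -> R;
  Qp_inj : {rmorphism rat -> Qp};
  Qp_absP : is_absval Qp_abs;
  QpP : is_completion (padic_abs p) Qp_abs Qp_inj;
  Qpbar : closedFieldType;
  Qpbar_abs : Qpbar -> R;
  Qpbar_inj : {rmorphism Qp -> Qpbar};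
  Qpbar_absP : is_absval Qpbar_abs;
  Qpbar_ext : forall x, Qpbar_abs (Qpbar_inj x) = Qp_abs x;
  Qpbar_alg : forall x, algebraicOver Qpbar_inj x;
  Cp : fieldType;
  Cp_abs : Cp -> R;
  Cp_inj : {rmorphism Qpbar -> Cp};
  Cp_absP : is_absval Cp_abs;
  CpP : is_completion Qpbar_abs Cp_abs Cp_inj }.

Inductive target :=
  | TargetInfty
  | TargetPrime (p : nat) of prime p & Cp_tower p.

Definition target_field (c : target) : fieldType :=
  match c with TargetInfty => R[i] | TargetPrime _ _ M => Cp M end.

Definition target_abs (c : target) : target_field c -> R :=
  match c with
  | TargetInfty => @Normc.normc R
  | TargetPrime _ _ M => @Cp_abs _ M
  end.

End Completions.

Section Adelic.
Variable R : realType.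

(* U is open in Y(C): its trace on A(C) is open for each affine open Spec A of Y,
   where A(C) has the coarsest topology making the evaluations at all elements
   of A continuous. *)
Definition open_points (K : fieldType) (Y : kfunctor K) (c : target R)
    (t : {rmorphism K -> target_field c}) (U : Y (KAlg t) -> Prop) :=
  forall (A : kalg K) (u : Y A), affine_open u ->
  forall h : khom A (KAlg t), U (act h u) ->
  exists (s : seq A) (e : R), 0 < e /\
    forall h' : khom A (KAlg t),
      (forall a, a \in s -> target_abs (h' a - h a : target_field c) < e) ->
      U (act h' u).

Variable k : fieldType.

(* The set X_K(tau, U); an extension of tau to k is a morphism of K-algebras. *)
Definition adelic_piece (K : fieldType) (iota : {rmorphism K -> k})
    (Y : kfunctor K) (c : target R) (t : {rmorphism K -> target_field c})
    (U : Y (KAlg t) -> Prop) (y : Y (KAlg iota)) :=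
  exists tbar : khom (KAlg iota) (KAlg t), U (act tbar y).

Definition basic_adelic (K : fieldType) (iota : {rmorphism K -> k})
    (Y : kfunctor K) (B : Y (KAlg iota) -> Prop) :=
  exists (m : nat) (c : 'I_m -> target R)
    (t : forall i, {rmorphism K -> target_field (c i)})
    (U : forall i, Y (KAlg (t i)) -> Prop),
    (forall i, open_points (U i)) /\
    (forall y, B y <-> forall i, adelic_piece (U i) y).

Definition general_adelic (K : fieldType) (iota : {rmorphism K -> k})
    (X : kfunctor K) (S : X (KAlg iota) -> Prop) :=
  exists (Y : kfunctor K) (pi : kmor Y X) (B : Y (KAlg iota) -> Prop),
    [/\ is_variety Y, flat_morphism pi, basic_adelic B &
        forall x, S x <-> exists2 y, B y & pi _ y = x].

Definition finite_extension (F E : fieldType) (j : {rmorphism F -> E}) :=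
  exists s : seq E, forall x, exists c : 'I_(size s) -> F,
    x = \sum_i j (c i) * s`_i.

(* Adelic open subsets of A^N(k), relative to the subfield i0 : K0 -> k.  The
   finite extensions K of K0 inside k are given by K0 -> K -> k. *)
Definition adelic_open (K0 : fieldType) (i0 : {rmorphism K0 -> k}) (N : nat)
    (S : 'rV[k]_N -> Prop) :=
  forall x, S x ->
  exists (K : fieldType) (j : {rmorphism K0 -> K}) (iota : {rmorphism K -> k})
    (S' : affine_space K N (KAlg iota) -> Prop),
    [/\ (forall a, iota (j a) = i0 a) /\ finite_extension j,
        general_adelic S', S' x & forall y, S' y -> S y].

End Adelic.

(* Endomorphisms of A^N are N-tuples of polynomials in N variables. *)
Section Dynamics.
Variables (k : fieldType) (N : nat).

Definition zariski_closed (Z : 'rV[k]_N -> Prop) :=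
  exists E : {mpoly k[N]} -> Prop,
    forall x, Z x <-> forall P, E P -> P.@[x 0] = 0.

Definition zariski_dense (S : 'rV[k]_N -> Prop) :=
  forall Z, zariski_closed Z -> (forall x, S x -> Z x) -> forall x, Z x.

Definition endo_map (F : N.-tuple {mpoly k[N]}) (x : 'rV[k]_N) : 'rV[k]_N :=
  \row_i (tnth F i).@[x 0].

Definition dominant (F : N.-tuple {mpoly k[N]}) :=
  zariski_dense (fun y => exists x, endo_map F x = y).

Definition orbit_of (F : N.-tuple {mpoly k[N]}) (x y : 'rV[k]_N) :=
  exists n, y = iter n (endo_map F) x.

(* H \o F for H in k(A^N); meaningful when F is dominant, so that the composite
   of the denominator of H with F is nonzero. *)
Definition frac_comp (F : N.-tuple {mpoly k[N]})
    (H : {fraction {mpoly k[N]}}) : {fraction {mpoly k[N]}} :=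
  tofrac (comp_mpoly F \n_(repr H)) / tofrac (comp_mpoly F \d_(repr H)).

Definition has_nonconstant_invariant (F : N.-tuple {mpoly k[N]}) :=
  exists2 H : {fraction {mpoly k[N]}}, frac_comp F H = H &
    forall c : k, H <> tofrac c%:MP.

(* Orbits under an endomorphism are always well-defined. *)
Definition SAZD (R : realType) (K0 : fieldType) (i0 : {rmorphism K0 -> k})
    (F : N.-tuple {mpoly k[N]}) :=
  exists S : 'rV[k]_N -> Prop,
    [/\ exists x, S x, adelic_open R i0 S &
        forall x, S x -> zariski_dense (orbit_of F x)].

Definition AZD (R : realType) (K0 : fieldType) (i0 : {rmorphism K0 -> k})
    (F : N.-tuple {mpoly k[N]}) :=
  has_nonconstant_invariant F \/ SAZD R i0 F.

(* (x_1, ..., x_N) |-> (f_1(x_1), ..., f_N(x_N)) *)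
Definition split_endo (f : 'I_N -> {poly k}) : N.-tuple {mpoly k[N]} :=
  [tuple (map_poly (@mpolyC N k) (f i)).['X_i] | i < N].

End Dynamics.

Definition alg_independent (k : fieldType) (n : nat) (s : n.-tuple k) :=
  forall P : {mpoly rat[n]}, mmap ratr (tnth s) P = 0 -> P = 0.

Definition finite_trdeg (k : fieldType) :=
  exists d, forall (n : nat) (s : n.-tuple k), alg_independent s -> (n <= d)%N.

(* Finitely generated as a field over its prime field. *)
Definition fg_field (K : fieldType) :=
  exists s : seq K, forall S : {pred K},
    divring_closed S -> {subset s <= S} -> forall x, x \in S.

(* Main.v *)
(* Every coordinate [f_i] of degree at least 2 has a fixed point [q_i] with
   nonzero multiplier; for an affine coordinate let [q_i] be its fixed point,
   or 0 for a translation.  Choose distinct primes [p_i] and embeddings of [k]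
   in [C_(p_i)] for which the coefficients, the [q_i] and their multipliers are
   integral, the nonzero ones being units congruent to roots of unity.  Let [x]
   be a point which, for each [i], lies under some extension of the [i]-th
   embedding at distance more than 1 from [q_i] in the [i]-th coordinate and less
   than 1 from [q_j] in the others.  At that place [f_i^n(x_i)] tends to infinity if
   [deg f_i >= 2], while the other coordinates are bounded and recurrent along
   [n + r p^m].  So if a polynomial vanishes on the orbit of [x], then so does
   its leading coefficient in [X_i], and by induction only polynomials in the
   affine coordinates matter.  On these the orbit is given by [a_i^n] and [n]: a
   vanishing polynomial forces a coincidence of the resulting exponential
   monomials, which yields an invariant rational function. *)

From HB Require Import structures.
From mathcomp Require Import all_boot all_order all_algebra all_field.
From mathcomp Require Import ring lra zify.
From mathcomp Require Import fraction complex mpoly reals boolp generic_quotient ring_quotient.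
From mathcomp Require classical_sets functions.
From mathcomp.analysis Require exp.
Require Import Defs.
Set Implicit Arguments.
Unset Strict Implicit.
Unset Printing Implicit Defensive.
Import Order.TTheory GRing.Theory Num.Theory.
Local Open Scope ring_scope.
Local Open Scope quotient_scope.

(** * Ultrametric absolute values *)

Section UltrametricAbsval.
Variables (R : realType) (F : fieldType).

Definition ultrametric_absval (v : F -> R) :=
  [/\ forall x, 0 <= v x, forall x, v x = 0 <-> x = 0,
      {morph v : x y / x * y} & forall x y, v (x + y) <= Num.max (v x) (v y)].

Lemma ultrametric_is_absval v : ultrametric_absval v -> is_absval v.
Proof.
case=> v0 vE vM vD; split=> // x y; apply: le_trans (vD x y) _.
by rewrite ge_max lerDl lerDr !v0.
Qed.

Variables (v : F -> R).

Section Basic.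
Hypothesis vA : is_absval v.

Lemma absval_ge0 x : 0 <= v x. Proof. by case: vA. Qed.
Lemma absval0 : v 0 = 0. Proof. by case: vA => _ E _ _; apply/E. Qed.
Lemma absvalM x y : v (x * y) = v x * v y. Proof. by case: vA. Qed.
Lemma absval_eq0 x : (v x == 0) = (x == 0).
Proof. by case: vA => _ E _ _; apply/eqP/eqP => /E. Qed.
Lemma absval_gt0 x : (0 < v x) = (x != 0).
Proof. by rewrite lt0r absval_ge0 andbT absval_eq0. Qed.
Lemma absval1 : v 1 = 1.
Proof.
have n0 : v 1 != 0 by rewrite absval_eq0 oner_eq0.
by apply: (mulfI n0); rewrite -absvalM !mulr1.
Qed.
Lemma absvalX x n : v (x ^+ n) = v x ^+ n.
Proof. by elim: n => [|n IH]; rewrite ?expr0 ?absval1 // !exprS absvalM IH. Qed.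
Lemma absvalN x : v (- x) = v x.
Proof.
have /eqP : v (-1) ^+ 2 = 1 by rewrite -absvalX sqrrN expr1n absval1.
rewrite sqrf_eq1 => /orP[/eqP E|/eqP E].
  by rewrite -mulN1r absvalM E mul1r.
by have := absval_ge0 (-1); rewrite E oppr_ge0 ler10.
Qed.
Lemma absvalB x y : v (x - y) = v (y - x). Proof. by rewrite -absvalN opprB. Qed.
Lemma absvalV x : v x^-1 = (v x)^-1.
Proof.
have [->|x0] := eqVneq x 0; first by rewrite invr0 absval0 invr0.
have n0 : v x != 0 by rewrite absval_eq0.
by apply: (mulfI n0); rewrite -absvalM !divff // absval1.
Qed.
Lemma absval_prod I (r : seq I) (P : pred I) (f : I -> F) :
  v (\prod_(i <- r | P i) f i) = \prod_(i <- r | P i) v (f i).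
Proof. exact: (big_morph v absvalM absval1). Qed.
End Basic.

Hypothesis vU : ultrametric_absval v.
Let vA := ultrametric_is_absval vU.

Lemma ultraD x y : v (x + y) <= Num.max (v x) (v y). Proof. by case: vU. Qed.
Lemma ultraD_le x y c : v x <= c -> v y <= c -> v (x + y) <= c.
Proof. by move=> a b; apply: le_trans (ultraD x y) _; rewrite ge_max a b. Qed.
Lemma ultraB_le x y c : v x <= c -> v y <= c -> v (x - y) <= c.
Proof. by move=> a b; apply: ultraD_le; rewrite ?absvalN. Qed.
Lemma ultraD_lt x y c : v x < c -> v y < c -> v (x + y) < c.
Proof. by move=> a b; apply: le_lt_trans (ultraD x y) _; rewrite gt_max a b. Qed.
Lemma ultraB_lt x y c : v x < c -> v y < c -> v (x - y) < c.
Proof. by move=> a b; apply: ultraD_lt; rewrite ?absvalN. Qed.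
Lemma ultra_sum_le I (r : seq I) (P : pred I) (f : I -> F) c :
  0 <= c -> (forall i, P i -> v (f i) <= c) -> v (\sum_(i <- r | P i) f i) <= c.
Proof.
move=> c0 H; elim/big_ind: _ => //; first by rewrite absval0.
by move=> x y; exact: ultraD_le.
Qed.
Lemma ultra_nat_le1 n : v n%:R <= 1.
Proof.
elim: n => [|n IH]; first by rewrite absval0.
by rewrite -addn1 natrD; apply: ultraD_le; rewrite // absval1.
Qed.
Lemma ultra_eq x y : v (x - y) < v y -> v x = v y.
Proof.
move=> H; apply/eqP; rewrite eq_le; apply/andP; split.
  by rewrite -[x](subrK y); apply: ultraD_le => //; exact: ltW.
rewrite leNgt; apply/negP => H2.
have : v (x - (x - y)) < v y by apply: ultraB_lt.
by rewrite opprB addrC subrK ltxx.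
Qed.
End UltrametricAbsval.

Lemma absval_comp (R : realType) (E F : fieldType) (w : F -> R) (f : {rmorphism E -> F}) :
  is_absval w -> is_absval (fun x => w (f x)).
Proof.
move=> wA; split=> [x|x|x y|x y].
- exact: (absval_ge0 wA).
- split=> [/eqP|->]; last by rewrite rmorph0 (absval0 wA).
  by rewrite (absval_eq0 wA) fmorph_eq0 => /eqP.
- by rewrite rmorphM (absvalM wA).
- by rewrite rmorphD; case: wA.
Qed.

Lemma ultrametric_comp (R : realType) (E F : fieldType) (w : F -> R) (f : {rmorphism E -> F}) :
  ultrametric_absval w -> ultrametric_absval (fun x => w (f x)).
Proof.
move=> wU; have [h1 h2 h3 _] := absval_comp f (ultrametric_is_absval wU).
by split=> // x y; rewrite rmorphD; case: wU.
Qed.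

Lemma geometric_small (R : realType) (rho e : R) : 0 <= rho -> rho < 1 -> 0 < e ->
  exists M, rho ^+ M < e.
Proof.
move=> rho0 rho1 e0; have [->|rhon] := eqVneq rho 0; first by exists 1%N; rewrite expr1.
have rp : 0 < rho by rewrite lt_def rhon.
pose d := rho^-1 - 1; have d0 : 0 < d by rewrite subr_gt0 invf_gt1.
have bern n : d *+ n <= rho^-1 ^+ n.
  suff : 1 + d *+ n <= rho^-1 ^+ n by apply: le_trans; rewrite lerDr ler01.
  elim: n => [|n IH]; first by rewrite mulr0n addr0 expr0.
  rewrite exprS; apply: le_trans (_ : (1 + d) * (1 + d *+ n) <= _); last first.
    by rewrite [1 + d]addrC subrK ler_pM2l ?invr_gt0.
  have dn0 : 0 <= d * (d *+ n) by rewrite mulr_ge0 ?mulrn_wge0 // ltW.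
  by rewrite mulrSr; move: (d *+ n) dn0 => a; lra.
have [n hn] : exists n, e^-1 < d *+ n.
  exists (Num.bound (e^-1 / d)); rewrite -mulr_natl -ltr_pdivrMr //.
  by apply: archi_boundP; rewrite divr_ge0 ?invr_ge0 // ltW.
exists n; rewrite -[ltRHS]invrK -[ltLHS]invrK ltf_pV2 ?posrE ?invr_gt0 ?exprn_gt0 //.
by rewrite -exprVn; apply: lt_le_trans hn _.
Qed.

Lemma archi_eq0 (R : realType) (z c : R) :
  (forall n, `|z| <= c / n.+1%:R) -> z = 0.
Proof.
move=> H; apply/eqP; rewrite -normr_le0 leNgt; apply/negP => lt.
have c0 : 0 <= c by have := le_trans (normr_ge0 z) (H 0); rewrite divr1.
have := archi_boundP (divr_ge0 c0 (ltW lt)).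
set m := Num.bound _ => hm; have := H m; rewrite leNgt => /negP; apply.
rewrite ltr_pdivrMr ?ltr0Sn // mulrC -ltr_pdivrMr //.
by apply: lt_trans hm _; rewrite ltr_nat.
Qed.

Section Subring.
Variables (F : comNzRingType) (O : F -> Prop).

Definition is_subring :=
  [/\ O 1, forall x y, O x -> O y -> O (x - y) &
      forall x y, O x -> O y -> O (x * y)].

Hypothesis OP : is_subring.

Lemma subring1 : O 1. Proof. by case: OP. Qed.
Lemma subringB x y : O x -> O y -> O (x - y). Proof. by case: OP => _ H *; apply: H. Qed.
Lemma subringM x y : O x -> O y -> O (x * y). Proof. by case: OP => _ _ H *; apply: H. Qed.
Lemma subring0 : O 0. Proof. by rewrite -(subrr 1); apply: subringB; exact: subring1. Qed.
Lemma subringN x : O x -> O (- x).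
Proof. by move=> h; rewrite -sub0r; apply: subringB => //; exact: subring0. Qed.
Lemma subringD x y : O x -> O y -> O (x + y).
Proof. by move=> hx hy; rewrite -[y]opprK; apply: subringB => //; exact: subringN. Qed.
Lemma subringX x n : O x -> O (x ^+ n).
Proof.
move=> h; elim: n => [|n IH]; first by rewrite expr0; exact: subring1.
by rewrite exprS; exact: subringM.
Qed.
Lemma subring_sum I (r : seq I) (P : pred I) (f : I -> F) :
  (forall i, P i -> O (f i)) -> O (\sum_(i <- r | P i) f i).
Proof. by move=> H; elim/big_ind: _ => //; [exact: subring0 | exact: subringD]. Qed.
Lemma subring_nat n : O n%:R.
Proof. elim: n => [|n IH]; first exact: subring0.
by rewrite -addn1 natrD; apply: subringD => //; exact: subring1. Qed.
End Subring.

(** * Real valuations from valuation rings *)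

Section ValuationRing.
Variables (F : fieldType) (p : nat) (O : F -> Prop).

Definition pvaluation_ring :=
  [/\ is_subring O, forall x, O x \/ O x^-1,
      ~ O p%:R^-1 & forall x, exists n, O (p%:R ^+ n * x)].

Hypothesis OP : pvaluation_ring.

Lemma val_subring : is_subring O. Proof. by case: OP. Qed.
Local Lemma val1 : O 1. Proof. exact: subring1 val_subring. Qed.
Local Lemma valM x y : O x -> O y -> O (x * y). Proof. by apply: subringM; exact: val_subring. Qed.
Local Lemma valX x n : O x -> O (x ^+ n). Proof. by apply: subringX; exact: val_subring. Qed.
Local Lemma val0 : O 0. Proof. exact: subring0 val_subring. Qed.
Local Lemma val_nat n : O n%:R. Proof. by apply: subring_nat; exact: val_subring. Qed.
Local Lemma valD x y : O x -> O y -> O (x + y). Proof. by apply: subringD; exact: val_subring. Qed.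

Lemma val_or x : O x \/ O x^-1. Proof. by case: OP. Qed.
Lemma val_p : ~ O p%:R^-1. Proof. by case: OP. Qed.
Lemma val_arch x : exists n, O (p%:R ^+ n * x). Proof. by case: OP. Qed.
Lemma val_p0 : p%:R != 0 :> F.
Proof. by apply/eqP => h; apply: val_p; rewrite h invr0; exact: val0. Qed.

Lemma val_expr x n : O (x ^+ n.+1) -> O x.
Proof.
move=> h; case: (val_or x) => // hi.
have [->|x0] := eqVneq x 0; first exact: val0.
rewrite (_ : x = x ^+ n.+1 * x^-1 ^+ n); first by apply: valM => //; exact: valX.
by rewrite exprS exprVn mulfK // expf_neq0.
Qed.

Local Notation pF := (p%:R : F).

Lemma val_pexpS (a : int) (m : nat) x :
  O (x / pF ^ (a + m%:Z)) -> O (x / pF ^ a).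
Proof.
move=> h; have -> : x / pF ^ a = x / pF ^ (a + m%:Z) * pF ^+ m.
  by rewrite expfzDr ?val_p0 // invfM -!mulrA -exprnP mulVf ?mulr1 // expf_neq0 // val_p0.
by apply: valM => //; apply: valX; exact: val_nat.
Qed.

Lemma val_pexp (a b : int) x : a <= b -> O (x / pF ^ b) -> O (x / pF ^ a).
Proof.
move=> ab h; apply: (@val_pexpS _ `|b - a|%N).
by rewrite (_ : _ + _ = b) //; lia.
Qed.

Lemma val_floor x n : x != 0 ->
  exists a : int, O (x ^+ n / pF ^ a) /\ ~ O (x ^+ n / pF ^ (a + 1)).
Proof.
move=> x0; have [M hM] := val_arch (x ^+ n); have [N hN] := val_arch (x ^+ n)^-1.
have xn0 : x ^+ n != 0 by rewrite expf_neq0.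
have ub (j : nat) : O (x ^+ n / pF ^ (- M%:Z + j%:Z)) -> (j <= M + N)%N.
  move=> h; rewrite leqNgt; apply/negP => lt.
  have h2 : O (x ^+ n / pF ^ (N%:Z + 1)) by apply: val_pexp h; lia.
  apply: val_p; have := valM h2 hN.
  rewrite expfzDr ?val_p0 // invfM expr1z -exprnP.
  have pN0 : pF ^+ N != 0 by rewrite expf_neq0 // val_p0.
  by rewrite mulrACA [(_ / pF)]mulrC mulrA mulrC; congr O; field; rewrite pN0 xn0 val_p0.
pose P j := `[< O (x ^+ n / pF ^ (- M%:Z + j%:Z)) >].
have exP : exists j, P j.
  by exists 0; apply/asboolP; rewrite addr0 -invr_expz invrK mulrC.
have ubP j : P j -> (j <= M + N)%N by move/asboolP/ub.
case: (ex_maxnP exP ubP) => j /asboolP Pj maxj.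
exists (- M%:Z + j%:Z); split=> // h.
have /maxj : P j.+1 by apply/asboolP; rewrite -addn1 PoszD addrA.
by rewrite ltnn.
Qed.

Variable R : realType.

(* Every element being [p]-bounded, the value group is archimedean, and
   [sup {a / n | x ^ n / p ^ a in O}] is a real valuation normalized at [p]. *)
Definition valcut (x : F) : R -> Prop := fun al =>
  exists (a : int) (n : nat), O (x ^+ n.+1 / pF ^ a) /\ al = a%:~R / n.+1%:R.

Definition valsup x : R := reals.sup (valcut x).

Lemma valcut_le x (a b : int) n m : O (x ^+ n.+1 / pF ^ a) ->
  ~ O (x ^+ m.+1 / pF ^ b) -> a%:~R / n.+1%:R <= b%:~R / m.+1%:R :> R.
Proof.
move=> ha hb; rewrite leNgt; apply/negP.
rewrite ltr_pdivlMr ?ltr0Sn // mulrAC ltr_pdivrMr ?ltr0Sn // => lt.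
apply: hb; apply: (@val_expr _ n).
have le : b * n.+1%:Z <= a * m.+1%:Z.
  by rewrite ltW // -(ltr_int R) !rmorphM /=.
rewrite exprMn -exprM exprVn.
rewrite (_ : (pF ^ b) ^+ n.+1 = pF ^ (b * n.+1%:Z)); last by rewrite exprnP exprz_exp.
apply: val_pexp le _.
rewrite mulnC exprM -exprz_exp -exprnP -exprVn -exprMn; exact: valX.
Qed.

Lemma valsup_bounds x a n : x != 0 -> O (x ^+ n.+1 / pF ^ a) ->
  ~ O (x ^+ n.+1 / pF ^ (a + 1)) ->
  a%:~R / n.+1%:R <= valsup x <= (a + 1)%:~R / n.+1%:R.
Proof.
move=> x0 ha hb.
have ub : classical_sets.ubound (valcut x) ((a + 1)%:~R / n.+1%:R).
  by move=> _ [a' [n' [h ->]]]; exact: valcut_le h hb.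
have mem : valcut x (a%:~R / n.+1%:R) by exists a, n.
apply/andP; split; last by apply: ge_sup => //; exists (a%:~R / n.+1%:R).
by apply: sup_upper_bound => //; split; [exists (a%:~R / n.+1%:R)|exists ((a + 1)%:~R / n.+1%:R)].
Qed.

Lemma valsup_approx x n : x != 0 ->
  exists a : int, [/\ O (x ^+ n.+1 / pF ^ a), ~ O (x ^+ n.+1 / pF ^ (a + 1)) &
    a%:~R / n.+1%:R <= valsup x <= (a%:~R + 1) / n.+1%:R].
Proof.
move=> x0; have [a [h1 h2]] := val_floor n.+1 x0.
by exists a; split=> //; have := valsup_bounds x0 h1 h2; rewrite rmorphD.
Qed.

Lemma valsupM x y : x != 0 -> y != 0 -> valsup (x * y) = valsup x + valsup y.
Proof.
move=> x0 y0; have xy0 : x * y != 0 by rewrite mulf_neq0.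
apply/eqP; rewrite -subr_eq0; apply/eqP/(@archi_eq0 _ _ 3) => n.
have [a [a1 a2 /andP[a3 a4]]] := valsup_approx n x0.
have [b [b1 b2 /andP[b3 b4]]] := valsup_approx n y0.
have [c [c1 c2 /andP[c3 c4]]] := valsup_approx n xy0.
have ab : O ((x * y) ^+ n.+1 / pF ^ (a + b)).
  rewrite expfzDr ?val_p0 // exprMn invfM mulrACA; exact: valM.
have ab_c : a + b <= c.
  rewrite leNgt; apply/negP => lt; apply: c2; apply: val_pexp ab.
  by rewrite lezD1.
have c_ab : c <= a + b + 2.
  rewrite leNgt; apply/negP => lt.
  have inv (z : F) d : ~ O (z ^+ n.+1 / pF ^ d) -> O (pF ^ d / z ^+ n.+1).
    by move=> hz; case: (val_or (z ^+ n.+1 / pF ^ d)) => //; rewrite invf_div.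
  have := valM (valM (inv _ _ a2) (inv _ _ b2)) c1.
  rewrite (_ : pF ^ (a + 1) / _ * _ * _ = 1 / pF ^ (c - (a + 1) - (b + 1))).
    move=> h; apply: val_p; rewrite -div1r -[pF]expr1z; apply: val_pexp h; lia.
  have [X0 Y0] : x ^+ n.+1 != 0 /\ y ^+ n.+1 != 0 by rewrite !expf_neq0.
  rewrite exprMn !(expfzDr _ _ val_p0) -!invr_expz.
  have E (d : int) : pF ^ d != 0 by rewrite expfz_neq0 // val_p0.
  rewrite !(expfzDr _ _ val_p0) expr1z; have := val_p0.
  move: (E a) (E b) (E c) X0 Y0.
  move: (pF ^ a) (pF ^ b) (pF ^ c) (x ^+ _) (y ^+ _) pF => A B C X Y P ????? ?.
  by field; do ?[apply/andP; split].
rewrite ler_norml; move: ab_c c_ab; rewrite -!(ler_int R) !rmorphD /= => ab_c c_ab.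
have n0 : 0 < n.+1%:R :> R by rewrite ltr0Sn.
move: a3 a4 b3 b4 c3 c4; rewrite !ler_pdivrMr // !ler_pdivlMr // => a3 a4 b3 b4 c3 c4.
rewrite -mulNr ler_pdivrMr //.
clear -ab_c c_ab a3 a4 b3 b4 c3 c4; lra.
Qed.

Hypothesis p_gt0 : (0 < p)%N.
Let pR0 : 0 < p%:R :> R. Proof. by rewrite ltr0n. Qed.

Definition valabs (x : F) : R := if x == 0 then 0 else exp.powR p%:R (- valsup x).

Lemma valsup_ge0 x : O x -> x != 0 -> 0 <= valsup x.
Proof.
move=> h x0; have [a [a1 a2 /andP[a3 _]]] := valsup_approx 0 x0.
apply: le_trans a3; rewrite divr1 ler0z leNgt; apply/negP => lt; apply: a2.
apply: (@val_pexp _ 0); first by rewrite lezD1.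
by rewrite expr0z divr1.
Qed.

Lemma valabs_le1 x : O x -> valabs x <= 1.
Proof.
move=> h; rewrite /valabs; case: eqVneq => [_|x0]; first exact: ler01.
rewrite -[leRHS](exp.powRr0 p%:R).
by apply: exp.ler_powR; rewrite ?ler1n // oppr_le0 valsup_ge0.
Qed.

Lemma valsupp : valsup p%:R = 1.
Proof.
apply/eqP; rewrite -subr_eq0; apply/eqP/(@archi_eq0 _ _ 1) => n.
have e1 : O (pF ^+ n.+1 / pF ^ n.+1).
  by rewrite -exprnP divff ?expf_neq0 ?val_p0 //; exact: val1.
have e2 : ~ O (pF ^+ n.+1 / pF ^ (n.+1%:Z + 1)).
  rewrite expfzDr ?val_p0 // -exprnP invfM mulrA divff ?expf_neq0 ?val_p0 //.
  by rewrite mul1r expr1z; exact: val_p.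
case/andP: (valsup_bounds val_p0 e1 e2).
rewrite rmorphD /= mulrDl divff ?pnatr_eq0 // => h1 h2.
by rewrite ger0_norm ?subr_ge0 // lerBlDr addrC.
Qed.

Lemma valabs_p : valabs p%:R = p%:R^-1.
Proof.
by rewrite /valabs (negPf val_p0) valsupp exp.powR_inv1 // ltW.
Qed.

Lemma valabsM : {morph valabs : x y / x * y}.
Proof.
move=> x y; rewrite /valabs mulf_eq0; case: (eqVneq x 0) => [_|x0] /=; first by rewrite mul0r.
case: (eqVneq y 0) => [_|y0] /=; first by rewrite mulr0.
by rewrite valsupM // opprD exp.powRD // (gt_eqF pR0) implybT.
Qed.

Lemma valabs_ultrametric : ultrametric_absval valabs.
Proof.
have ge0 x : 0 <= valabs x.
  by rewrite /valabs; case: ifP => // _; exact: exp.powR_ge0.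
have main x z : O z -> valabs (x * (1 + z)) <= valabs x.
  move=> h; rewrite valabsM -[leRHS]mulr1 ler_wpM2l //.
  by apply: valabs_le1; apply: valD => //; exact: val1.
split=> // [x||x y].
- rewrite /valabs; case: eqVneq => // x0; split=> [h|/eqP].
    by have := exp.powR_gt0 (- valsup x) pR0; rewrite h ltxx.
  by rewrite (negPf x0).
- exact: valabsM.
have [->|x0] := eqVneq x 0; first by rewrite add0r le_max lexx orbT.
have [->|y0] := eqVneq y 0; first by rewrite addr0 le_max lexx.
rewrite le_max; case: (val_or (y / x)) => h; apply/orP; [left|right].
  by have := main x _ h; rewrite mulrDr mulr1 mulrC divfK.
by have := main y _ h; rewrite invf_div mulrDr mulr1 [y * (_ / _)]mulrC divfK // addrC.
Qed.
End ValuationRing.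

Section Ratr.
Variables (F : fieldType) (F0 : [pchar F] =i pred0).

Lemma natf_eq0 n : (n%:R == 0 :> F) = (n == 0)%N.
Proof. by have /pcharf0P := F0. Qed.

Lemma intf_eq0 (z : int) : (z%:~R == 0 :> F) = (z == 0).
Proof.
case: z => n; first by rewrite -pmulrn natf_eq0.
by rewrite NegzE mulrNz oppr_eq0 -pmulrn natf_eq0.
Qed.

Lemma ratr_frac (a d : int) : d != 0 -> ratr (a%:~R / d%:~R) = a%:~R / d%:~R :> F.
Proof.
move=> d0; set x := _ / _; have : numq x * d = a * denq x.
  by apply: (@intr_inj rat); rewrite !rmorphM /= numqE /x mulrAC divfK ?intr_eq0.
move/(congr1 (fun z : int => z%:~R : F)); rewrite !rmorphM => /= E.
by apply/eqP; rewrite /ratr eqr_div ?intf_eq0 ?denq_eq0 // E.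
Qed.

Fact ratr_pchar0_zmod : zmod_morphism (@ratr F).
Proof.
move=> x y; have dx := denq_neq0 x; have dy := denq_neq0 y.
have -> : x - y = (numq x * denq y - numq y * denq x)%:~R / (denq x * denq y)%:~R.
  by rewrite rmorphB !rmorphM /= !numqE; field; rewrite !intr_eq0 dx dy.
rewrite ratr_frac ?mulf_neq0 // /ratr rmorphB !rmorphM /=; field.
by rewrite !intf_eq0 dx dy.
Qed.

Fact ratr_pchar0_monoid : monoid_morphism (@ratr F).
Proof.
split=> [|x y]; first by rewrite /ratr divr1.
have dx := denq_neq0 x; have dy := denq_neq0 y.
have -> : x * y = (numq x * numq y)%:~R / (denq x * denq y)%:~R.
  by rewrite !rmorphM /= !numqE; field; rewrite !intr_eq0 dx dy.
rewrite ratr_frac ?mulf_neq0 // /ratr !rmorphM /=; field.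
by rewrite !intf_eq0 dx dy.
Qed.

Definition ratf & [pchar F] =i pred0 : rat -> F := @ratr F.
HB.instance Definition _ := GRing.isZmodMorphism.Build rat F (ratf F0) ratr_pchar0_zmod.
HB.instance Definition _ := GRing.isMonoidMorphism.Build rat F (ratf F0) ratr_pchar0_monoid.

Variables (R : realType) (p : nat) (p_pr : prime p) (v : F -> R).
Hypothesis vU : ultrametric_absval v.
Hypothesis vp : v p%:R = p%:R^-1.
Let vA := ultrametric_is_absval vU.
Let p1 : p%:R^-1 < 1 :> R.
Proof. by rewrite invf_lt1 ?ltr1n ?ltr0n ?prime_gt0 ?prime_gt1. Qed.

Lemma ultra_coprime n : coprime p n -> v n%:R = 1.
Proof.
move=> cop; have [|a b ab _] := @egcdnP n p; first by case: n cop => //; rewrite /coprime gcdn0 => /eqP E; move: p_pr; rewrite E.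
move: ab; rewrite gcdnC (eqP cop) => ab.
have E : v (n%:R * a%:R) = 1.
  rewrite -natrM mulnC ab natrD -[RHS](absval1 vA); apply: ultra_eq => //.
  rewrite addrK absval1 // natrM absvalM // vp.
  by apply: le_lt_trans p1; rewrite ler_piMl ?invr_ge0 ?ler0n // ultra_nat_le1.
apply/eqP; rewrite eq_le ultra_nat_le1 //= -[leLHS]E absvalM //.
by rewrite ler_piMr ?absval_ge0 // ultra_nat_le1.
Qed.

Lemma ultra_nat n : (0 < n)%N -> v n%:R = p%:R ^- logn p n.
Proof.
move=> n0; have [m cop E] := pfactor_coprime p_pr n0.
by rewrite {1}E natrM natrX absvalM // absvalX // ultra_coprime // mul1r vp exprVn.
Qed.

Lemma ultra_rat q : v (ratr q) = padic_abs R p q.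
Proof.
rewrite /padic_abs; case: eqVneq => [->|q0].
  by rewrite (raddf0 (ratf F0)) absval0.
have pR : p%:R != 0 :> R by rewrite pnatr_eq0 -lt0n prime_gt0.
have vabsz (z : int) : v z%:~R = v `|z|%N%:R.
  by case: z => n //; rewrite NegzE mulrNz absvalN.
rewrite /ratr absvalM // absvalV // !vabsz !ultra_nat ?absz_gt0 ?denq_eq0 ?numq_eq0 //.
by rewrite invrK expfzDr // -invr_expz mulrC -exprnP.
Qed.
End Ratr.

Definition integral_coefs (F : comNzRingType) (A : F -> Prop) (x : F) :=
  exists q : {poly F}, [/\ q \is monic, forall i, A q`_i & root q x].

Lemma integral_mem (F : fieldType) (O : F -> Prop) (x : F) :
  is_subring O -> O x \/ O x^-1 -> integral_coefs O x -> O x.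
Proof.
move=> OP [//|hi] [q [qm qO /rootP qx]].
have [->|x0] := eqVneq x 0; first exact: subring0.
case E: (size q) (size_poly_eq0 q) => [|d] qn0.
  by move: qn0; rewrite eqxx => /esym/eqP h; move: qm; rewrite h monicE lead_coef0 eq_sym oner_eq0.
clear qn0; case: d E => [|d] E.
  have := qx; rewrite [q]size1_polyC ?E // hornerC.
  move/monicP: qm; rewrite lead_coefE E /= => -> /eqP; by rewrite oner_eq0.
have -> : x = - \sum_(i < d.+1) q`_i * x^-1 ^+ (d - i).
  apply: (mulIf (expf_neq0 d x0)); rewrite -exprS mulNr mulr_suml.
  move: qx; rewrite horner_coef E big_ord_recr /=.
  move/monicP: qm; rewrite lead_coefE E /= => -> /eqP.
  rewrite mul1r addrC addr_eq0 => /eqP ->; congr (- _).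
  apply: eq_bigr => i _; rewrite -mulrA; congr (_ * _).
  have -> : x ^+ d = x ^+ (d - i) * x ^+ i by rewrite -exprD subnK // -ltnS.
  by rewrite exprVn mulKf // expf_neq0.
apply: subringN => //; apply: subring_sum => // i _.
by apply: subringM => //; apply: subringX.
Qed.

Section MaximalSubring.
Variables (F : fieldType) (p : nat) (A : F -> Prop).
Hypotheses (AP : is_subring A) (Ap : ~ A p%:R^-1).

Definition adjoin (O : F -> Prop) (x y : F) :=
  exists q : {poly F}, (forall i, O q`_i) /\ y = q.[x].

Lemma adjoin_subring O x : is_subring O -> is_subring (adjoin O x).
Proof.
move=> OP; split.
- exists 1; rewrite hornerC; split=> // i; rewrite coef1.
  by case: (_ == _); [exact: subring1 | exact: subring0].
- move=> _ _ [q [qO ->]] [r [rO ->]]; exists (q - r); rewrite hornerD hornerN.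
  by split=> // i; rewrite coefB; exact: subringB.
- move=> _ _ [q [qO ->]] [r [rO ->]]; exists (q * r); rewrite hornerM.
  by split=> // i; rewrite coefM; apply: subring_sum => // j _; exact: subringM.
Qed.

Lemma adjoin_sub O x y : is_subring O -> O y -> adjoin O x y.
Proof.
move=> OP Oy; exists y%:P; rewrite hornerC; split=> // i; rewrite coefC.
by case: (_ == _) => //; exact: subring0.
Qed.

Lemma adjoin_gen O x : is_subring O -> adjoin O x x.
Proof.
move=> OP; exists 'X; rewrite hornerX; split=> // i; rewrite coefX.
by case: (_ == _); [exact: subring1 | exact: subring0].
Qed.

Lemma maximal_subring : exists O : F -> Prop,
  [/\ is_subring O, forall x, A x -> O x, ~ O p%:R^-1 &
      forall x, ~ O x -> adjoin O x p%:R^-1].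
Proof.
pose good (B : F -> Prop) := [/\ is_subring B, forall x, A x -> B x & ~ B p%:R^-1].
pose P (B : F -> Prop) := (forall x, ~ B x) \/ good B.
have [|E [PE maxE]] := @classical_sets.Zorn_bigcup F P.
  move=> G GP tot; case: (pselect (exists2 X, G X & exists x, X x)); last first.
    by move=> nE; left=> x [X GX Xx]; apply: nE; exists X => //; exists x.
  have gd X x : G X -> X x -> good X.
    by move=> GX Xx; case: (GP _ GX) => // /(_ x).
  move=> [X0 GX0 [x0 X0x0]]; right.
  have [[X01 _ _] AX0 _] := gd _ _ GX0 X0x0.
  have pair x y : classical_sets.bigcup G id x -> classical_sets.bigcup G id y ->
      exists X, [/\ G X, is_subring X, X x & X y].
    move=> [X GX Xx] [Y GY Yy]; case: (tot _ _ GX GY) => sub.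
      by exists Y; split=> //; [case: (gd _ _ GY Yy) | exact: sub].
    by exists X; split=> //; [case: (gd _ _ GX Xx) | exact: sub].
  split.
  - split; first by exists X0.
      by move=> x y hx hy; have [X [GX sX Xx Xy]] := pair _ _ hx hy; exists X => //; exact: subringB.
    by move=> x y hx hy; have [X [GX sX Xx Xy]] := pair _ _ hx hy; exists X => //; exact: subringM.
  - by move=> x Ax; exists X0 => //; exact: AX0.
  - by move=> [X GX Xp]; case: (gd _ _ GX Xp) => _ _ /(_ Xp).
have {PE} [Esub AE Ep] : good E.
  case: PE => // E0; exfalso; apply: (maxE A); last by right; split.
  split=> [x /E0 //|/(_ 1 (subring1 AP)) /E0 //].
exists E; split=> // x nEx; apply: contrapT => np.
apply: (maxE (adjoin E x)).
  split=> [y Ey|]; first exact: adjoin_sub.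
  by move/(_ x (adjoin_gen _ Esub)).
right; split=> //; first exact: adjoin_subring.
by move=> y /AE Ey; exact: adjoin_sub.
Qed.

Hypothesis p0 : p%:R != 0 :> F.

Lemma maximal_subring_valuation O : is_subring O -> ~ O p%:R^-1 ->
  (forall x, ~ O x -> adjoin O x p%:R^-1) -> forall x, O x \/ O x^-1.
Proof.
move=> OP Op maxO.
have unit1 a : O a -> O (1 - p%:R * a)^-1.
  move=> Oa; set u := 1 - _; have Ou : O u.
    by apply: subringB => //; [exact: subring1 | apply: subringM => //; exact: subring_nat].
  have [u0|u0] := eqVneq u 0; first by rewrite u0 invr0; exact: subring0.
  apply: contrapT => /maxO [q [qO]]; rewrite horner_coef => E.
  apply: Op; have [b Ob ub] : exists2 b, O b & u ^+ size q = 1 + p%:R * b.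
    elim: (size q) => [|n [b Ob IH]]; first by exists 0; rewrite ?mulr0 ?addr0 //; exact: subring0.
    exists (u * b - a).
      by apply: subringB => //; exact: subringM.
    by rewrite exprS IH mulrDr mulr1 mulrBr {1}/u; ring.
  have h : O (u ^+ size q / p%:R).
    rewrite E mulr_sumr; apply: subring_sum => // i _.
    rewrite mulrCA; apply: subringM => //.
    have -> : u ^+ size q = u ^+ (size q - i) * u ^+ i by rewrite -exprD subnK // ltnW.
    by rewrite -mulrA -exprMn divff // expr1n mulr1; apply: subringX.
  rewrite (_ : p%:R^-1 = u ^+ size q / p%:R - b); first by apply: subringB.
  by rewrite ub mulrDl div1r mulrAC divff // mul1r addrK.
pose D x n := exists2 q : nat -> F, forall i, O (q i) & p%:R^-1 = \sum_(i < n.+1) q i * x ^+ i.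
have Dex x : ~ O x -> exists n, D x n.
  move=> /maxO [q [qO E]]; exists (size q), (fun i => q`_i) => //.
  by rewrite E (@horner_coef_wide _ (size q).+1).
have D0 x : ~ D x 0.
  by move=> [q qO]; rewrite big_ord1 expr0 mulr1 => E; apply: Op; rewrite E.
have step x n m : (m <= n)%N -> x != 0 -> D x n -> D x^-1 m -> exists2 k, (k < n)%N & D x k.
  case: n => [|n] mn x0 hn; first by case: (D0 _ hn).
  case: hn => q qO qE; move=> [r0 r0O]; pose r i := if (i <= m)%N then r0 i else 0.
  have rO i : O (r i) by rewrite /r; case: ifP => // _; exact: subring0.
  rewrite (_ : \sum_(i < m.+1) _ = \sum_(i < n.+2) r i * x^-1 ^+ i); last first.
    rewrite (big_ord_widen n.+2 (fun i => r0 i * x^-1 ^+ i)) // big_mkcond.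
    apply: eq_bigr => i _; rewrite /r ltnS; case: ifP => //; by rewrite mul0r.
  move=> rE.
  pose w := (1 - p%:R * r 0)^-1.
  have w0 : 1 - p%:R * r 0 != 0.
    apply/eqP => h; apply: Op; rewrite (_ : p%:R^-1 = r 0) //.
    by apply: (mulfI p0); rewrite divff //; apply/eqP; rewrite -subr_eq0 h.
  have xE : x ^+ n.+1 = w * p%:R * \sum_(i < n.+1) r (n.+1 - i)%N * x ^+ i.
    have : x ^+ n.+1 = p%:R * \sum_(i < n.+2) r (n.+1 - i)%N * x ^+ i.
      apply: (mulfI (invr_neq0 p0)); rewrite mulKf // {1}rE mulr_suml.
      rewrite [RHS](reindex_inj rev_ord_inj) /=; apply: eq_bigr => i _.
      rewrite subSS -mulrA subKn; last by rewrite -ltnS.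
      congr (_ * _).
      have -> : x ^+ n.+1 = x ^+ (n.+1 - i) * x ^+ i by rewrite -exprD subnK // -ltnS.
      by rewrite exprVn mulrC mulfK // expf_neq0.
    rewrite big_ord_recr /= subnn mulrDr => h.
    apply: (mulfI w0); rewrite mulrA mulrA /w divff // mul1r.
    by rewrite mulrBl mul1r {1}h -mulrA addrK.
  exists n => //; exists (fun i => q i + q n.+1 * (w * p%:R) * r (n.+1 - i)%N).
    move=> i; apply: subringD => //; apply: subringM => //; apply: subringM => //.
    by apply: subringM => //; [exact: unit1 | exact: subring_nat].
  rewrite qE big_ord_recr /= xE mulrA mulr_sumr -big_split /=.
  by apply: eq_bigr => i _; rewrite mulrDl -!mulrA.
move=> x; apply: contrapT => nO.
have nx : ~ O x by move=> h; apply: nO; left.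
have ny : ~ O x^-1 by move=> h; apply: nO; right.
have x0 : x != 0 by apply/eqP => h; apply: nx; rewrite h; exact: subring0.
have minD y : ~ O y -> exists2 n, D y n & forall m, D y m -> (n <= m)%N.
  move=> /Dex [n0 hn0].
  have ex : exists n, `[< D y n >] by exists n0; apply/asboolP.
  case: (ex_minnP ex) => n /asboolP hn mn; exists n => // m hm.
  by apply: mn; apply/asboolP.
have [n hn mn] := minD _ nx; have [m hm mm] := minD _ ny.
case/orP: (leq_total m n) => le.
  have [k kn /mn] := step _ _ _ le x0 hn hm.
  by rewrite leqNgt kn.
have hn' : D x^-1^-1 n by rewrite invrK.
have [k kn /mm] := step _ _ _ le (invr_neq0 x0) hm hn'.
by rewrite leqNgt kn.
Qed.

Lemma pvaluation_ring_exists :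
  (forall x, exists n, integral_coefs A (p%:R ^+ n * x)) ->
  exists O : F -> Prop, pvaluation_ring p O /\
    forall x, integral_coefs A x -> O x.
Proof.
move=> arch; have [O [OP AO Op maxO]] := maximal_subring.
have Ov := maximal_subring_valuation OP Op maxO.
have int x : integral_coefs A x -> O x.
  move=> [q [qm qA qx]]; apply: integral_mem => //; exists q; split=> // i.
  exact: AO.
exists O; split=> //; split=> // x; have [n h] := arch x; exists n; exact: int.
Qed.
End MaximalSubring.

Section MmapMuni.
Variables (n : nat) (R : comNzRingType) (S : comNzRingType).

Lemma mmap_muni (f : {rmorphism R -> S}) (h : 'I_n.+1 -> S) (P : {mpoly R[n.+1]}) :
  mmap f h P = (map_poly (mmap f (fun i => h (widen_ord (leqnSn n) i))) (muni P)).[h ord_max].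
Proof.
rewrite muniE raddf_sum /= horner_sum; apply: eq_bigr => m _.
rewrite map_polyZ hornerZ map_polyXn hornerXn /= mmapZ mmapX /mmap1 big_ord_recr /= mulrA.
congr (_ * _ * _); apply: eq_bigr => i _; rewrite mnmE; congr (h _ ^+ m _); exact: val_inj.
Qed.
End MmapMuni.

Lemma muni_eq0 (n : nat) (R : comNzRingType) (P : {mpoly R[n.+1]}) : muni P = 0 -> P = 0.
Proof.
move=> E; have := mmap_muni (@mpolyC n.+1 R) (fun i => 'X_i) P.
rewrite E map_poly0 horner0 => <-; rewrite [LHS]mpolyE; apply: eq_bigr => m _.
by rewrite mul_mpolyC mmap1_id.
Qed.

Lemma mpoly_nonvanishing (n : nat) (F : idomainType) (P : {mpoly F[n]})
    (S : 'I_n -> nat -> F) : (forall i, injective (S i)) -> P != 0 ->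
  exists j : 'I_n -> nat, P.@[fun i => S i (j i)] != 0.
Proof.
elim: n P S => [|n IH] P S inj P0.
  exists (fun=> 0%N); apply: contra P0 => /eqP E.
  have Pc : P = (P@_0%MM)%:MP.
    apply/mpolyP => m; rewrite mcoeffC; have -> : m = 0%MM by apply/mnmP; case.
    by rewrite eqxx mulr1.
  by move: E; rewrite Pc mevalC => ->; rewrite mpolyC0.
have mP0 : muni P != 0 by apply: contra P0 => /eqP /muni_eq0 ->.
have [|j hj] := IH (lead_coef (muni P)) (fun i => S (widen_ord (leqnSn n) i)) (fun i => inj _).
  by rewrite lead_coef_eq0.
pose q := map_poly (meval (fun i => S (widen_ord (leqnSn n) i) (j i))) (muni P).
have q0 : q != 0.
  apply/eqP => /polyP /(_ (size (muni P)).-1); rewrite coef_map coef0 => E.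
  by move: hj; rewrite lead_coefE E eqxx.
have [m hm] : exists m, q.[S ord_max m] != 0.
  apply: contrapT => no.
  have := @max_poly_roots _ q (map (S ord_max) (iota 0 (size q))) q0.
  rewrite map_inj_uniq // iota_uniq size_map size_iota ltnn => /(_ _ isT) h.
  suff : false by []; apply: h; apply/allP => _ /mapP[m _ ->].
  by apply/rootP/eqP/negPn/negP => h; apply: no; exists m.
exists (fun i => if unlift ord_max i is Some i' then j i' else m).
rewrite [meval _ _](_ : _ = q.[S ord_max m]) //.
rewrite /meval (mmap_muni _ _ P) unlift_none; congr (_.[_]).
apply/polyP => i; rewrite !coef_map /= /meval; apply: eq_bigr => u _.
congr (_ * _); apply: mmap1_eq => i'.
have -> : widen_ord (leqnSn n) i' = lift ord_max i' by apply: val_inj; rewrite /= /bump leqNgt ltn_ord.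
by rewrite liftK.
Qed.

Section Lipschitz.
Variables (K : realType) (F : fieldType) (v : F -> K).
Hypothesis vU : ultrametric_absval v.
Let vA := ultrametric_is_absval vU.

Lemma ultraM_lip (a b c d : F) e : v a <= 1 -> v d <= 1 ->
  v (a - b) <= e -> v (c - d) <= e -> v (a * c - b * d) <= e.
Proof.
move=> ha hd h1 h2; rewrite (_ : a * c - b * d = a * (c - d) + (a - b) * d); last by ring.
apply: ultraD_le => //; rewrite absvalM //.
  by apply: le_trans h2; rewrite ler_piMl // absval_ge0.
by apply: le_trans h1; rewrite ler_piMr // absval_ge0.
Qed.

Lemma absvalX_le1 (a : F) n : v a <= 1 -> v (a ^+ n) <= 1.
Proof. by move=> h; rewrite absvalX // exprn_ile1 // absval_ge0. Qed.

Lemma ultraX_lip (a b : F) e n : v a <= 1 -> v b <= 1 ->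
  v (a - b) <= e -> v (a ^+ n - b ^+ n) <= e.
Proof.
move=> ha hb h; have e0 := le_trans (absval_ge0 vA _) h.
elim: n => [|n IH]; first by rewrite !expr0 subrr absval0.
by rewrite !exprS; apply: ultraM_lip => //; exact: absvalX_le1.
Qed.

Lemma mmap1_le1 n (a : 'I_n -> F) m : (forall i, v (a i) <= 1) -> v (mmap1 a m) <= 1.
Proof.
move=> ha; rewrite /mmap1; elim/big_ind: _; first by rewrite absval1.
  by move=> x y hx hy; rewrite absvalM // mulr_ile1 ?absval_ge0.
by move=> i _; exact: absvalX_le1.
Qed.

Lemma mmap1_lip n (a b : 'I_n -> F) m e : 0 <= e ->
  (forall i, v (a i) <= 1) -> (forall i, v (b i) <= 1) ->
  (forall i, v (a i - b i) <= e) -> v (mmap1 a m - mmap1 b m) <= e.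
Proof.
move=> e0 ha hb hab; rewrite /mmap1.
pose T x y := [/\ v x <= 1, v y <= 1 & v (x - y) <= e].
suff [] : T (\prod_(i < n) a i ^+ m i) (\prod_(i < n) b i ^+ m i) by [].
elim/big_ind2: _.
- by split; rewrite ?absval1 // subrr absval0.
- move=> x x' y y' [h1 h2 h3] [g1 g2 g3]; split.
  + by rewrite absvalM // mulr_ile1 ?absval_ge0.
  + by rewrite absvalM // mulr_ile1 ?absval_ge0.
  + exact: ultraM_lip.
- by move=> i _; split; [exact: absvalX_le1..|exact: ultraX_lip].
Qed.

Lemma mmap_le n (R : nzRingType) (f : R -> F) (a : 'I_n -> F) (P : {mpoly R[n]}) M :
  0 <= M -> (forall m, v (f P@_m) <= M) -> (forall i, v (a i) <= 1) ->
  v (mmap f a P) <= M.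
Proof.
move=> M0 hM ha; apply: ultra_sum_le => // m _; rewrite absvalM //.
by apply: le_trans (hM m); rewrite ler_piMr ?absval_ge0 // mmap1_le1.
Qed.

Lemma mmap_lip n (R : nzRingType) (f : R -> F) (a b : 'I_n -> F) (P : {mpoly R[n]}) M e :
  0 <= e -> 0 <= M -> (forall m, v (f P@_m) <= M) ->
  (forall i, v (a i) <= 1) -> (forall i, v (b i) <= 1) ->
  (forall i, v (a i - b i) <= e) -> v (mmap f a P - mmap f b P) <= M * e.
Proof.
move=> e0 M0 hM ha hb hab; rewrite -sumrB; apply: ultra_sum_le => //; first exact: mulr_ge0.
move=> m _; rewrite -mulrBr absvalM //; apply: ler_pM; rewrite ?absval_ge0 //.
exact: mmap1_lip.
Qed.

Lemma mcoeff_bound n (R : nzRingType) (f : R -> F) (P : {mpoly R[n]}) : f 0 = 0 ->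
  exists2 M, 0 < M & forall m, v (f P@_m) <= M.
Proof.
move=> f0; exists (1 + \sum_(m <- msupp P) v (f P@_m)).
  by rewrite ltr_pwDl // sumr_ge0 // => *; exact: absval_ge0.
move=> m; case: (boolP (m \in msupp P)) => [h|/memN_msupp_eq0 ->]; last first.
  by rewrite f0 absval0 // addr_ge0 // sumr_ge0 // => *; exact: absval_ge0.
rewrite (big_rem m) //= addrCA lerDl addr_ge0 // sumr_ge0 // => *; exact: absval_ge0.
Qed.
End Lipschitz.

Lemma prime_dvd_denq (p : nat) (q : rat) : prime p -> (p %| `|denq q|)%N -> ~~ (p %| `|numq q|)%N.
Proof.
move=> p_pr pd; apply/negP => pn; have := coprime_num_den q; rewrite /coprime => /eqP E.
have : (p %| 1)%N by rewrite -E dvdn_gcd pn pd.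
by rewrite dvdn1 => /eqP E1; move: p_pr; rewrite E1.
Qed.

Section PadicRat.
Variables (R : realType) (p : nat) (p_pr : prime p).

Definition padic_int (q : rat) : Prop :=
  exists (a : int) (d : nat), ~~ (p %| d)%N /\ q = a%:~R / d%:R.

Lemma padic_int_int (a : int) : padic_int a%:~R.
Proof. by exists a, 1%N; rewrite divr1 dvdn1; split=> //; case: (p) p_pr => [|[]]. Qed.

Lemma padic_int_ring : pvaluation_ring p padic_int.
Proof.
have dn0 (d : nat) : ~~ (p %| d)%N -> d%:R != 0 :> rat.
  by move=> h; rewrite pnatr_eq0; apply: contraNneq h => ->; rewrite dvdn0.
split.
- split; first exact: (padic_int_int 1).
    move=> _ _ [a [d [hd ->]]] [b [e [he ->]]].
    exists (a * e%:Z - b * d%:Z), (d * e)%N; split; first by rewrite Euclid_dvdM // negb_or hd.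
    rewrite natrM rmorphB !rmorphM /=; field; by rewrite !dn0.
  move=> _ _ [a [d [hd ->]]] [b [e [he ->]]].
  exists (a * b), (d * e)%N; split; first by rewrite Euclid_dvdM // negb_or hd.
  by rewrite natrM !rmorphM /=; field; rewrite !dn0.
- move=> q; case: (boolP (p %| `|denq q|)%N) => h; last first.
    left; exists (numq q), `|denq q|%N; split=> //.
    by rewrite -{1}[q]divq_num_den; congr (_ / _); case: (denq q) (denq_gt0 q).
  right; have h2 := prime_dvd_denq p_pr h.
  have -> : q^-1 = (denq q)%:~R / (numq q)%:~R by rewrite -[in LHS](divq_num_den q) invf_div.
  case: (numq q) h2 => n h2; first by exists (denq q), n.
  exists (- denq q), n.+1; split=> //.
  by rewrite NegzE mulrNz invrN rmorphN /= mulrN mulNr -pmulrn.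
- move=> [a [d [hd E]]]; have p0 : p%:R != 0 :> rat by rewrite pnatr_eq0 -lt0n prime_gt0.
  have /eqP : d%:R = a%:~R * p%:R :> rat.
    by apply: (mulIf (invr_neq0 p0)); rewrite mulfK // E mulrC divfK // dn0.
  rewrite -[d%:R]/(d%:Z%:~R) -[p%:R]/(p%:Z%:~R) -rmorphM eqr_int => /eqP dE.
  move: hd; rewrite -[d]/(`|d%:Z|%N) dE abszM /= dvdn_mull //.
- move=> q; exists (logn p `|denq q|); have d0 : (0 < `|denq q|)%N by rewrite absz_gt0 denq_eq0.
  have [m cop E] := pfactor_coprime p_pr d0.
  exists (numq q), m; split; first by rewrite -prime_coprime.
  rewrite -{2}[q]divq_num_den.
  have -> : (denq q)%:~R = `|denq q|%N%:R :> rat by case: (denq q) (denq_gt0 q).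
  rewrite {2}E natrM natrX mulrCA; congr (_ * _).
  have m0 : m%:R != 0 :> rat by apply: dn0; rewrite -prime_coprime.
  have p0 : p%:R != 0 :> rat by rewrite pnatr_eq0 -lt0n prime_gt0.
  by rewrite invfM mulrCA divff ?mulr1 // expf_neq0.
Qed.

Lemma rat_pchar0 : [pchar rat] =i pred0. Proof. exact: pchar_num. Qed.

Lemma ratr_rat q : ratr q = q :> rat.
Proof. by rewrite /ratr divq_num_den. Qed.

Lemma padic_abs_ultrametric : ultrametric_absval (padic_abs R p).
Proof.
have U := valabs_ultrametric padic_int_ring R (prime_gt0 p_pr).
have E : padic_abs R p =1 valabs p padic_int R.
  move=> q; rewrite -(ultra_rat rat_pchar0 p_pr U) ?ratr_rat //.
  exact: valabs_p padic_int_ring R.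
by have -> : padic_abs R p = valabs p padic_int R by apply/funext.
Qed.

Lemma padic_abs_p : padic_abs R p p%:R = p%:R^-1.
Proof.
have U := valabs_ultrametric padic_int_ring R (prime_gt0 p_pr).
have V : valabs p padic_int R p%:R = p%:R^-1.
  exact: valabs_p padic_int_ring R.
by rewrite -(ultra_rat rat_pchar0 p_pr U) // ratr_rat.
Qed.

Lemma padic_abs_int_le1 (z : int) : padic_abs R p z%:~R <= 1.
Proof.
have U := padic_abs_ultrametric; have V := ultrametric_is_absval U.
by case: z => n; rewrite ?NegzE ?mulrNz ?absvalN // ultra_nat_le1.
Qed.

Lemma padic_abs_int_dvd (z : int) e : (p%:Z ^+ e %| z)%Z -> padic_abs R p z%:~R <= p%:R^-1 ^+ e.
Proof.
have U := padic_abs_ultrametric; have V := ultrametric_is_absval U.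
move=> /dvdzP[m ->]; rewrite rmorphM /= absvalM // rmorphXn /= absvalX //.
rewrite -[p%:~R]/(p%:R) padic_abs_p ler_piMl ?padic_abs_int_le1 //.
by rewrite exprn_ge0 // invr_ge0 ler0n.
Qed.
End PadicRat.

Lemma padic_abs_le1_large (R : realType) (q : rat) :
  exists B, forall p, prime p -> (B < p)%N -> padic_abs R p q <= 1.
Proof.
exists `|denq q|%N => p p_pr lt; rewrite /padic_abs; case: ifP => // q0.
rewrite (_ : logn p `|denq q| = 0%N); last first.
  apply/eqP; rewrite -leqn0 leqNgt logn_gt0 mem_primes p_pr absz_gt0 denq_eq0 /=.
  by apply/negP => /dvdn_leq; rewrite absz_gt0 denq_eq0 leqNgt lt => /(_ isT).
rewrite sub0r -invr_expz -exprnP invf_le1 ?exprn_gt0 ?ltr0n ?prime_gt0 //.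
by rewrite exprn_ege1 // ler1n prime_gt0.
Qed.

Lemma padic_abs_le1_large_seq (R : realType) (s : seq rat) :
  exists B, forall p, prime p -> (B < p)%N -> forall q, q \in s -> padic_abs R p q <= 1.
Proof.
elim: s => [|q s [B IH]]; first by exists 0%N.
have [B' h] := padic_abs_le1_large R q.
exists (maxn B B') => p p_pr; rewrite gtn_max => /andP[h1 h2] x.
by rewrite inE => /orP[/eqP ->|hx]; [exact: h|exact: IH].
Qed.

(** * Specialization of transcendentals to p-adic integers *)

Section Sequence.
Variables (R : realType) (p : nat) (p_pr : prime p) (n : nat) (c0 : 'I_n -> int).

Let w := padic_abs R p.
Let wU : ultrametric_absval w. Proof. exact: padic_abs_ultrametric. Qed.
Let wA := ultrametric_is_absval wU.

Definition int_eval (P : {mpoly rat[n]}) (c : 'I_n -> int) : rat := P.@[fun i => (c i)%:~R].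

Lemma int_eval_lip P M e (c d : 'I_n -> int) : 0 <= M -> (forall m, w P@_m <= M) ->
  (forall i, (p%:Z ^+ e %| c i - d i)%Z) ->
  w (int_eval P c - int_eval P d) <= M * p%:R^-1 ^+ e.
Proof.
move=> M0 hM h; apply: (mmap_lip wU) => //.
- by rewrite exprn_ge0 // invr_ge0 ler0n.
- by move=> i; exact: padic_abs_int_le1.
- by move=> i; exact: padic_abs_int_le1.
- by move=> i; rewrite -rmorphB; exact: padic_abs_int_dvd.
Qed.

Lemma small_pow (eps : R) : 0 < eps -> exists e, p%:R^-1 ^+ e < eps.
Proof.
by apply: geometric_small; rewrite ?invr_ge0 // invf_lt1 ?ltr1n ?ltr0n ?prime_gt0 ?prime_gt1.
Qed.

(* One step of the diagonal construction: inside the residue class of [c] modulo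
   [p ^ e] there is a smaller one on which [P] has constant nonzero absolute value. *)
Lemma diagonal_step (P : {mpoly rat[n]}) (c : 'I_n -> int) (e : nat) :
  exists ce : ('I_n -> int) * nat,
  [/\ (e < ce.2)%N, forall i, (p%:Z ^+ e %| ce.1 i - c i)%Z &
   P != 0 -> forall d : 'I_n -> int, (forall i, (p%:Z ^+ ce.2 %| d i - ce.1 i)%Z) ->
     int_eval P d != 0 /\ w (int_eval P d) = w (int_eval P ce.1)].
Proof.
have [->|P0] := eqVneq P 0.
  by exists (c, e.+1); split=> //= i; rewrite subrr dvdz0.
pose S (i : 'I_n) (j : nat) : rat := (c i + p%:Z ^+ e * j%:Z)%:~R.
have [|j hj] := @mpoly_nonvanishing _ _ P S _ P0.
  move=> i a b /intr_inj /addrI /mulfI; rewrite expf_neq0; last by case: (p) p_pr.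
  by move=> /(_ isT) [].
pose d i := c i + p%:Z ^+ e * (j i)%:Z.
have d0 : int_eval P d != 0 by [].
have [M M0 hM] := @mcoeff_bound _ _ _ wU _ _ idfun P erefl.
have wd : 0 < w (int_eval P d) by rewrite absval_gt0.
have [e' he'] := small_pow (divr_gt0 wd M0).
exists (d, maxn e.+1 e'); split=> /=; first by rewrite leq_maxl.
  by move=> i; rewrite /d addrAC subrr add0r dvdz_mulr.
move=> _ d' hd'; have lt : w (int_eval P d' - int_eval P d) < w (int_eval P d).
  apply: le_lt_trans (int_eval_lip (ltW M0) hM hd') _.
  rewrite mulrC -ltr_pdivlMr //; apply: le_lt_trans he'.
  by apply: ler_wiXn2l; rewrite ?invr_ge0 ?ler0n ?leq_maxr // invf_le1 ?ltr0n ?ler1n prime_gt0.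
have E := ultra_eq wU lt; split=> //.
by rewrite -(absval_eq0 wA) E (absval_eq0 wA).
Qed.

Definition mpoly_of_seq (s : seq ('X_{1..n} * rat)) : {mpoly rat[n]} :=
  \sum_(q <- s) q.2 *: 'X_[q.1].

Lemma mpoly_of_seq_surj P : exists s, P = mpoly_of_seq s.
Proof.
exists [seq (m, P@_m) | m <- msupp P].
by rewrite /mpoly_of_seq big_map [LHS]mpolyE.
Qed.

Definition nth_mpoly (l : nat) : {mpoly rat[n]} :=
  if unpickle l is Some s then mpoly_of_seq s else 0.

Lemma nth_mpoly_surj P : exists l, P = nth_mpoly l.
Proof.
have [s ->] := mpoly_of_seq_surj P.
by exists (pickle s); rewrite /nth_mpoly pickleK.
Qed.

Lemma generic_sequence : exists c : nat -> 'I_n -> int,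
  [/\ forall l i, (p%:Z %| c l i - c0 i)%Z,
   forall e, exists L, forall l i, (L <= l)%N -> (p%:Z ^+ e %| c l i - c L i)%Z &
   forall P, P != 0 -> exists L, forall l, (L <= l)%N ->
     int_eval P (c l) != 0 /\ w (int_eval P (c l)) = w (int_eval P (c L))].
Proof.
pose step l (x : ('I_n -> int) * nat) := projT1 (cid (diagonal_step (nth_mpoly l) x.1 x.2)).
have stepP l x : _ := projT2 (cid (diagonal_step (nth_mpoly l) x.1 x.2)).
pose s := fix s l := if l is l'.+1 then step l' (s l') else (c0, 1%N).
have s_gt l : (l < (s l).2)%N.
  elim: l => //= l IH; apply: leq_ltn_trans IH _.
  by case: (stepP l (s l)).
have s_mono l m i : (p%:Z ^+ (s l).2 %| (s (l + m)%N).1 i - (s l).1 i)%Z.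
  elim: m => [|m IH]; first by rewrite addn0 subrr dvdz0.
  rewrite addnS /= -/(s _); set x := s (l + m)%N.
  case: (stepP (l + m)%N x) => _ h _.
  have -> : (step (l + m)%N x).1 i - (s l).1 i =
      ((step (l + m)%N x).1 i - x.1 i) + (x.1 i - (s l).1 i) by rewrite addrA subrK.
  apply: rpredD => //; apply: dvdz_trans (h i); apply: dvdz_exp2l.
  rewrite /x; elim: (m) => [|k IHk]; rewrite ?addn0 // addnS.
  by apply: leq_trans IHk _; apply: ltnW; case: (stepP (l + k)%N (s (l + k)%N)).
exists (fun l => (s l).1); split.
- by move=> l i; have := s_mono 0%N l i; rewrite expr1.
- move=> e; exists e => l i /subnKC <-; apply: dvdz_trans (s_mono _ _ _).
  by apply: dvdz_exp2l; apply: ltnW; exact: s_gt.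
move=> P P0; have [l hl] := nth_mpoly_surj P; exists l.+1 => l' /subnKC <-.
move: P0; rewrite {P}hl => P0.
case: (stepP l (s l)) => _ _ /(_ P0) H; apply: (H (s _).1) => i.
exact: (s_mono l.+1).
Qed.
End Sequence.

Definition rat_closure (R : realType) (F : fieldType) (v : F -> R) (x : F) :=
  forall e, 0 < e -> exists z : rat, v (x - ratr z) < e.

Lemma int_residue (p : nat) (z : int) : (0 < p)%N ->
  exists2 b, (b < p)%N & (p%:Z %| z - b%:Z)%Z.
Proof.
move=> p0; have pz : p%:Z != 0 by rewrite -lt0n in p0 *; case: (p) p0.
exists `|(z %% p%:Z)%Z|%N; first by rewrite -ltz_nat gez0_abs ?modz_ge0 // ltz_pmod.
rewrite gez0_abs ?modz_ge0 // {1}(divz_eq z p%:Z) addrK.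
exact: dvdz_mull.
Qed.

Lemma padic_abs_residue (R : realType) (p : nat) (q : rat) : prime p ->
  padic_abs R p q <= 1 -> exists2 b, (b < p)%N & padic_abs R p (q - b%:R) <= p%:R^-1.
Proof.
move=> p_pr; have wU := padic_abs_ultrametric R p_pr; have wA := ultrametric_is_absval wU.
have [->|q0] := eqVneq q 0.
  by exists 0%N; rewrite ?prime_gt0 // subrr absval0 // invr_ge0 ler0n.
rewrite {1}/padic_abs (negPf q0) => le.
have pd : ~~ (p %| `|denq q|)%N.
  apply/negP => pd; have pn := prime_dvd_denq p_pr pd.
  move: le; rewrite (lognE p `|numq q|) (negPf pn) !andbF subr0 -exprnP leNgt => /negP; apply.
  by rewrite exprn_egt1 ?ltr1n ?prime_gt1 // -lt0n logn_gt0 mem_primes p_pr absz_gt0 denq_eq0.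
have wd : padic_abs R p (denq q)%:~R = 1.
  have -> : (denq q)%:~R = `|denq q|%N%:R :> rat by case: (denq q) (denq_gt0 q).
  apply: (ultra_coprime p_pr wU); first exact: padic_abs_p.
  by rewrite prime_coprime.
have cop : coprimez (denq q) p%:Z.
  by rewrite coprimezE /= coprime_sym prime_coprime.
have [[u u'] /= uu] := coprimezP _ _ cop.
have [b bp hb] := int_residue (numq q * u) (prime_gt0 p_pr).
exists b => //; rewrite -[leLHS]mul1r -{1}wd -absvalM // mulrBr mulrC -numqE.
have -> : (numq q)%:~R - (denq q)%:~R * b%:R =
   (numq q * u' * p%:Z + (numq q * u - b%:Z) * denq q)%:~R :> rat.
  rewrite -[b%:R]/(b%:Z%:~R) -rmorphM -rmorphB; congr _%:~R.
  by rewrite mulrBl -[in LHS](mulr1 (numq q)) -uu; ring.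
rewrite -[leRHS]expr1; apply: padic_abs_int_dvd => //; rewrite expr1.
by apply: rpredD; [exact: dvdz_mull | exact: dvdz_mulr].
Qed.

Section SpecializationRing.
Variables (R : realType) (k : fieldType) (k0 : [pchar k] =i pred0).
Variables (n : nat) (t : 'I_n -> k).
Hypothesis indep : forall P : {mpoly rat[n]}, mmap ratr t P = 0 -> P = 0.
Variables (p : nat) (p_pr : prime p) (c : nat -> 'I_n -> int).

Local Notation w := (padic_abs R p).
Let wU : ultrametric_absval w. Proof. exact: padic_abs_ultrametric. Qed.
Let wA := ultrametric_is_absval wU.
Let phi (P : {mpoly rat[n]}) : k := mmap (ratf k0) t P.

Hypothesis cauchy : forall e, exists L, forall l i, (L <= l)%N -> (p%:Z ^+ e %| c l i - c L i)%Z.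
Hypothesis stable : forall P, P != 0 -> exists L, forall l, (L <= l)%N ->
     int_eval P (c l) != 0 /\ w (int_eval P (c l)) = w (int_eval P (c L)).

Definition eventually_le (P Q : {mpoly rat[n]}) :=
  exists L, forall l, (L <= l)%N -> w (int_eval P (c l)) <= w (int_eval Q (c l)).

(* Elements [P(t) / Q(t)] of [Q(t)] such that [P(c_l) / Q(c_l)] is eventually [p]-integral. *)
Definition spec_ring (x : k) := exists P Q : {mpoly rat[n]},
  [/\ Q != 0, x * phi Q = phi P & eventually_le P Q].

Local Lemma phi_eq0 P : phi P = 0 -> P = 0. Proof. exact: indep. Qed.
Local Lemma phi_neq0 P : P != 0 -> phi P != 0.
Proof. by apply: contraNneq => /phi_eq0 ->. Qed.

Lemma spec_ring_frac P Q : Q != 0 -> eventually_le P Q -> spec_ring (phi P / phi Q).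
Proof. by move=> Q0 h; exists P, Q; rewrite divfK // phi_neq0. Qed.

Lemma spec_ring_subring : is_subring spec_ring.
Proof.
split.
- by exists 1, 1; rewrite mul1r oner_neq0; split=> //; exists 0%N.
- move=> x y [P [Q [Q0 hx [L hL]]]] [P' [Q' [Q0' hy [L' hL']]]].
  exists (P * Q' - P' * Q), (Q * Q'); split; first exact: mulf_neq0.
    by rewrite /phi rmorphB !rmorphM /= -/(phi _) -!/(phi _) -hx -hy; ring.
  exists (maxn L L') => l; rewrite geq_max => /andP[/hL h1 /hL' h2].
  rewrite /int_eval rmorphB !rmorphM /=; rewrite absvalM //.
  apply: ultraB_le => //; rewrite absvalM //; last rewrite mulrC.
    by apply: ler_pM; rewrite ?absval_ge0.
  by apply: ler_pM; rewrite ?absval_ge0.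
- move=> x y [P [Q [Q0 hx [L hL]]]] [P' [Q' [Q0' hy [L' hL']]]].
  exists (P * P'), (Q * Q'); split; first exact: mulf_neq0.
    by rewrite /phi !rmorphM /= -!/(phi _) -hx -hy; ring.
  exists (maxn L L') => l; rewrite geq_max => /andP[/hL h1 /hL' h2].
  by rewrite /int_eval !rmorphM /= !absvalM //; apply: ler_pM; rewrite ?absval_ge0.
Qed.

Local Lemma phi_scale q P : phi (q *: P) = ratr q * phi P.
Proof. by rewrite /phi mmapZ. Qed.
Local Lemma eval_scale q P l : int_eval (q *: P) (c l) = q * int_eval P (c l).
Proof. by rewrite /int_eval mevalZ. Qed.
Local Lemma pk0 : p%:R != 0 :> k.
Proof. by rewrite natf_eq0 // -lt0n prime_gt0. Qed.

Lemma spec_ring_p : ~ spec_ring p%:R^-1.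
Proof.
move=> [P [Q [Q0 E [L hL]]]].
have EQ : Q = p%:R *: P.
  apply/eqP; rewrite -subr_eq0; apply/eqP/phi_eq0.
  by rewrite /phi rmorphB /= -!/(phi _) phi_scale -E ratr_nat mulVKf ?subrr // pk0.
have P0 : P != 0 by apply: contraNneq Q0 => P0; rewrite EQ P0 scaler0.
have [L' hL'] := stable P0; have [e _] := hL' (maxn L L') (leq_maxr _ _).
have := hL (maxn L L') (leq_maxl _ _).
rewrite EQ eval_scale absvalM // padic_abs_p // leNgt => /negP; apply.
by rewrite gtr_pMl ?absval_gt0 // invf_lt1 ?ltr1n ?ltr0n ?prime_gt0 ?prime_gt1.
Qed.

Lemma eventually_bounded P : exists2 M, 0 < M & forall l, w (int_eval P (c l)) <= M.
Proof.
have [M M0 hM] := @mcoeff_bound _ _ _ wU _ _ idfun P erefl.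
exists M => // l; apply: (mmap_le wU) => // [|i]; [exact: ltW | exact: padic_abs_int_le1].
Qed.

Lemma spec_ring_scale P Q : Q != 0 ->
  exists N, forall m, (N <= m)%N -> spec_ring (p%:R ^+ m * (phi P / phi Q)).
Proof.
move=> Q0; have [M M0 hM] := eventually_bounded P; have [L hL] := stable Q0.
have [LQ0 _] := hL L (leqnn L).
have wQ : 0 < w (int_eval Q (c L)) by rewrite absval_gt0.
have [N hN] := small_pow p_pr (divr_gt0 wQ M0).
exists N => m Nm; have -> : p%:R ^+ m * (phi P / phi Q) = phi (p%:R ^+ m *: P) / phi Q.
  by rewrite phi_scale (rmorphXn (ratf k0)) /= mulrA; congr (_ * _ * _); rewrite /ratf ratr_nat.
apply: spec_ring_frac => //; exists L => l /hL [_ ->].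
rewrite eval_scale absvalM // absvalX // padic_abs_p //.
apply: (@le_trans _ _ (p%:R^-1 ^+ N * M)).
  apply: ler_pM; [by rewrite exprn_ge0 // invr_ge0 ler0n | exact: absval_ge0 | | exact: hM].
  by apply: ler_wiXn2l; rewrite ?invr_ge0 ?ler0n // invf_le1 ?ltr0n ?ler1n prime_gt0.
by rewrite -ler_pdivlMr // ltW.
Qed.

Lemma spec_ring_integral (x : k) (q : {poly {mpoly rat[n]}}) N : q != 0 ->
  root (map_poly phi q) x ->
  (forall i, spec_ring (p%:R ^+ N * (phi q`_i / phi (lead_coef q)))) ->
  integral_coefs spec_ring (p%:R ^+ N * x).
Proof.
move=> q0 qx hq; set d := (size q).-1; set D := lead_coef q in hq *.
have D0 : phi D != 0 by rewrite phi_neq0 // lead_coef_eq0.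
have sq : size q = d.+1 by rewrite prednK // size_poly_gt0.
pose r := \poly_(i < d.+1) (p%:R ^+ (N * (d - i)) * (phi q`_i / phi D)).
have rd : r`_d = 1.
  by rewrite coef_poly ltnSn subnn muln0 expr0 mul1r -lead_coefE divff.
have sr : size r = d.+1.
  by apply/eqP; rewrite eqn_leq size_poly /= ltnNge; apply/negP => /leq_sizeP /(_ d (leqnn d)) /eqP; rewrite rd oner_eq0.
exists r; split.
- by rewrite monicE lead_coefE sr rd.
- move=> i; rewrite coef_poly; case: ltnP => id; last exact: subring0 spec_ring_subring.
  move: id; rewrite ltnS leq_eqVlt => /orP[/eqP ->|id].
    by rewrite subnn muln0 expr0 mul1r -lead_coefE divff //; exact: subring1 spec_ring_subring.
  have -> : (d - i = (d - i).-1.+1)%N by rewrite prednK // subn_gt0.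
  rewrite mulnS addnC exprD -mulrA; apply: (subringM spec_ring_subring); last exact: hq.
  by apply: (subringX spec_ring_subring); exact: subring_nat spec_ring_subring _.
- apply/rootP; rewrite (@horner_coef_wide _ d.+1) ?sr //.
  move/rootP: qx; rewrite (@horner_coef_wide _ d.+1); last first.
    by rewrite -sq; exact: size_poly.
  move/(congr1 (fun y => p%:R ^+ (N * d) / phi D * y)); rewrite mulr0 mulr_sumr => E.
  apply: etrans E; apply: eq_bigr => i _; rewrite coef_poly ltn_ord coef_map_id0; last exact: raddf0.
  have -> : p%:R ^+ (N * d) = p%:R ^+ (N * (d - i)) * p%:R ^+ (N * i) :> k.
    by rewrite -exprD -mulnDr subnK // -ltnS.
  have E (a b u y z : k) : a * (u * y) * (b * z) = a * b * y * (u * z) by ring.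
  by rewrite exprMn -exprM E.
Qed.

Lemma spec_ring_arch (x : k) (q : {poly {mpoly rat[n]}}) : q != 0 ->
  root (map_poly phi q) x -> exists N, integral_coefs spec_ring (p%:R ^+ N * x).
Proof.
move=> q0 qx; have D0 : lead_coef q != 0 by rewrite lead_coef_eq0.
pose N i := projT1 (cid (spec_ring_scale q`_i D0)).
have NP i := projT2 (cid (spec_ring_scale q`_i D0)).
exists (\max_(i < size q) N i)%N; apply: spec_ring_integral qx _ => // i.
case: (ltnP i (size q)) => h; last first.
  by rewrite nth_default // /phi mmap0 mul0r mulr0; exact: subring0 spec_ring_subring.
by apply: NP; exact: (@leq_bigmax _ (fun i : 'I_(size q) => N i) (Ordinal h)).
Qed.

Lemma spec_ring_near i e : exists z : int, spec_ring ((t i - z%:~R) / p%:R ^+ e).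
Proof.
have [L hL] := cauchy e; exists (c L i).
have -> : (t i - (c L i)%:~R) / p%:R ^+ e =
    phi ('X_i - (c L i)%:~R%:MP) / phi ((p%:R ^+ e)%:MP).
  rewrite /phi rmorphB /= !mmapC mmapX mmap1U; congr ((_ - _) / _).
    by rewrite /= /ratf ratr_int.
  by rewrite /= (rmorphXn (ratf k0)) /= /ratf ratr_nat.
apply: spec_ring_frac.
  by rewrite mpolyC_eq0 expf_neq0 // pnatr_eq0 -lt0n prime_gt0.
exists L => l /hL h; rewrite /int_eval mevalB !mevalC mevalXU -rmorphB /=.
by rewrite absvalX // padic_abs_p //; exact: padic_abs_int_dvd.
Qed.

Lemma spec_ring_residue x : spec_ring x ->
  exists2 b, (b < p)%N & spec_ring ((x - b%:R) / p%:R).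
Proof.
move=> [P [Q [Q0 hx [L hL]]]].
have st (P0 : {mpoly rat[n]}) : exists L, forall l l', (L <= l)%N -> (L <= l')%N ->
    w (int_eval P0 (c l)) = w (int_eval P0 (c l')).
  have [->|/stable [L0 h]] := eqVneq P0 0; last by exists L0 => l l' /h [_ ->] /h [_ ->].
  by exists 0%N => l l' _ _; rewrite /int_eval !meval0.
pose L1 b := projT1 (cid (st (P - b%:R *: Q))).
have L1P b := projT2 (cid (st (P - b%:R *: Q))).
have [L2 hL2] := stable Q0.
set M := maxn (maxn L L2) (\max_(b < p) L1 b).
have ML : (L <= M)%N by rewrite /M !leq_max leqnn.
have ML2 : (L2 <= M)%N by rewrite /M !leq_max leqnn orbT.
have ML1 b : (b < p)%N -> (L1 b <= M)%N.
  move=> h; rewrite /M leq_max; apply/orP; right.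
  exact: (@leq_bigmax _ (fun i : 'I_p => L1 i) (Ordinal h)).
have [Q1 _] := hL2 M ML2; have wQ : 0 < w (int_eval Q (c M)) by rewrite absval_gt0.
have [|b bp hb] := @padic_abs_residue R p (int_eval P (c M) / int_eval Q (c M)) p_pr.
  by rewrite absvalM // absvalV // ler_pdivrMr // mul1r hL.
exists b => //; have -> : (x - b%:R) / p%:R = phi (P - b%:R *: Q) / phi (p%:R *: Q).
  rewrite /phi rmorphB /= -!/(phi _) !phi_scale !ratr_nat -hx -mulrBl invfM.
  by rewrite mulrACA divff ?mulr1 // phi_neq0.
apply: spec_ring_frac.
  by rewrite scaler_eq0 negb_or Q0 pnatr_eq0 -lt0n prime_gt0.
exists M => l Ml; rewrite (L1P b l M) //; last exact: ML1; last first.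
  exact: leq_trans (ML1 _ bp) Ml.
rewrite eval_scale absvalM // padic_abs_p //.
have [_ ->] := hL2 l (leq_trans ML2 Ml); have [_ <-] := hL2 M ML2.
rewrite /int_eval mevalB mevalZ -!/(int_eval _ _) -ler_pdivrMr // -absvalV // -absvalM //.
by rewrite mulrBl mulfK.
Qed.
End SpecializationRing.

Lemma transcendence_basis (k : fieldType) (k0 : [pchar k] =i pred0) : finite_trdeg k ->
  exists (n : nat) (t : 'I_n -> k), (forall P, mmap ratr t P = 0 -> P = 0) /\
    forall x, exists2 q : {poly {mpoly rat[n]}}, q != 0 & root (map_poly (mmap ratr t) q) x.
Proof.
move=> [d hd]; pose I n := `[< exists s : n.-tuple k, alg_independent s >].
have I0 : exists n, I n.
  exists 0%N; apply/asboolP; exists [tuple] => P.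
  have -> : P = (P@_0%MM)%:MP.
    apply/mpolyP => m; rewrite mcoeffC; have -> : m = 0%MM by apply/mnmP; case.
    by rewrite eqxx mulr1.
  rewrite -[ratr]/(ratf k0 : _ -> _) mmapC => /eqP; rewrite fmorph_eq0 => /eqP ->.
  by rewrite mpolyC0.
have Id n : I n -> (n <= d)%N by move=> /asboolP[s]; exact: hd.
case: (ex_maxnP I0 Id) => n /asboolP[s hs] maxn; exists n, (tnth s); split=> // x.
have /asboolPn nI : ~~ I n.+1 by apply/negP => /maxn; rewrite ltnn.
have [P [hP P0]] : exists P : {mpoly rat[n.+1]}, mmap ratr (tnth [tuple of rcons s x]) P = 0 /\ P != 0.
  apply: contrapT => no; apply: nI; exists [tuple of rcons s x] => P hP.
  by apply/eqP/negPn/negP => P0; apply: no; exists P.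
exists (muni P); first by apply: contra P0 => /eqP /muni_eq0 ->.
move: hP; rewrite -[ratr]/(ratf k0 : _ -> _) mmap_muni.
have -> : tnth [tuple of rcons s x] ord_max = x.
  by rewrite (tnth_nth x) /= nth_rcons size_tuple ltnn eqxx.
set h := (fun i : 'I_n => _); have -> : h = tnth s.
  by apply/funext => i; rewrite /h !(tnth_nth x) /= nth_rcons size_tuple ltn_ord.
by move/rootP.
Qed.

(* The powers of [s] take finitely many values modulo [p], so two of them agree. *)
Lemma residue_root_of_unity (R : realType) (F : fieldType) (v : F -> R) (p : nat)
    (q : {poly F}) (s : F) : ultrametric_absval v -> prime p -> v p%:R = p%:R^-1 ->
  q \is monic -> root q s -> (forall i, exists b : nat, v (q`_i - b%:R) <= p%:R^-1) ->
  v s = 1 -> exists2 r, (0 < r)%N & v (s ^+ r - 1) < 1.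
Proof.
move=> vU p_pr vp qm qs qb vs; have vA := ultrametric_is_absval vU.
have p0 : 0 <= p%:R^-1 :> R by rewrite invr_ge0 ler0n.
have p1 : p%:R^-1 < 1 :> R by rewrite invf_lt1 ?ltr1n ?ltr0n ?prime_gt0 ?prime_gt1.
pose b i := projT1 (cid (qb i)); have bP i := projT2 (cid (qb i)).
case E: (size q) => [|[|d]].
- move/eqP: E; rewrite size_poly_eq0 => /eqP E; move: qm.
  by rewrite E monicE lead_coef0 eq_sym oner_eq0.
- move: qs; rewrite [q]size1_polyC ?E // rootC.
  by move/monicP: qm; rewrite lead_coefE E /= => -> ; rewrite oner_eq0.
pose val (h : nat -> int) := \sum_(i < d.+1) (h i)%:~R * s ^+ i.
pose ext (g : {ffun 'I_d.+1 -> 'I_p}) (i : nat) := (g (inord i) : nat)%:Z.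
have vX i : v (s ^+ i) = 1 by rewrite absvalX // vs expr1n.
have vint (z : int) : v z%:~R <= 1.
  by case: z => a; rewrite ?NegzE ?mulrNz ?absvalN // ultra_nat_le1.
have red (h : nat -> int) : exists g, v (val h - val (ext g)) <= p%:R^-1.
  have H i := cid2 (int_residue (h i) (prime_gt0 p_pr)).
  exists [ffun i : 'I_d.+1 => Ordinal (s2valP (H i))].
  rewrite /val -sumrB; apply: ultra_sum_le => // i _; rewrite /ext ffunE /= inord_val.
  rewrite -mulrBl absvalM // vX mulr1 pmulrn -intrB.
  have /dvdzP[m ->] := s2valP' (H i).
  by rewrite intrM -pmulrn absvalM // vp ler_piMl.
have pw N : exists g, v (s ^+ N - val (ext g)) <= p%:R^-1.
  elim: N => [|N [g IH]].
    have [g hg] := red (fun i => (i == 0)%:Z); exists g.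
    suff <- : val (fun i => (i == 0)%:Z) = s ^+ 0 by [].
    rewrite /val big_ord_recl big1 ?addr0 ?mulr1 // => i _; exact: mul0r.
  set a := ext g in IH.
  pose h i : int := (if i is j.+1 then a j else 0) - a d * (b i)%:Z.
  have [g' hg'] := red h; exists g'.
  rewrite -[s ^+ N.+1](subrK (val h)) -addrA; apply: ultraD_le => //.
  have vh : val h = s * val a - (a d)%:~R * (s ^+ d.+1 + \sum_(i < d.+1) (b i)%:R * s ^+ i).
    rewrite /val /h; under eq_bigr => i _ do rewrite rmorphB rmorphM /= mulrBl -mulrA.
    rewrite sumrB -mulr_sumr big_ord_recl /= mul0r add0r.
    rewrite [in RHS]big_ord_recr /= mulrDr mulrCA -exprS mulr_sumr mulrDr opprD addrA addrK.
    rewrite mulr_sumr; congr (_ - _); last by rewrite mulr_sumr; apply: eq_bigr.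
    by apply: eq_bigr => i _; rewrite /bump /= add1n exprS mulrCA.
  have sd : s ^+ d.+1 = - \sum_(i < d.+1) q`_i * s ^+ i.
    move/rootP: qs; rewrite horner_coef E big_ord_recr /=.
    move/monicP: qm; rewrite lead_coefE E /= => ->.
    by rewrite mul1r addrC => /eqP; rewrite addr_eq0 => /eqP.
  have -> : s ^+ N.+1 - val h = s * (s ^+ N - val a)
     - (a d)%:~R * \sum_(i < d.+1) (q`_i - (b i)%:R) * s ^+ i.
    rewrite vh sd exprS mulrBr.
    under [in RHS]eq_bigr => i _ do rewrite mulrBl.
    by rewrite sumrB opprB; ring.
  apply: ultraB_le => //; rewrite absvalM //; first by rewrite vs mul1r.
  apply: le_trans (_ : 1 * p%:R^-1 <= _); last by rewrite mul1r.
  apply: ler_pM; rewrite ?absval_ge0 //; apply: ultra_sum_le => // i _.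
  by rewrite absvalM // vX mulr1; exact: bP.
pose G N := projT1 (cid (pw N)); have GP N : v (s ^+ N - val (ext (G N))) <= p%:R^-1 := projT2 (cid (pw N)).
have [[i j] /= /andP[ij /eqP Gij]] : exists ij : 'I_#|{ffun 'I_d.+1 -> 'I_p}|.+1 * 'I_#|{ffun 'I_d.+1 -> 'I_p}|.+1,
    (ij.1 < ij.2)%N && (G ij.1 == G ij.2).
  apply: contrapT => no.
  have inj : injective (fun i : 'I_#|{ffun 'I_d.+1 -> 'I_p}|.+1 => G i).
    move=> i j Gij; apply: val_inj; case: (ltngtP i j) => // lt; exfalso; apply: no.
      by exists (i, j); rewrite /= lt Gij eqxx.
    by exists (j, i); rewrite /= lt Gij eqxx.
  by have := leq_card _ inj; rewrite card_ord ltnn.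
exists (j - i)%N; first by rewrite subn_gt0.
have -> : v (s ^+ (j - i) - 1) = v (s ^+ j - s ^+ i).
  have -> : s ^+ j - s ^+ i = s ^+ i * (s ^+ (j - i) - 1).
    by rewrite mulrBr mulr1 -exprD subnKC // ltnW.
  by rewrite absvalM // vX mul1r.
apply: le_lt_trans p1; have -> : s ^+ j - s ^+ i =
  (s ^+ j - val (ext (G j))) - (s ^+ i - val (ext (G i))) by rewrite Gij; ring.
exact: ultraB_le.
Qed.

Lemma prodr_ge1_factor (R : realDomainType) (I : eqType) (r : seq I) (f : I -> R) i :
  (forall j, j \in r -> 0 <= f j <= 1) -> i \in r -> 1 <= \prod_(j <- r) f j -> f i = 1.
Proof.
move=> f01 ir; rewrite (big_rem i) //= => h.
have /andP[fi0 fi1] := f01 i ir.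
apply/eqP; rewrite eq_le fi1; apply: le_trans h _.
by rewrite ler_piMr // big_seq prodr_ile1 // => j /mem_rem; exact: f01.
Qed.

(* Specialize a transcendence basis at a [p]-adically convergent sequence of
   integer points on which every nonzero polynomial has an eventually constant
   absolute value.  The elements of the resulting [spec_ring] have residues in
   [F_p], and for large [p] the elements of [S] and their inverses are integral over it. *)
Theorem padic_valuation (R : realType) (k : fieldType) (k0 : [pchar k] =i pred0)
    (trdeg : finite_trdeg k) (S : seq k) (B : nat) : 0 \notin S ->
  exists (p : nat) (v : k -> R),
  [/\ prime p /\ (B < p)%N, ultrametric_absval v, v p%:R = p%:R^-1,
      forall s, s \in S -> v s = 1 /\ exists2 r, (0 < r)%N & v (s ^+ r - 1) < 1 &
      forall x, exists q : {poly k}, [/\ q != 0, root q x & forall i, rat_closure v q`_i]].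
Proof.
move=> S0; have [n [t [indep alg]]] := transcendence_basis k0 trdeg.
pose phi : {rmorphism {mpoly rat[n]} -> k} := mmap (ratf k0) t.
pose S' := S ++ [seq x^-1 | x <- S].
pose Q x := s2val (cid2 (alg x)).
have Q0 x : Q x != 0 := s2valP (cid2 (alg x)).
have QP x : root (map_poly phi (Q x)) x := s2valP' (cid2 (alg x)).
have L0 x : lead_coef (Q x) != 0 by rewrite lead_coef_eq0.
pose D := \prod_(x <- S') lead_coef (Q x).
have D0 : D != 0 by rewrite /D prodf_seq_neq0; apply/allP => x _; rewrite L0.
have [|j hj] := @mpoly_nonvanishing _ _ D (fun _ i => i%:R) _ D0.
  by move=> _ a b /eqP; rewrite eqr_nat => /eqP.
pose c0 (i : 'I_n) : int := (j i)%:Z.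
have D1 : int_eval D c0 != 0 by [].
pose coefs x := flatten [seq [seq P@_m | m <- msupp P] | P <- polyseq (Q x)].
have [B' hB'] := padic_abs_le1_large_seq R ((int_eval D c0)^-1 :: flatten [seq coefs x | x <- S']).
have [p] := prime_above (maxn B B'); rewrite gtn_max => /andP[Bp B'p] p_pr.
have wU := padic_abs_ultrametric R p_pr; have wA := ultrametric_is_absval wU.
have wD : 1 <= padic_abs R p (int_eval D c0).
  have := hB' p p_pr B'p _ (mem_head _ _); rewrite absvalV // invf_le1 //.
  by rewrite absval_gt0.
have wQ x i m : x \in S' -> padic_abs R p (Q x)`_i@_m <= 1.
  move=> xS; case: (ltnP i (size (Q x))) => h; last first.
    by rewrite nth_default // mcoeff0 absval0.
  case: (boolP (m \in msupp (Q x)`_i)) => hm; last first.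
    by rewrite memN_msupp_eq0 // absval0.
  apply: hB' => //; rewrite inE; apply/orP; right.
  apply/flattenP; exists (coefs x); first by apply/mapP; exists x.
  apply/flattenP; exists [seq (Q x)`_i@_m | m <- msupp (Q x)`_i].
    by apply/mapP; exists (Q x)`_i => //; exact: mem_nth.
  by apply/mapP; exists m.
have wev x i c : x \in S' -> padic_abs R p (int_eval (Q x)`_i c) <= 1.
  move=> xS; apply: (mmap_le wU) => // [m|i']; [exact: wQ | exact: padic_abs_int_le1].
have wL0 x : x \in S' -> padic_abs R p (int_eval (lead_coef (Q x)) c0) = 1.
  move=> xS; move: wD; rewrite /D /int_eval rmorph_prod /= absval_prod //.
  apply: (prodr_ge1_factor (f := fun x => padic_abs R p (int_eval (lead_coef (Q x)) c0))) => // y yS.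
  by rewrite absval_ge0 //= wev.
have [c [c1 c2 c3]] := generic_sequence R p_pr c0.
have wL x l : x \in S' -> padic_abs R p (int_eval (lead_coef (Q x)) (c l)) = 1.
  move=> xS; rewrite -[RHS](wL0 x xS); apply: ultra_eq => //; rewrite wL0 //.
  apply: le_lt_trans (_ : 1 * p%:R^-1 ^+ 1 < 1); last first.
    by rewrite mul1r expr1 invf_lt1 ?ltr1n ?ltr0n ?prime_gt0 ?prime_gt1.
  by apply: int_eval_lip => // m; exact: wQ.
pose A := spec_ring R k0 t p c.
have Asub : is_subring A by apply: spec_ring_subring.
have intS x : x \in S' -> integral_coefs A x.
  move=> xS; have -> : x = p%:R ^+ 0 * x by rewrite expr0 mul1r.
  apply: (spec_ring_integral indep p_pr (Q0 x) (QP x)) => i.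
  rewrite expr0 mul1r; apply: (spec_ring_frac k0 indep (L0 x)).
  by exists 0%N => l _; rewrite (wL x l xS); exact: wev.
have Ap : ~ A p%:R^-1 := spec_ring_p indep p_pr c3.
have Aarch y : exists N, integral_coefs A (p%:R ^+ N * y).
  exact: (@spec_ring_arch _ _ k0 _ _ indep p p_pr c c3 y (Q y) (Q0 y) (QP y)).
have pk : p%:R != 0 :> k by rewrite natf_eq0 // -lt0n prime_gt0.
have [O [OP AO]] := pvaluation_ring_exists Asub Ap pk Aarch.
pose v := valabs p O R.
have p_gt0 := prime_gt0 p_pr.
have vU : ultrametric_absval v := valabs_ultrametric OP R p_gt0.
have vA := ultrametric_is_absval vU.
have vp : v p%:R = p%:R^-1 := valabs_p OP R.
have AO1 x : A x -> v x <= 1.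
  move=> Ax; apply: (valabs_le1 OP R p_gt0); apply: AO.
  exists ('X - x%:P); rewrite monicXsubC root_XsubC eqxx; split=> // i.
  rewrite coefB coefX coefC; apply: subringB => //; first exact: subring_nat.
  by case: ifP => // _; exact: subring0.
have vA_p x e : A (x / p%:R ^+ e) -> v x <= p%:R^-1 ^+ e.
  move/AO1; rewrite absvalM // absvalV // absvalX // vp.
  by rewrite ler_pdivrMr ?mul1r // exprn_gt0 // invr_gt0 ltr0n.
have vS x : x \in S -> v x = 1.
  move=> xS; have x0 : x != 0 by apply: contraNneq S0 => <-.
  have h1 : v x <= 1.
    by apply: (valabs_le1 OP R p_gt0); apply/AO/intS; rewrite mem_cat xS.
  have h2 : v x^-1 <= 1.
    by apply: (valabs_le1 OP R p_gt0); apply/AO/intS; rewrite mem_cat map_f ?orbT.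
  by apply/eqP; rewrite eq_le h1 -invf_le1 ?absval_gt0 // -absvalV.
exists p, v; split=> //.
  move=> s sS; split; first exact: vS.
  have sS' : s \in S' by rewrite mem_cat sS.
  have [q [qm qA qs]] := intS s sS'.
  apply: (residue_root_of_unity vU p_pr vp qm qs _ (vS s sS)) => i.
  have [b _ hb] := spec_ring_residue indep p_pr c3 (qA i).
  by exists b; rewrite -[leRHS]expr1; apply: vA_p; rewrite expr1.
have vt i : v (t i) <= 1.
  have [z] := spec_ring_near R k0 indep p_pr c2 i 0; rewrite expr0 divr1 => h.
  rewrite -[t i](subrK z%:~R); apply: ultraD_le => //; first exact: AO1.
  by case: (z) => a; rewrite ?NegzE ?mulrNz ?absvalN // ultra_nat_le1.
have clos P : rat_closure v (phi P).
  move=> e e0; have [M M0 hM] := @mcoeff_bound _ _ _ vU _ _ (ratf k0) P (rmorph0 _).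
  have [N hN] := small_pow p_pr (divr_gt0 e0 M0).
  pose z i := projT1 (cid (spec_ring_near R k0 indep p_pr c2 i N)).
  have zP i := projT2 (cid (spec_ring_near R k0 indep p_pr c2 i N)).
  exists (int_eval P z).
  have -> : ratr (int_eval P z) = mmap (ratf k0) (fun i => (z i)%:~R) P.
    rewrite -[ratr]/(ratf k0 : _ -> _) /int_eval /meval /mmap rmorph_sum; apply: eq_bigr => m _.
    rewrite rmorphM /mmap1 rmorph_prod; congr (_ * _); apply: eq_bigr => i _.
    by rewrite rmorphXn /= /ratf ratr_int.
  apply: le_lt_trans (mmap_lip vU (_ : 0 <= p%:R^-1 ^+ N) (ltW M0) hM vt _ _) _.
  - by rewrite exprn_ge0 // invr_ge0 ler0n.
  - by move=> i; case: (z i) => a; rewrite ?NegzE ?mulrNz ?absvalN // ultra_nat_le1.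
  - by move=> i; apply: vA_p; exact: zP.
  - by rewrite mulrC -ltr_pdivlMr.
move=> x; exists (map_poly phi (Q x)); split; [|exact: QP|].
  rewrite -lead_coef_eq0 lead_coef_map_eq /=; last first.
    by apply: contra (L0 x) => /eqP /indep ->.
  by apply: contra (L0 x) => /eqP /indep ->.
by move=> i; rewrite coef_map; exact: clos.
Qed.

(** * Completions *)

Record ultrametric (R : realType) (F : fieldType) := Ultrametric {
  uval :> F -> R;
  uvalP : ultrametric_absval uval }.

Section Completion.
Import classical_sets functions.
Variables (R : realType) (F : fieldType) (v : ultrametric R F).
Let vU := uvalP v.
Let vA := ultrametric_is_absval vU.

Definition cauchys : {pred nat -> F} := fun x => `[< cauchy_seq v x >].

Lemma cauchy_bounded x : cauchy_seq v x -> exists2 M, 0 < M & forall i, v (x i) <= M.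
Proof.
move=> /(_ 1 ltr01)[n hn]; exists (1 + \sum_(i < n.+1) v (x i)).
  by rewrite ltr_pwDl // sumr_ge0 // => *; exact: absval_ge0.
have le i : (i < n.+1)%N -> v (x i) <= 1 + \sum_(i < n.+1) v (x i).
  move=> h; rewrite (bigD1 (Ordinal h)) //= addrCA lerDl addr_ge0 // sumr_ge0 // => *.
  exact: absval_ge0.
move=> i; case: (ltnP i n.+1) => [/le //|ni].
rewrite -[x i](subrK (x n)); apply: ultraD_le => //; last exact: le.
apply: le_trans (ltW (hn _ _ (ltnW ni) (leqnn n))) _.
by rewrite lerDl sumr_ge0 // => *; exact: absval_ge0.
Qed.

Lemma cauchys_subring : subring_closed cauchys.
Proof.
split.
- by apply/asboolP => e e0; exists 0%N => i j _ _; rewrite subrr absval0.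
- move=> x y /asboolP hx /asboolP hy; apply/asboolP => e e0.
  have [n hn] := hx e e0; have [m hm] := hy e e0; exists (maxn n m) => i j.
  rewrite !geq_max => /andP[i1 i2] /andP[j1 j2].
  have -> : (x - y) i - (x - y) j = (x i - x j) - (y i - y j).
    by rewrite [LHS](_ : _ = (x i - y i) - (x j - y j)) //; ring.
  by apply: ultraB_lt => //; [exact: hn | exact: hm].
- move=> x y /asboolP hx /asboolP hy; apply/asboolP => e e0.
  have [M M0 hM] := cauchy_bounded hx; have [M' M0' hM'] := cauchy_bounded hy.
  have [n hn] := hx _ (divr_gt0 e0 M0'); have [m hm] := hy _ (divr_gt0 e0 M0).
  exists (maxn n m) => i j; rewrite !geq_max => /andP[i1 i2] /andP[j1 j2].
  have -> : (x * y) i - (x * y) j = x i * (y i - y j) + (x i - x j) * y j.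
    by rewrite [LHS](_ : _ = x i * y i - x j * y j) //; ring.
  apply: ultraD_lt => //; rewrite absvalM //.
    apply: le_lt_trans (_ : M * v (y i - y j) < e); first by rewrite ler_wpM2r ?absval_ge0.
    by rewrite mulrC -ltr_pdivlMr //; exact: hm.
  apply: le_lt_trans (_ : v (x i - x j) * M' < e); first by rewrite ler_wpM2l ?absval_ge0.
  by rewrite -ltr_pdivlMr //; exact: hn.
Qed.
HB.instance Definition _ := GRing.isSubringClosed.Build (nat -> F) cauchys cauchys_subring.

Record cauchy := Cauchy { cauchy_fun :> nat -> F; _ : cauchy_fun \in cauchys }.
HB.instance Definition _ := [isSub for cauchy_fun].
HB.instance Definition _ := [Choice of cauchy by <:].
HB.instance Definition _ := [SubChoice_isSubComNzRing of cauchy by <:].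

Lemma cauchyP (x : cauchy) : cauchy_seq v x. Proof. by apply/asboolP; exact: (valP x). Qed.

Definition null_cauchy : {pred cauchy} :=
  fun x => `[< forall e, 0 < e -> exists n, forall i, (n <= i)%N -> v (x i) < e >].

Lemma not_null_cauchy (x : cauchy) : x \notin null_cauchy ->
  exists2 c, 0 < c & exists n, forall i, (n <= i)%N -> v (x i) = c.
Proof.
move/asboolPn => nx.
have [e e0 he] : exists2 e, 0 < e & forall n, exists2 i, (n <= i)%N & e <= v (x i).
  apply: contrapT => no; apply: nx => e e0; apply: contrapT => nn; apply: no; exists e => // n.
  apply: contrapT => ni; apply: nn; exists n => i le; rewrite ltNge; apply/negP => h.
  by apply: ni; exists i.
have [n hn] := cauchyP x e0; have [i ni ei] := he n.
exists (v (x i)); first exact: lt_le_trans ei.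
exists n => j nj; apply: ultra_eq => //; apply: lt_le_trans ei; exact: hn.
Qed.

Lemma null_cauchy_ideal : @idealr_closed cauchy null_cauchy.
Proof.
split.
- by apply/asboolP => e e0; exists 0%N => i _; rewrite absval0.
- apply/asboolPn => /(_ 1 ltr01)[n /(_ n (leqnn n))]; by rewrite absval1 ?ltxx.
- move=> a x y /asboolP hx /asboolP hy; apply/asboolP => e e0.
  have [M M0 hM] := cauchy_bounded (cauchyP a).
  have [n hn] := hx _ (divr_gt0 e0 M0); have [m hm] := hy _ e0.
  exists (maxn n m) => i; rewrite !geq_max => /andP[i1 i2].
  apply: ultraD_lt => //; last exact: hm.
  rewrite [X in v X](_ : _ = a i * x i) // absvalM //.
  apply: le_lt_trans (_ : M * v (x i) < e); first by rewrite ler_wpM2r ?absval_ge0.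
  by rewrite mulrC -ltr_pdivlMr //; exact: hn.
Qed.
HB.instance Definition _ := isIdealr.Build cauchy null_cauchy null_cauchy_ideal.

Definition completion := {ideal_quot null_cauchy}.
HB.instance Definition _ := GRing.ComNzRing.on completion.

Definition completion_pi : {rmorphism cauchy -> completion} := \pi_completion.

Lemma completion_pi_eq (x y : cauchy) :
  (completion_pi x == completion_pi y) = (x - y \in null_cauchy).
Proof. by rewrite Quotient.idealrBE. Qed.

Lemma completion_piP (x : completion) : exists y, x = completion_pi y.
Proof. by elim/quotW: x => x; exists x. Qed.

Lemma completion_inverse (x : completion) : exists y, (x == 0) && (y == 0) || (x != 0) && (y * x == 1).
Proof.
have [->|x0] := eqVneq x 0; first by exists 0; rewrite eqxx.
case: (completion_piP x) x0 => {}x -> x0.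
have nx : x \notin null_cauchy.
  by apply: contra x0 => h; rewrite -(rmorph0 completion_pi) completion_pi_eq subr0.
have [c c0 [n hn]] := not_null_cauchy nx.
have xn0 i : (n <= i)%N -> x i != 0 by move=> /hn h; rewrite -(absval_eq0 vA) h gt_eqF.
pose y i := if (n <= i)%N then (x i)^-1 else 0.
have yC : y \in cauchys.
  apply/asboolP => e e0; have [m hm] := cauchyP x (mulr_gt0 e0 (mulr_gt0 c0 c0)).
  exists (maxn n m) => i j; rewrite !geq_max => /andP[i1 i2] /andP[j1 j2].
  rewrite /y i1 j1; have -> : (x i)^-1 - (x j)^-1 = (x j - x i) / (x i * x j).
    by field; rewrite !xn0.
  rewrite absvalM // absvalV // absvalM // !hn // ltr_pdivrMr ?mulr_gt0 //; exact: hm.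
exists (completion_pi (Cauchy yC)); apply/orP; right => /=.
rewrite -rmorphM -(rmorph1 completion_pi) completion_pi_eq; apply/asboolP => e e0.
exists n => i ni; rewrite [X in v X](_ : _ = y i * x i - 1) //.
by rewrite /y ni mulVf ?xn0 // subrr absval0.
Qed.

Definition completion_inv (x : completion) := projT1 (cid (completion_inverse x)).
Lemma completion_invP x :
  (x == 0) && (completion_inv x == 0) || (x != 0) && (completion_inv x * x == 1).
Proof. exact: projT2 (cid (completion_inverse x)). Qed.
Lemma completion_mulVf x : x != 0 -> completion_inv x * x = 1.
Proof. by move=> x0; have := completion_invP x; rewrite (negPf x0) /= => /eqP. Qed.
Lemma completion_inv0 : completion_inv 0 = 0.
Proof. by have := completion_invP 0; rewrite eqxx /= orbF => /eqP. Qed.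
HB.instance Definition _ := GRing.ComNzRing_isField.Build completion completion_mulVf completion_inv0.

Definition tail_abs (x : nat -> F) (l : R) :=
  forall e, 0 < e -> exists n, forall i, (n <= i)%N -> `|v (x i) - l| < e.

Lemma tail_abs_exists (x : cauchy) : exists l, tail_abs x l.
Proof.
case: (boolP (x \in null_cauchy)) => [/asboolP h|/not_null_cauchy [c _ [n hn]]].
  exists 0 => e /h [n hn]; exists n => i /hn.
  by rewrite subr0 ger0_norm // absval_ge0.
by exists c => e e0; exists n => i /hn ->; rewrite subrr normr0.
Qed.

Lemma tail_abs_unique (x y : nat -> F) l l' : tail_abs x l -> tail_abs y l' ->
  (forall e, 0 < e -> exists n, forall i, (n <= i)%N -> v (x i - y i) < e) -> l = l'.
Proof.
move=> hx hy hxy; apply/eqP; rewrite -subr_eq0 -normr_le0 leNgt; apply/negP => lt.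
have e0 : 0 < `|l - l'| / 3 by rewrite divr_gt0.
have [n hn] := hx _ e0; have [m hm] := hy _ e0; have [q hq] := hxy _ e0.
pose i := maxn n (maxn m q).
have := hn i (leq_maxl _ _).
have := hm i; rewrite /i !leq_max leqnn orbT -/i => /(_ isT).
have := hq i; rewrite /i !leq_max leqnn !orbT -/i => /(_ isT) h1 h2 h3.
have h4 : `|v (x i) - v (y i)| <= v (x i - y i).
  have A a b : v a - v b <= v (a - b).
    rewrite lerBlDr; case: vA => _ _ _ H; apply: le_trans (H _ _).
    by rewrite subrK.
  by rewrite ler_norml lerNl opprB A absvalB // A.
have := ler_normD (l - v (x i)) (v (x i) - l'); rewrite addrA subrK => h5.
have := ler_normD (v (x i) - v (y i)) (v (y i) - l'); rewrite addrA subrK => h6.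
rewrite (distrC l (v (x i))) in h5.
lra.
Qed.

Definition completion_abs (x : completion) : R := projT1 (cid (tail_abs_exists (repr x))).

Lemma completion_absP (x : cauchy) : tail_abs x (completion_abs (completion_pi x)).
Proof.
rewrite /completion_abs; case: cid => l /= hl.
have [l' hl'] := tail_abs_exists x; suff -> : l = l' by [].
apply: tail_abs_unique hl hl' _.
have : repr (completion_pi x) - x \in null_cauchy.
  by rewrite -completion_pi_eq /= reprK.
by move/asboolP.
Qed.

Lemma completion_abs_eq (x : cauchy) l : tail_abs x l -> completion_abs (completion_pi x) = l.
Proof.
move=> hl; apply: tail_abs_unique (completion_absP x) hl _ => e e0.
by exists 0%N => i _; rewrite subrr absval0.
Qed.

Lemma tail_abs_le (x : nat -> F) l c n :
  tail_abs x l -> (forall i, (n <= i)%N -> v (x i) <= c) -> l <= c.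
Proof.
move=> hx hc; rewrite leNgt; apply/negP => lt.
have [|m hm] := hx (l - c); first by rewrite subr_gt0.
have := hm (maxn n m) (leq_maxr _ _); have := hc (maxn n m) (leq_maxl _ _).
rewrite ltr_norml => h1 /andP[h2 _]; lra.
Qed.

Lemma tail_abs_ge (x : nat -> F) l c n :
  tail_abs x l -> (forall i, (n <= i)%N -> c <= v (x i)) -> c <= l.
Proof.
move=> hx hc; rewrite leNgt; apply/negP => lt.
have [|m hm] := hx (c - l); first by rewrite subr_gt0.
have := hm (maxn n m) (leq_maxr _ _); have := hc (maxn n m) (leq_maxl _ _).
rewrite ltr_norml => h1 /andP[_ h2]; lra.
Qed.

Lemma completion_abs_ultrametric : ultrametric_absval completion_abs.
Proof.
have ge0 x : 0 <= completion_abs x.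
  have [{}x ->] := completion_piP x.
  by apply: (tail_abs_ge (n := 0%N) (completion_absP x)) => i _; exact: absval_ge0.
split=> // [x|x y|x y].
- have [{}x ->] := completion_piP x; split=> [h|->].
    apply/eqP; rewrite -(rmorph0 completion_pi) completion_pi_eq subr0; apply/asboolP => e e0.
    have := completion_absP x; rewrite h => /(_ e e0)[n hn]; exists n => i /hn.
    by rewrite subr0; apply: le_lt_trans; exact: ler_norm.
  rewrite -(rmorph0 completion_pi); apply: completion_abs_eq => e e0.
  by exists 0%N => i _; rewrite absval0 // subrr normr0.
- have [{}x ->] := completion_piP x; have [{}y ->] := completion_piP y.
  rewrite -rmorphM; apply: completion_abs_eq => e e0.
  set a := completion_abs _; set b := completion_abs _.
  have a0 : 0 <= a by exact: ge0.
  have b0 : 0 <= b by exact: ge0.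
  have [M M0 hM] := cauchy_bounded (cauchyP x).
  have M1 : 0 < M + b + 1 by apply: ltr_wpDl => //; rewrite addr_ge0 // ltW.
  have [n hn] := completion_absP x (divr_gt0 e0 M1).
  have [m hm] := completion_absP y (divr_gt0 e0 M1).
  exists (maxn n m) => i; rewrite geq_max => /andP[/hn h1 /hm h2].
  rewrite -/a in h1; rewrite -/b in h2.
  rewrite [X in v X](_ : _ = x i * y i) // absvalM //.
  have -> : v (x i) * v (y i) - a * b = v (x i) * (v (y i) - b) + (v (x i) - a) * b by ring.
  apply: le_lt_trans (ler_normD _ _) _; rewrite !normrM (ger0_norm b0) ger0_norm ?absval_ge0 //.
  apply: le_lt_trans (_ : (M + b) * (e / (M + b + 1)) < e).
    rewrite mulrDl; apply: lerD; first by apply: ler_pM => //; [exact: absval_ge0 | exact: ltW].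
    by rewrite mulrC ler_wpM2l // ltW.
  by rewrite mulrCA gtr_pMr // ltr_pdivrMr // mul1r ltrDl.
- have [{}x ->] := completion_piP x; have [{}y ->] := completion_piP y.
  rewrite -rmorphD leNgt; apply/negP => lt.
  set m := Num.max _ _ in lt; set s := completion_abs _ in lt.
  have e0 : 0 < (s - m) / 2 by rewrite divr_gt0 // subr_gt0.
  have [n1 h1] := completion_absP x e0; have [n2 h2] := completion_absP y e0.
  have : s <= m + (s - m) / 2.
    apply: (tail_abs_le (n := maxn n1 n2) (completion_absP (x + y))) => i.
    rewrite geq_max => /andP[/h1 + /h2]; rewrite !ltr_norml => /andP[_ g1] /andP[_ g2].
    rewrite [X in v X](_ : _ = x i + y i) //; apply: ultraD_le => //.
      have : completion_abs (completion_pi x) <= m by rewrite le_max lexx.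
      lra.
    have : completion_abs (completion_pi y) <= m by rewrite le_max lexx orbT.
    lra.
  lra.
Qed.

Lemma const_cauchy (c : F) : (fun=> c) \in cauchys.
Proof. by apply/asboolP => e e0; exists 0%N => i j _ _; rewrite subrr absval0. Qed.

Definition completion_inj (c : F) : completion := completion_pi (Cauchy (const_cauchy c)).

Fact completion_inj_zmod : zmod_morphism completion_inj.
Proof. by move=> x y; rewrite -rmorphB; congr (completion_pi _); apply: val_inj. Qed.
Fact completion_inj_monoid : monoid_morphism completion_inj.
Proof.
split; first by rewrite -(rmorph1 completion_pi); congr (completion_pi _); apply: val_inj.
by move=> x y; rewrite -rmorphM; congr (completion_pi _); apply: val_inj.
Qed.
HB.instance Definition _ := GRing.isZmodMorphism.Build F completion completion_inj completion_inj_zmod.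
HB.instance Definition _ := GRing.isMonoidMorphism.Build F completion completion_inj completion_inj_monoid.

Lemma completion_is_completion : is_completion v completion_abs completion_inj.
Proof.
have iso x : completion_abs (completion_inj x) = v x.
  by apply: completion_abs_eq => e e0; exists 0%N => i _; rewrite subrr normr0.
have near (x : cauchy) e n : (forall i, (n <= i)%N -> v (x i - x n) <= e) ->
    completion_abs (completion_pi x - completion_inj (x n)) <= e.
  move=> h; rewrite /completion_inj -rmorphB.
  by apply: (tail_abs_le (n := n) (completion_absP _)) => i /h.
have dense y e : 0 < e -> exists x, completion_abs (y - completion_inj x) < e.
  move=> e0; have [{}y ->] := completion_piP y.
  have e2 : 0 < e / 2 by rewrite divr_gt0.
  have [n hn] := cauchyP y e2; exists (y n).
  apply: le_lt_trans (near y (e / 2) n _) _; last lra.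
  by move=> i ni; apply: ltW; apply: hn.
have cU := completion_abs_ultrametric; have cA := ultrametric_is_absval cU.
split=> // X hX.
have pos (m : nat) : 0 < m.+1%:R^-1 :> R by rewrite invr_gt0 ltr0Sn.
pose c m := projT1 (cid (dense (X m) _ (pos m))).
have cP m : completion_abs (X m - completion_inj (c m)) < m.+1%:R^-1 := projT2 (cid (dense (X m) _ (pos m))).
have small e : 0 < e -> exists N, forall m, (N <= m)%N -> m.+1%:R^-1 < e :> R.
  move=> e0; exists (Num.bound e^-1) => m hm.
  rewrite invf_plt ?posrE ?ltr0Sn //; apply: lt_le_trans (archi_boundP _) _.
    by rewrite invr_ge0 ltW.
  by rewrite ler_nat ltnW.
have cC : c \in cauchys.
  apply/asboolP => e e0; have [N hN] := small e e0; have [n hn] := hX e e0.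
  exists (maxn N n) => i j; rewrite !geq_max => /andP[i1 i2] /andP[j1 j2].
  rewrite -iso rmorphB /=.
  have -> : completion_inj (c i) - completion_inj (c j) =
     (X i - X j) - (X i - completion_inj (c i)) + (X j - completion_inj (c j)) by ring.
  apply: ultraD_lt => //; last by apply: lt_trans (cP _) (hN _ j1).
  by apply: ultraB_lt => //; [exact: hn | apply: lt_trans (cP _) (hN _ i1)].
exists (completion_pi (Cauchy cC)) => e e0.
have e2 : 0 < e / 2 by rewrite divr_gt0.
have [N hN] := small e e0; have [n hn] := cauchyP (Cauchy cC) e2.
exists (maxn N n) => i; rewrite geq_max => /andP[i1 i2].
rewrite -[X i](subrK (completion_inj (c i))) -addrA; apply: ultraD_lt => //.
  by apply: lt_trans (cP _) (hN _ i1).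
rewrite absvalB //; apply: le_lt_trans (near (Cauchy cC) (e / 2) i _) _; last lra.
by move=> j ij; apply: ltW; apply: hn => //; exact: leq_trans ij.
Qed.
End Completion.

Record subfield_pred (F : fieldType) := SubfieldPred {
  subfield_mem :> {pred F};
  subfield_memP : divring_closed subfield_mem }.

HB.instance Definition _ (F : fieldType) (S : subfield_pred F) :=
  GRing.isDivringClosed.Build F (subfield_mem S) (subfield_memP S).

Record subfield (F : fieldType) (S : subfield_pred F) := Subfield {
  subfield_val : F; _ : subfield_val \in subfield_mem S }.

HB.instance Definition _ F (S : subfield_pred F) := [isSub for @subfield_val F S].
HB.instance Definition _ F (S : subfield_pred F) := [Choice of subfield S by <:].
HB.instance Definition _ F (S : subfield_pred F) := [SubChoice_isSubComUnitRing of subfield S by <:].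
HB.instance Definition _ F (S : subfield_pred F) := [SubComUnitRing_isSubIntegralDomain of subfield S by <:].
HB.instance Definition _ F (S : subfield_pred F) := [SubIntegralDomain_isSubField of subfield S by <:].

Section RatClosure.
Variables (R : realType) (F : fieldType) (v : F -> R).
Hypotheses (F0 : [pchar F] =i pred0) (vU : ultrametric_absval v).
Let vA := ultrametric_is_absval vU.

Definition rat_closure_mem : {pred F} := fun x => `[< rat_closure v x >].

Lemma rat_closure_divring : divring_closed rat_closure_mem.
Proof.
have clM x y : rat_closure v x -> rat_closure v y -> rat_closure v (x * y).
  move=> hx hy e e0; have pos a : 0 < v a + 1 by rewrite ltr_wpDl ?absval_ge0.
  have [b hb] := hy _ (divr_gt0 e0 (pos x)).
  have [a ha] := hx _ (divr_gt0 e0 (pos (ratr b))); exists (a * b).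
  rewrite -[ratr]/(ratf F0 : _ -> _) rmorphM /= in ha hb *.
  have small c d : v c < e / (v d + 1) -> v (c * d) < e.
    move=> h; rewrite absvalM //; apply: le_lt_trans (_ : v c * (v d + 1) < e).
      by rewrite ler_wpM2l ?absval_ge0 // lerDl ler01.
    by rewrite -ltr_pdivlMr.
  rewrite (_ : _ - _ = (y - ratf F0 b) * x + (x - ratf F0 a) * ratf F0 b); last by ring.
  by apply: ultraD_lt => //; exact: small.
have clV x : rat_closure v x -> rat_closure v x^-1.
  move=> hx e e0; have [->|x0] := eqVneq x 0.
    by exists 0; rewrite invr0 -[ratr]/(ratf F0 : _ -> _) rmorph0 subrr absval0.
  have vx : 0 < v x by rewrite absval_gt0.
  have d0 : 0 < Num.min (v x) (e * (v x * v x)) by rewrite lt_min vx !mulr_gt0.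
  have [z] := hx _ d0; rewrite lt_min -[ratr]/(ratf F0 : _ -> _) => /andP[h1 h2].
  have Ez : v (ratf F0 z) = v x by apply: ultra_eq => //; rewrite absvalB.
  have z0 : ratf F0 z != 0 by rewrite -(absval_eq0 vA) Ez (absval_eq0 vA).
  exists z^-1; rewrite fmorphV /=.
  have -> : x^-1 - (ratf F0 z)^-1 = (ratf F0 z - x) / (x * ratf F0 z).
    by field; rewrite x0 z0.
  by rewrite absvalM // absvalV // absvalM // Ez absvalB // ltr_pdivrMr ?mulr_gt0.
split.
- by apply/asboolP => e e0; exists 1; rewrite -[ratr]/(ratf F0 : _ -> _) rmorph1 subrr absval0.
- move=> x y /asboolP hx /asboolP hy; apply/asboolP => e e0.
  have [z hz] := hx e e0; have [w hw] := hy e e0; exists (z - w).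
  rewrite -[ratr]/(ratf F0 : _ -> _) rmorphB /= in hz hw *.
  have -> : x - y - (ratf F0 z - ratf F0 w) = (x - ratf F0 z) - (y - ratf F0 w) by ring.
  exact: ultraB_lt.
- by move=> x y /asboolP hx /asboolP hy; apply/asboolP; apply: clM => //; exact: clV.
Qed.
End RatClosure.

Section RootExistence.
Variables (R : realType) (k : closedFieldType) (C : fieldType).
Variables (v : k -> R) (w : C -> R) (j : {rmorphism k -> C}).
Hypotheses (vU : ultrametric_absval v) (wU : ultrametric_absval w).
Hypothesis compl : is_completion v w j.
Let vA := ultrametric_is_absval vU.
Let wA := ultrametric_is_absval wU.

Lemma ultraX_lip_le (F : fieldType) (u : F -> R) (uU : ultrametric_absval u) B (a b : F) n :
  1 <= B -> u a <= B -> u b <= B -> u (a ^+ n - b ^+ n) <= u (a - b) * B ^+ n.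
Proof.
move=> B1 ha hb; have uA := ultrametric_is_absval uU; have B0 := le_trans ler01 B1.
elim: n => [|n IH]; first by rewrite !expr0 subrr absval0 // mulr1 absval_ge0.
have -> : a ^+ n.+1 - b ^+ n.+1 = a * (a ^+ n - b ^+ n) + (a - b) * b ^+ n.
  by rewrite !exprS; ring.
apply: ultraD_le => //; rewrite absvalM //.
  rewrite exprS mulrCA; apply: ler_pM; rewrite ?absval_ge0 //.
rewrite ler_wpM2l ?absval_ge0 // absvalX //.
apply: (@le_trans _ _ (B ^+ n)); first by rewrite lerXn2r ?nnegrE ?absval_ge0.
by rewrite exprS ler_peMl // exprn_ge0.
Qed.

Lemma root_le (n : nat) (a : 'I_n -> k) B x : 1 <= B -> (forall i, v (a i) <= B) ->
  x ^+ n = \sum_(i < n) a i * x ^+ i -> v x <= B.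
Proof.
move=> B1 ha E; rewrite leNgt; apply/negP => lt.
have B0 : 0 < B by apply: lt_le_trans B1.
case: n a ha E => [|n] a ha E.
  by move: E; rewrite big_ord0 expr0 => /eqP; rewrite oner_eq0.
have : v (x ^+ n.+1) <= B * v x ^+ n.
  rewrite E; apply: ultra_sum_le => // [|i _].
    by rewrite mulr_ge0 ?exprn_ge0 ?absval_ge0 // ltW.
  rewrite absvalM // absvalX //; apply: ler_pM; rewrite ?exprn_ge0 ?absval_ge0 //.
  by apply: ler_weXn2l; [exact: ltW (le_lt_trans B1 lt) | rewrite -ltnS].
rewrite absvalX // exprS leNgt => /negP; apply.
by rewrite ltr_pM2r // exprn_gt0 // (lt_trans B0).
Qed.

Lemma nearby_root (n : nat) (a b : 'I_n -> k) B d x : (0 < n)%N -> 1 <= B -> 0 <= d ->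
  v x <= B -> x ^+ n = \sum_(i < n) a i * x ^+ i -> (forall i, v (a i - b i) <= d ^+ n) ->
  exists2 z, z ^+ n = \sum_(i < n) b i * z ^+ i & v (x - z) <= d * B.
Proof.
move=> n0 B1 d0 xB xE hab; have B0 := le_trans ler01 B1.
pose q : {poly k} := 'X^n - \poly_(i < n) (if insub i is Some i' then b i' else 0).
have qE y : q.[y] = y ^+ n - \sum_(i < n) b i * y ^+ i.
  rewrite hornerD hornerN hornerXn horner_poly; congr (_ - _); apply: eq_bigr => i _.
  by rewrite valK.
have sq : size q = n.+1.
  by rewrite size_polyDl ?size_polyXn // size_polyN ltnS size_poly.
have qm : q \is monic.
  rewrite monicE lead_coefE sq coefB coefXn eqxx coef_poly ltnn subr0 //.
have [s qs] := closed_field_poly_normal q.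
move: qs; rewrite (monicP qm) scale1r => qs.
have ss : size s = n by move: sq; rewrite qs size_prod_XsubC => -[].
have : v q.[x] <= (d * B) ^+ n.
  rewrite qE xE -sumrB; apply: ultra_sum_le => // [|i _].
    by rewrite exprn_ge0 // mulr_ge0.
  rewrite -mulrBl absvalM // absvalX // exprMn; apply: ler_pM; rewrite ?exprn_ge0 ?absval_ge0 //.
  apply: (@le_trans _ _ (B ^+ i)); first by rewrite lerXn2r ?nnegrE ?absval_ge0.
  by apply: ler_weXn2l => //; exact: ltnW.
rewrite qs horner_prod absval_prod // => h.
have [z zs hz] : exists2 z, z \in s & v (x - z) <= d * B.
  apply: contrapT => no.
  have : (d * B) ^+ size s < \prod_(z <- s) v ('X - z%:P).[x].
    have far z : z \in s -> d * B < v (x - z).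
      by move=> zs; rewrite ltNge; apply/negP => hz; apply: no; exists z.
    have s0 : (0 < size s)%N by rewrite ss.
    elim: (s) s0 far => // z [|z' s'] IH _ far.
      rewrite big_seq1 expr1 hornerXsubC; exact: far (mem_head _ _).
    rewrite big_cons exprS; apply: ltr_pM; rewrite ?mulr_ge0 ?exprn_ge0 ?mulr_ge0 //.
      by rewrite hornerXsubC; exact: far (mem_head _ _).
    by apply: IH => // y hy; apply: far; rewrite inE hy orbT.
  by rewrite ss ltNge h.
exists z => //; apply/eqP; rewrite -subr_eq0 -qE qs.
by rewrite -/(root _ _) root_prod_XsubC.
Qed.

Lemma half_pow_le n m : (n <= m)%N -> 2%:R^-1 ^+ m <= 2%:R^-1 ^+ n :> R.
Proof. by move=> h; apply: ler_wiXn2l; rewrite ?invr_ge0 // invf_le1 ?ltr0n // ler1n. Qed.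

Lemma half_pow_small (e : R) : 0 < e -> exists N, forall m, (N <= m)%N -> 2%:R^-1 ^+ m < e.
Proof.
move=> e0; have [||N hN] := @geometric_small R 2%:R^-1 e _ _ e0; rewrite ?invr_ge0 ?invf_lt1 ?ltr1n //.
by exists N => m /half_pow_le h; apply: le_lt_trans h hN.
Qed.

(* Roots of nearby monic polynomials are near each other, so the polynomials
   over [k] approximating [P] have roots that form a Cauchy sequence. *)
Lemma completion_root (n : nat) (P : 'I_n -> C) : (0 < n)%N ->
  exists x, x ^+ n = \sum_(i < n) P i * x ^+ i.
Proof.
move=> n0; have [iso dense cmpl] := compl.
pose B := 1 + \sum_i w (P i).
have B1 : 1 <= B by rewrite lerDl sumr_ge0 // => *; exact: absval_ge0.
have B0 : 0 < B by apply: lt_le_trans B1.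
have PB i : w (P i) <= B.
  rewrite /B (bigD1 i) //= addrCA lerDl addr_ge0 ?ler01 // sumr_ge0 // => *; exact: absval_ge0.
pose del m : R := 2%:R^-1 ^+ m.
have del0 m : 0 < del m by rewrite exprn_gt0 // invr_gt0 ltr0n.
have del1 m : del m <= 1 by rewrite exprn_ile1 ?invr_ge0 // invf_le1 ?ltr0n // ler1n.
have delM m m' : (m <= m')%N -> del m' <= del m by exact: half_pow_le.
have app m i : exists c, w (P i - j c) < del m ^+ n by apply: dense; exact: exprn_gt0.
pose a m i := projT1 (cid (app m i)).
have aP m i : w (P i - j (a m i)) < del m ^+ n := projT2 (cid (app m i)).
have aB m i : v (a m i) <= B.
  rewrite -iso (_ : j _ = P i - (P i - j (a m i))); last by ring.
  apply: ultraB_le => //; apply: le_trans (ltW (aP m i)) _.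
  by apply: le_trans B1; rewrite exprn_ile1 // ltW.
have aa m i : v (a m i - a m.+1 i) <= del m ^+ n.
  rewrite -iso rmorphB /= (_ : _ - _ = (P i - j (a m.+1 i)) - (P i - j (a m i))); last by ring.
  apply: ultraB_le => //; last exact: ltW.
  apply: le_trans (ltW (aP _ _)) _; apply: lerXn2r; rewrite ?nnegrE; [exact: ltW..|].
  exact: delM.
pose rt m (x : k) := x ^+ n = \sum_(i < n) a m i * x ^+ i.
have rtB m x : rt m x -> v x <= B by apply: root_le.
have [x0 hx0] : exists x, rt 0%N x.
  have [x hx] := @solve_monicpoly k n (fun i => if insub i is Some i' then a 0%N i' else 0) n0.
  by exists x; rewrite /rt hx; apply: eq_bigr => i _; rewrite valK.
have stepE m x : exists z, rt m x -> rt m.+1 z /\ v (x - z) <= del m * B.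
  case: (pselect (rt m x)) => [h|h]; last by exists 0 => /h.
  have [z hz1 hz2] := nearby_root n0 B1 (ltW (del0 m)) (rtB m x h) h (aa m).
  by exists z.
pose step m x := projT1 (cid (stepE m x)).
have stepP m x := projT2 (cid (stepE m x)).
pose s := fix s m := if m is m'.+1 then step m' (s m') else x0.
have sR m : rt m (s m) by elim: m => //= m IH; case: (stepP m (s m) IH).
have sD m d : v (s m - s (m + d)%N) <= del m * B.
  elim: d => [|d IH]; first by rewrite addn0 subrr absval0 // mulr_ge0 // ltW.
  rewrite addnS -[s m](subrK (s (m + d)%N)) -addrA; apply: ultraD_le => //.
  have [_ h] := stepP (m + d)%N (s (m + d)%N) (sR _).
  by apply: le_trans h _; rewrite ler_wpM2r ?(ltW B0) // delM // leq_addr.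
have sC : cauchy_seq w (fun m => j (s m)).
  move=> e e0; have [N hN] := half_pow_small (divr_gt0 e0 B0); exists N => m m' h h'.
  have lt : del N * B < e by rewrite -ltr_pdivlMr //; exact: hN.
  rewrite -rmorphB iso; apply: le_lt_trans lt.
  rewrite (_ : s m - s m' = (s N - s m') - (s N - s m)); last by ring.
  by apply: ultraB_le => //; rewrite -(subnKC h, subnKC h').
have [X hX] := cmpl _ sC.
have XB : w X <= B.
  have [N hN] := hX 1 ltr01; rewrite (_ : X = j (s N) - (j (s N) - X)); last by ring.
  by apply: ultraB_le => //; [rewrite iso; exact: rtB (sR N) | exact: le_trans (ltW (hN N (leqnn N))) B1].
exists X; apply/eqP; rewrite -subr_eq0 -(absval_eq0 wA) eq_le absval_ge0 // andbT.
apply/ler_addgt0Pr => e e0; rewrite add0r.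
have K0 : 0 < B * B ^+ n by rewrite mulr_gt0 // exprn_gt0.
have [N1 h1] := hX _ (divr_gt0 e0 K0).
have [N2 h2] := half_pow_small (divr_gt0 e0 K0).
pose m := maxn N1 N2.
have hm1 : w (X - j (s m)) * (B * B ^+ n) <= e.
  by rewrite -ler_pdivlMr // absvalB // ltW //; apply: h1; rewrite leq_maxl.
have hm2 : del m * (B * B ^+ n) <= e.
  by rewrite -ler_pdivlMr // ltW //; apply: h2; rewrite leq_maxr.
have sB : w (j (s m)) <= B by rewrite iso; exact: rtB (sR m).
have Bn0 i : 0 <= B ^+ i by rewrite exprn_ge0 // ltW.
have Bn i : (i <= n)%N -> B ^+ i <= B ^+ n by exact: ler_weXn2l.
have -> : X ^+ n - \sum_(i < n) P i * X ^+ i =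
   (X ^+ n - j (s m) ^+ n) - \sum_(i < n) (P i * X ^+ i - j (a m i) * j (s m) ^+ i).
  rewrite sumrB opprB -(rmorphXn j) (sR m : rt m (s m)) rmorph_sum /=.
  under [X in _ + (X - _)]eq_bigr => i _ do rewrite -rmorphXn -rmorphM.
  by rewrite addrA subrK.
apply: ultraB_le => //.
  apply: le_trans (@ultraX_lip_le _ _ wU B _ _ n B1 XB sB) _; apply: le_trans hm1.
  by rewrite ler_wpM2l ?absval_ge0 // ler_peMl.
apply: ultra_sum_le => // [|i _]; first exact: ltW.
have -> : P i * X ^+ i - j (a m i) * j (s m) ^+ i =
  P i * (X ^+ i - j (s m) ^+ i) + (P i - j (a m i)) * j (s m) ^+ i by ring.
apply: ultraD_le => //; rewrite absvalM //.
  apply: le_trans hm1; rewrite mulrCA; apply: ler_pM; rewrite ?absval_ge0 //.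
  apply: le_trans (@ultraX_lip_le _ _ wU B _ _ i B1 XB sB) _.
  by rewrite ler_wpM2l ?absval_ge0 // Bn // ltnW.
apply: le_trans hm2; apply: ler_pM; rewrite ?absval_ge0 //.
  apply: le_trans (ltW (aP m i)) _; rewrite -(prednK n0) exprS ler_piMr ?(ltW (del0 m)) //.
  by rewrite exprn_ile1 // ltW.
rewrite absvalX //; apply: le_trans (_ : B ^+ i <= _).
  by rewrite lerXn2r ?nnegrE ?(absval_ge0 wA) ?(ltW B0).
apply: le_trans (Bn i (ltnW (ltn_ord i))) _; by rewrite ler_peMl.
Qed.
End RootExistence.

Lemma Cp_tower_exists (R : realType) (k : closedFieldType) (k0 : [pchar k] =i pred0)
    (p : nat) (p_pr : prime p) (v : k -> R) : ultrametric_absval v ->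
  v p%:R = p%:R^-1 ->
  (forall x, exists q : {poly k}, [/\ q != 0, root q x & forall i, rat_closure v q`_i]) ->
  exists (M : Cp_tower R p) (tau : {rmorphism k -> Cp M}),
    (forall x, Cp_abs (tau x) = v x) /\ ultrametric_absval (@Cp_abs _ _ M).
Proof.
move=> vU vp valg; pose V := Ultrametric vU.
pose C : fieldType := completion V.
pose w : C -> R := @completion_abs R k V.
pose j : {rmorphism k -> C} := completion_inj V.
have wU : ultrametric_absval w := completion_abs_ultrametric V.
have wA := ultrametric_is_absval wU.
have compl : is_completion v w j := completion_is_completion V.
have [iso dense cmpl] := compl.
have C0 : [pchar C] =i pred0 by move=> x; rewrite (fmorph_pchar j).
have wp : w p%:R = p%:R^-1 by rewrite -(rmorph_nat j) iso.
pose SQ := SubfieldPred (rat_closure_divring C0 wU).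
pose Q : fieldType := subfield SQ.
pose incQ : {rmorphism Q -> C} := \val.
pose wQ (x : Q) := w (incQ x).
have wQA : is_absval wQ := absval_comp incQ wA.
have Q0 : [pchar Q] =i pred0 by move=> x; rewrite -(fmorph_pchar incQ).
have ratQ z : incQ (ratf Q0 z) = ratr z by exact: fmorph_rat.
have QP : is_completion (padic_abs R p) wQ (ratf Q0).
  split=> [z|y e e0|x hx].
  - by rewrite /wQ ratQ (ultra_rat C0 p_pr wU wp).
  - have /asboolP/(_ e e0)[z hz] := valP y; exists z.
    by rewrite /wQ rmorphB ratQ.
  - have [|l hl] := cmpl (fun i => incQ (x i)).
      by move=> e /hx [n hn]; exists n => i i' h h'; rewrite -rmorphB; exact: hn.
    have lQ : l \in subfield_mem SQ.
      apply/asboolP => e e0; have [n hn] := hl e e0.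
      have /asboolP/(_ e e0)[z hz] := valP (x n); exists z.
      have -> : l - ratr z = (incQ (x n) - ratr z) - (incQ (x n) - l) by ring.
      by apply: ultraB_lt => //; exact: hn.
    exists (Subfield lQ) => e /hl [n hn]; exists n => i /hn.
    by rewrite /wQ rmorphB.
pose Salg : {pred C} := fun x => `[< algebraicOver incQ x >].
have SalgP : divring_closed Salg.
  split=> [|x y /asboolP hx /asboolP hy|x y /asboolP hx /asboolP hy]; apply/asboolP.
  - exact: algebraic1.
  - exact: algebraic_sub.
  - exact: algebraic_div.
pose SA := SubfieldPred SalgP.
pose A0 : fieldType := subfield SA.
pose incA0 : {rmorphism A0 -> C} := \val.
have A0closed : GRing.closed_field_axiom A0.
  move=> n P n0; have [x hx] := completion_root vU wU compl (fun i : 'I_n => incA0 (P i)) n0.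
  have xA : x \in subfield_mem SA.
    apply/asboolP/integral_algebraic.
    pose q : {poly C} := 'X^n - \poly_(i < n) incA0 (P i).
    have sq : size q = n.+1.
      by rewrite size_polyDl ?size_polyXn // size_polyN ltnS size_poly.
    have qm : q \is monic.
      by rewrite monicE lead_coefE sq coefB coefXn eqxx coef_poly ltnn subr0.
    apply: (integral_root_monic qm).
      by apply/rootP; rewrite hornerD hornerN hornerXn horner_poly hx subrr.
    move=> c; rewrite -[c]/(id c) => /(nthP 0)[i _ <-]; apply/integral_algebraic.
    rewrite coefB coefXn coef_poly; apply: algebraic_sub.
      by case: eqP => _; [exact: algebraic1 | exact: algebraic0].
    case: ifP => _; last exact: algebraic0.
    by have /asboolP := valP (P i).
  exists (Subfield xA); apply: (fmorph_inj incA0).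
  have E : incA0 (Subfield xA) = x by [].
  rewrite (rmorphXn incA0) E hx (rmorph_sum incA0); apply: eq_bigr => i _.
  by rewrite (rmorphM incA0) (rmorphXn incA0) E.
pose A : closedFieldType := HB.pack (subfield SA) (Field_isAlgClosed.Build (subfield SA) A0closed).
pose incA : {rmorphism A -> C} := incA0.
pose wAb (x : A) := w (incA x).
have wAbA : is_absval wAb := absval_comp incA wA.
have QA x : incQ x \in subfield_mem SA by apply/asboolP; exact: algebraic_id.
pose QtoA (x : Q) : A := Subfield (QA x).
have QtoA_zmod : zmod_morphism QtoA by move=> x y; apply: (fmorph_inj incA).
have QtoA_monoid : monoid_morphism QtoA by split=> [|x y]; apply: (fmorph_inj incA).
pose QtoAm : {rmorphism Q -> A} := HB.pack QtoA
  (GRing.isZmodMorphism.Build Q A QtoA QtoA_zmod)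
  (GRing.isMonoidMorphism.Build Q A QtoA QtoA_monoid).
have algA (x : A) : algebraicOver QtoAm x.
  have /asboolP[q q0 qx] := valP x; exists q => //.
  move/rootP: qx => qx; apply/rootP/(fmorph_inj incA); rewrite rmorph0 -qx.
  by rewrite -horner_map -map_poly_comp.
have kA x : j x \in subfield_mem SA.
  apply/asboolP; have [q [q0 qx qc]] := valg x.
  have qQ i : j q`_i \in subfield_mem SQ.
    apply/asboolP => e e0; have [z hz] := qc i e e0; exists z.
    by rewrite -(fmorph_rat j) -rmorphB iso.
  pose r : {poly Q} := \poly_(i < size q) Subfield (qQ i).
  have rE : map_poly incQ r = map_poly j q.
    apply/polyP => i; rewrite !coef_map coef_poly; case: ltnP => // h.
    exact: etrans (rmorph0 incQ) (esym (etrans (congr1 j (nth_default 0 h)) (rmorph0 j))).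
  exists r; first by rewrite -(map_poly_eq0 incQ) rE map_poly_eq0.
  by rewrite rE; apply/rootP; rewrite horner_map (rootP qx) rmorph0.
have CP : is_completion wAb w incA.
  split=> // y e e0; have [x hx] := dense y e e0.
  by exists (Subfield (kA x) : A).
pose M : Cp_tower R p := @CpTower R p Q wQ (ratf Q0) wQA QP A wAb QtoAm wAbA
  (fun x => erefl) algA C w incA wA CP.
by exists M, j.
Qed.

Theorem padic_place (R : realType) (k : closedFieldType) (k0 : [pchar k] =i pred0)
    (trdeg : finite_trdeg k) (S : seq k) (B : nat) : 0 \notin S ->
  exists (p : nat) (M : Cp_tower R p) (tau : {rmorphism k -> Cp M}),
  [/\ prime p, (B < p)%N, ultrametric_absval (@Cp_abs _ _ M), Cp_abs (tau p%:R) = p%:R^-1 &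
      forall s, s \in S -> Cp_abs (tau s) = 1 /\
        exists2 r, (0 < r)%N & Cp_abs (tau (s ^+ r - 1)) < 1].
Proof.
move=> S0; have [p [v [[p_pr Bp] vU vp vS valg]]] := padic_valuation R k0 trdeg B S0.
have [M [tau [tauE MU]]] := Cp_tower_exists k0 p_pr vU vp valg.
exists p, M, tau; split=> // [|s /vS [v1 [r r0 hr]]]; first by rewrite tauE.
by rewrite tauE; split=> //; exists r; rewrite ?tauE.
Qed.

(** * Affine space as a variety *)

Section ModuleLocalization.
Variables (A : comPzRingType) (M : lmodType A) (f : A).

Definition loc_rel (x y : M * nat) : bool :=
  `[< exists l, f ^+ (l + y.2) *: x.1 = f ^+ (l + x.2) *: y.1 >].

Lemma loc_rel_equiv : equiv_class_of loc_rel.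
Proof.
split=> [x|x y|y x z].
- by apply/asboolP; exists 0%N.
- by apply/asboolP/asboolP => -[l E]; exists l.
move=> /asboolP[l E] /asboolP[l' E']; apply/asboolP; exists (l + l' + y.2)%N.
have -> : (l + l' + y.2 + z.2 = (l' + z.2) + (l + y.2))%N by lia.
rewrite exprD -scalerA E scalerA mulrC -scalerA E' scalerA -exprD.
by congr (_ ^+ _ *: _); lia.
Qed.
Canonical loc_equiv := EquivRelPack loc_rel_equiv.

Definition locmod := {eq_quot loc_rel}.
HB.instance Definition _ := Choice.on locmod.

Definition loc_pi (m : M) (n : nat) : locmod := \pi_locmod (m, n).

Lemma loc_piE m n m' n' : loc_pi m n = loc_pi m' n' <->
  exists l, f ^+ (l + n') *: m = f ^+ (l + n) *: m'.
Proof.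
split=> [/eqmodP/asboolP //|h]; by apply/eqmodP/asboolP.
Qed.

Lemma loc_piP (x : locmod) : exists m n, x = loc_pi m n.
Proof. by elim/quotW: x => -[m n]; exists m, n. Qed.

Definition loc_add (x y : locmod) : locmod :=
  let a := repr x in let b := repr y in
  loc_pi (f ^+ b.2 *: a.1 + f ^+ a.2 *: b.1) (a.2 + b.2).
Definition loc_opp (x : locmod) : locmod := loc_pi (- (repr x).1) (repr x).2.

Lemma loc_repr m n : exists l,
  f ^+ (l + n) *: (repr (loc_pi m n)).1 = f ^+ (l + (repr (loc_pi m n)).2) *: m.
Proof.
have : loc_pi m n = loc_pi (repr (loc_pi m n)).1 (repr (loc_pi m n)).2.
  by rewrite /loc_pi -surjective_pairing reprK.
by move/loc_piE => [l E]; exists l.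
Qed.

Lemma loc_addE m n m' n' : loc_add (loc_pi m n) (loc_pi m' n') =
  loc_pi (f ^+ n' *: m + f ^+ n *: m') (n + n').
Proof.
rewrite /loc_add; have [l E] := loc_repr m n; have [l' E'] := loc_repr m' n'.
move: (repr _) E => [a s] /= E; move: (repr _) E' => [b t] /= E'.
apply/loc_piE; exists (l + l')%N; rewrite !scalerDr !scalerA -!exprD; congr (_ + _).
  have -> : (l + l' + (n + n') + t = (l' + n' + t) + (l + n))%N by lia.
  rewrite exprD -scalerA E scalerA -exprD; congr (_ ^+ _ *: _); lia.
have -> : (l + l' + (n + n') + s = (l + n + s) + (l' + n'))%N by lia.
rewrite exprD -scalerA E' scalerA -exprD; congr (_ ^+ _ *: _); lia.
Qed.

Lemma loc_oppE m n : loc_opp (loc_pi m n) = loc_pi (- m) n.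
Proof.
rewrite /loc_opp; have [l E] := loc_repr m n; move: (repr _) E => [a s] /= E.
by apply/loc_piE; exists l; rewrite !scalerN E.
Qed.

Lemma loc_addA : associative loc_add.
Proof.
move=> x y z; have [a [i ->]] := loc_piP x; have [b [j ->]] := loc_piP y.
have [c [l ->]] := loc_piP z; rewrite !loc_addE addnA.
by rewrite !scalerDr !scalerA -!exprD addrA; congr (loc_pi (_ *: _ + _ *: _ + _ *: _) _); congr (_ ^+ _); lia.
Qed.
Lemma loc_addC : commutative loc_add.
Proof.
move=> x y; have [a [i ->]] := loc_piP x; have [b [j ->]] := loc_piP y.
by rewrite !loc_addE addrC addnC.
Qed.
Lemma loc_add0 : left_id (loc_pi 0 0) loc_add.
Proof.
move=> x; have [a [i ->]] := loc_piP x.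
by rewrite loc_addE scaler0 add0r expr0 scale1r.
Qed.
Lemma loc_addN : left_inverse (loc_pi 0 0) loc_opp loc_add.
Proof.
move=> x; have [a [i ->]] := loc_piP x; rewrite loc_oppE loc_addE scalerN addNr.
by apply/loc_piE; exists 0%N; rewrite !scaler0.
Qed.
HB.instance Definition _ := GRing.isZmodule.Build locmod loc_addA loc_addC loc_add0 loc_addN.

Lemma loc_piD m n m' n' : loc_pi m n + loc_pi m' n' = loc_pi (f ^+ n' *: m + f ^+ n *: m') (n + n').
Proof. exact: loc_addE. Qed.

Lemma loc_piDn m m' n : loc_pi m n + loc_pi m' n = loc_pi (m + m') n.
Proof.
rewrite loc_piD -scalerDr; apply/loc_piE; exists 0%N.
by rewrite scalerA -exprD add0n.
Qed.

Lemma loc_pi_cancel m n d : loc_pi (f ^+ d *: m) (n + d) = loc_pi m n.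
Proof. by apply/loc_piE; exists 0%N; rewrite scalerA -exprD. Qed.

Lemma loc_pi_eq0 m n : loc_pi m n = 0 -> exists l, f ^+ l *: m = 0.
Proof.
by move/loc_piE => [l]; rewrite addn0 scaler0 => h; exists l.
Qed.
End ModuleLocalization.

Section RingLocalization.
Variables (A : comPzRingType) (f : A).

Definition locring := locmod (A^o : lmodType A) f.
HB.instance Definition _ := GRing.Zmodule.on locring.
Definition locring_pi (a : A) (n : nat) : locring := loc_pi f (a : A^o) n.

Definition loc_mul (x y : locring) : locring :=
  let a := repr x in let b := repr y in locring_pi (a.1 * b.1) (a.2 + b.2).

Lemma loc_mulE a n b m : loc_mul (locring_pi a n) (locring_pi b m) = locring_pi (a * b) (n + m).
Proof.
rewrite /loc_mul; have [l E] := loc_repr f (a : A^o) n; have [l' E'] := loc_repr f (b : A^o) m.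
rewrite /locring_pi; move: (repr _) E => [a' s] /= E; move: (repr _) E' => [b' t] /= E'.
apply/loc_piE; exists (l + l')%N; rewrite /GRing.scale /= in E E' *.
have -> : (l + l' + (n + m) = (l + n) + (l' + m))%N by lia.
have -> : (l + l' + (s + t) = (l + s) + (l' + t))%N by lia.
by rewrite !exprD in E E' *; rewrite mulrACA E E' mulrACA.
Qed.
Lemma locring_piP (x : locring) : exists a n, x = locring_pi a n.
Proof. exact: (@loc_piP A A^o f x). Qed.
Lemma loc_mulA : associative loc_mul.
Proof.
move=> x y z; have [a [i ->]] := locring_piP x; have [b [j ->]] := locring_piP y.
by have [c [l ->]] := locring_piP z; rewrite !loc_mulE addnA mulrA.
Qed.
Lemma loc_mulC : commutative loc_mul.
Proof.
move=> x y; have [a [i ->]] := locring_piP x; have [b [j ->]] := locring_piP y.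
by rewrite !loc_mulE mulrC addnC.
Qed.
Lemma loc_mul1 : left_id (locring_pi 1 0) loc_mul.
Proof. by move=> x; have [a [i ->]] := locring_piP x; rewrite loc_mulE mul1r. Qed.
Lemma loc_mulD : left_distributive loc_mul +%R.
Proof.
move=> x y z; have [a [i ->]] := locring_piP x; have [b [j ->]] := locring_piP y.
have [c [l ->]] := locring_piP z; rewrite loc_mulE loc_mulE [locring_pi a i + _]loc_piD.
rewrite [RHS]loc_piD -/(locring_pi _ _) loc_mulE -[LHS](@loc_pi_cancel A A^o f _ _ l).
congr (loc_pi f _ _); last lia.
by rewrite /GRing.scale /= !exprD; ring.
Qed.
HB.instance Definition _ := GRing.Zmodule_isComPzRing.Build locring loc_mulA loc_mulC loc_mul1 loc_mulD.

Definition loc_map (a : A) : locring := locring_pi a 0.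
Fact loc_map_zmod : zmod_morphism loc_map.
Proof.
move=> a b; rewrite /loc_map -[- locring_pi b 0]/(loc_opp _) [loc_opp _]loc_oppE.
by rewrite [RHS]loc_piDn.
Qed.
Fact loc_map_monoid : monoid_morphism loc_map.
Proof. by split=> // a b; rewrite [RHS]loc_mulE. Qed.
HB.instance Definition _ := GRing.isZmodMorphism.Build A locring loc_map loc_map_zmod.
HB.instance Definition _ := GRing.isMonoidMorphism.Build A locring loc_map loc_map_monoid.

Lemma loc_map_is_localization : is_localization f loc_map.
Proof.
split.
- exists (locring_pi 1 1); rewrite [LHS]loc_mulE mulr1.
  by apply/loc_piE; exists 0%N; rewrite /GRing.scale /= mulrC.
- move=> b; have [a [n ->]] := locring_piP b; exists n, a.
  rewrite -rmorphXn [LHS]loc_mulE addn0; apply/loc_piE; exists 0%N.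
  by rewrite /GRing.scale /= expr0 mul1r mulrC.
- move=> a /loc_pi_eq0 [l h]; by exists l.
Qed.
End RingLocalization.

Section UnitIdeal.
Variables (A B : comPzRingType) (h : A -> B) (J : B -> Prop).
Hypotheses (J0 : J 0) (JD : forall x y, J x -> J y -> J (x + y))
  (JM : forall a x, J x -> J (a * x)).

Lemma unit_ideal_powers (E : A -> Prop) : unit_ideal h E ->
  (forall e, E e -> exists n, J (h e ^+ n)) -> J 1.
Proof.
move=> [s sE s1] hE; pose nil x := exists n, J (x ^+ n).
have Jsum I (r : seq I) (P : pred I) F : (forall i, P i -> J (F i)) -> J (\sum_(i <- r | P i) F i).
  by move=> H; elim/big_ind: _.
suff : nil (\sum_(p <- s) p.1 * h p.2) by rewrite s1 => -[n]; rewrite expr1n.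
rewrite big_seq; elim/big_ind: _.
- by exists 1%N; rewrite expr1.
- move=> x y [n hn] [m hm]; exists (n + m)%N; rewrite exprDn; apply: Jsum => i _.
  rewrite -mulr_natl; apply: JM; case: (leqP m i) => mi.
    by rewrite -(subnK mi) exprD mulrA; apply: JM.
  have -> : (n + m - i = (m - i) + n)%N by move: (nat_of_ord i) mi => i' mi; lia.
  by rewrite mulrC exprD mulrA; apply: JM.
- move=> p /sE /hE [n hn]; exists n; rewrite exprMn; exact: JM.
Qed.
End UnitIdeal.

Section KalgLocalization.
Variable K : fieldType.
Implicit Types A B T : kalg K.

Definition loc_kalg A (f : A) : kalg K := KAlg (loc_map f \o kstr A).

Definition loc_hom A (f : A) : khom A (loc_kalg f) :=
  @KHom K A (loc_kalg f) (loc_map f) (fun=> erefl).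

Lemma loc_homP A (f : A) : is_localization f (loc_hom f).
Proof. exact: loc_map_is_localization. Qed.

Lemma localization_lift A B (f : A) (l : khom A B) T (g : khom A T) (c : T) :
  is_localization f l -> g f * c = 1 -> exists h : khom B T, forall a, h (l a) = g a.
Proof.
move=> [_ sur ker] gc.
have gcX n : g f ^+ n * c ^+ n = 1 by rewrite -exprMn gc expr1n.
have wd b n a m a' : b * l f ^+ n = l a -> b * l f ^+ m = l a' -> g a * c ^+ n = g a' * c ^+ m.
  move=> h1 h2; have : l (a * f ^+ m - a' * f ^+ n) = 0.
    by rewrite rmorphB !rmorphM !rmorphXn -h1 -h2 mulrAC subrr.
  move/ker => [k /(congr1 g)]; rewrite rmorph0 rmorphM rmorphXn rmorphB !rmorphM !rmorphXn.
  move/(congr1 (fun y => c ^+ k * y)); rewrite mulr0 mulrA [c ^+ k * _]mulrC gcX mul1r.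
  move/eqP; rewrite subr_eq0 => /eqP E.
  rewrite -[LHS]mulr1 -(gcX m) -[RHS]mulr1 -(gcX n).
  rewrite mulrACA E [RHS]mulrACA; ring.
have ex b : exists y, exists n a, b * l f ^+ n = l a /\ y = g a * c ^+ n.
  by have [n [a h]] := sur b; exists (g a * c ^+ n), n, a.
pose h b := projT1 (cid (ex b)).
have hE b n a : b * l f ^+ n = l a -> h b = g a * c ^+ n.
  by move=> E; rewrite /h; case: cid => y /= [m [a' [E' ->]]]; exact: wd E' E.
have hl a : h (l a) = g a by rewrite (hE _ 0%N a) ?expr0 ?mulr1.
have h_zmod : zmod_morphism h.
  move=> x y; have [n [a Ex]] := sur x; have [m [b Ey]] := sur y.
  rewrite (hE _ _ _ Ex) (hE _ _ _ Ey) (hE (x - y) (n + m)%N (a * f ^+ m - b * f ^+ n)).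
    rewrite rmorphB !rmorphM !rmorphXn exprD mulrBl; congr (_ - _).
      by rewrite mulrACA gcX mulr1.
    by rewrite [c ^+ n * _]mulrC mulrACA gcX mulr1.
  by rewrite rmorphB !rmorphM !rmorphXn -Ex -Ey exprD; ring.
have h_monoid : monoid_morphism h.
  split=> [|x y]; first by rewrite -(rmorph1 l) hl rmorph1.
  have [n [a Ex]] := sur x; have [m [b Ey]] := sur y.
  rewrite (hE _ _ _ Ex) (hE _ _ _ Ey) (hE (x * y) (n + m)%N (a * b)).
    by rewrite rmorphM exprD mulrACA.
  by rewrite rmorphM -Ex -Ey exprD mulrACA.
pose hm : {rmorphism B -> T} := HB.pack h
  (GRing.isZmodMorphism.Build B T h h_zmod) (GRing.isMonoidMorphism.Build B T h h_monoid).
have hK c' : hm (kstr B c') = kstr T c' by rewrite -(kmapK l) [LHS]hl kmapK.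
by exists (KHom hK) => a; exact: hl.
Qed.

Definition khom_comp A B T (g : khom B T) (h : khom A B) : khom A T.
Proof. by exists (g \o h) => c; rewrite /= !kmapK. Defined.

Definition khom_id A : khom A A.
Proof. by exists idfun. Defined.

(* Locally on its source, an open immersion Spec A -> Spec B is a localization. *)
Lemma affine_open_local (X : kfunctor K) A B (u : X A) (v : X B) (h : khom B A) :
  affine_open u -> affine_open v -> act h v = u ->
  exists2 E : B -> Prop, unit_ideal h E & forall e, E e ->
    exists (Be : kalg K) (l : khom B Be) (psi : khom A Be),
    [/\ is_localization e l, forall b, psi (h b) = l b &
        forall a, psi a = 0 -> exists n, h e ^+ n * a = 0].
Proof.
move=> [u_mono u_open] [v_mono _] hv; have [E hE] := u_open B v.
exists E; first by apply/hE; exists (khom_id A); rewrite (act_id u) // hv.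
move=> e Ee; exists (loc_kalg e), (loc_hom e).
have [[b0 hb0] sur ker] := loc_homP e.
have [psi hpsi] : exists psi : khom A (loc_kalg e), act psi u = act (loc_hom e) v.
  apply/hE; exists [:: (b0, e)]; first by move=> p; rewrite inE => /eqP ->.
  by rewrite big_seq1 mulrC.
have psih b : psi (h b) = loc_hom e b.
  apply: (v_mono _ (khom_comp psi h) (loc_hom e)).
  by rewrite -hpsi -hv -(act_comp (gh := khom_comp psi h)).
exists psi; split=> //; first exact: loc_homP.
move=> a pa; have [[c hc] _ kerA] := loc_homP (h e).
have [chi hchi] := @localization_lift _ _ e (loc_hom e) _ (khom_comp (loc_hom (h e)) h) c (loc_homP e) hc.
have /(_ a) : khom_comp chi psi =1 loc_hom (h e).
  apply: u_mono; rewrite (act_comp (g := chi) (h := psi)) // hpsi.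
  by rewrite -(act_comp (gh := khom_comp (loc_hom (h e)) h)) // -?hv ?(act_comp (g := loc_hom (h e)) (h := h)) // => b; rewrite hchi.
rewrite /= pa rmorph0 => /esym /kerA [n hn]; by exists n.
Qed.
End KalgLocalization.

Section AffineSpaceVariety.
Variables (K : fieldType) (N : nat).

Local Notation AN := (affine_space K N).

Definition mpoly_kalg : kalg K := @KAlg K {mpoly K[N]} (@mpolyC N K).

Definition generic_point : AN mpoly_kalg := \row_i 'X_i.

Lemma generic_point_eval (T : kalg K) (x : AN T) :
  exists h : khom mpoly_kalg T, act h generic_point = x.
Proof.
case: T x => T iT x /=; have [T1|T1] := eqVneq (1 : T) 0.
  have T0 (y : T) : y = 0 by rewrite -[y]mulr1 T1 mulr0.
  pose h (_ : {mpoly K[N]}) : T := 0.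
  have h_zmod : zmod_morphism h by move=> ? ?; rewrite /h subr0.
  have h_monoid : monoid_morphism h by split=> [|? ?]; rewrite /h ?mulr0 ?T1.
  pose hm : {rmorphism {mpoly K[N]} -> T} := HB.pack h
    (GRing.isZmodMorphism.Build _ _ h h_zmod) (GRing.isMonoidMorphism.Build _ _ h h_monoid).
  have hK c : hm (mpolyC N c) = iT c by rewrite [RHS]T0.
  by exists (@KHom K mpoly_kalg (KAlg iT) hm hK); apply/rowP => i; rewrite [LHS]T0 [RHS]T0.
pose T' : comNzRingType := HB.pack (GRing.ComPzRing.sort T) (GRing.PzSemiRing_isNonZero.Build T T1).
pose iT' : {rmorphism K -> T'} := iT.
pose hm : {rmorphism {mpoly K[N]} -> T'} := mmap iT' (fun i => (x : 'rV[T']_N) 0 i).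
have hK c : hm (mpolyC N c) = iT c by rewrite /hm /= mmapC.
exists (@KHom K mpoly_kalg (KAlg iT) hm hK); apply/rowP => i; rewrite !mxE.
by rewrite /hm /= mmapX mmap1U.
Qed.

Lemma mpoly_kalg_ext (T : kalg K) (h h' : khom mpoly_kalg T) :
  act h generic_point = act h' generic_point -> h =1 h'.
Proof.
move=> /rowP E P; rewrite [P]mpolyE !rmorph_sum /=; apply: eq_bigr => m _.
rewrite -mul_mpolyC !rmorphM; congr (_ * _); first by rewrite !(kmapK _ P@_m).
rewrite mpolyXE_id !rmorph_prod; apply: eq_bigr => i _; rewrite !rmorphXn; congr (_ ^+ _).
by have := E i; rewrite !mxE.
Qed.

Lemma generic_point_open : affine_open generic_point.
Proof.
split=> [|T x]; first exact: mpoly_kalg_ext.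
exists (fun=> True) => T' g; split=> _; last exact: generic_point_eval.
by exists [:: (1, 1)] => //; rewrite big_seq1 mul1r rmorph1.
Qed.

Lemma mpoly_kalg_fg : fg_algebra mpoly_kalg.
Proof.
exists [seq 'X_i | i : 'I_N] => S [S1 SB SM] SK Ss P.
have S0 : 0 \in S by rewrite -(subrr 1); apply: SB.
have SD : {in S &, forall x y, x + y \in S}.
  by move=> x y hx hy; rewrite -[y]opprK; apply: (SB) => //; rewrite -sub0r; exact: SB.
rewrite [P]mpolyE; elim/big_ind: _ => // m _.
rewrite -mul_mpolyC; apply: (SM); first exact: SK.
rewrite mpolyXE_id; elim/big_ind: _ => // i _.
have Xi : 'X_i \in S by apply: Ss; exact: map_f (mem_enum _ _).
by elim: (m i) => [|d IH]; rewrite ?expr0 // exprS; exact: SM.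
Qed.

Lemma affine_space_separated : separated AN.
Proof.
move=> T x y; exists (fun e => exists i, e = x 0 i - y 0 i) => T' g; split.
  by move=> /rowP E _ [i ->]; have := E i; rewrite !mxE rmorphB => ->; rewrite subrr.
move=> h; apply/rowP => i; rewrite !mxE; apply/eqP; rewrite -subr_eq0 -rmorphB.
by apply/eqP; apply: h; exists i.
Qed.

Lemma unit_ideal_kill (A B : comPzRingType) (h : A -> B) (E : A -> Prop) (a : B) :
  unit_ideal h E -> (forall e, E e -> exists n, h e ^+ n * a = 0) -> a = 0.
Proof.
move=> hE ha; rewrite -[a]mul1r.
apply: (@unit_ideal_powers _ _ h (fun x => x * a = 0) _ _ _ E hE ha).
- by rewrite mul0r.
- by move=> x y hx hy; rewrite mulrDl hx hy addr0.
- by move=> x y hx; rewrite -mulrA hx mulr0.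
Qed.

Lemma affine_space_reduced : reduced AN.
Proof.
move=> A u uo a n an; have [n0|n0] := posnP n.
  by rewrite -[a]mulr1 -(expr0 a) -n0 an mulr0.
have [h hu] := generic_point_eval u.
have [E hE loc] := affine_open_local uo generic_point_open hu.
apply: unit_ideal_kill hE _ => e /loc [Be [l [psi [[[b0 hb0] sur ker] hpsi kill]]]].
apply: kill; have [m [b hb]] := sur (psi a).
have : l (b ^+ n) = 0.
  by rewrite rmorphXn -hb exprMn -(rmorphXn psi) an (rmorph0 psi) mul0r.
move=> /ker [d] /eqP; rewrite mulf_eq0 !expf_eq0 n0 => /orP[/andP[_ /eqP e0]|/eqP b0'].
  have B1 : 1 = 0 :> Be by rewrite -hb0 e0 rmorph0 mul0r.
  by rewrite -[psi a]mulr1 B1 mulr0.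
move: hb; rewrite b0' rmorph0 => /(congr1 (fun y => y * b0 ^+ m)).
by rewrite mul0r -mulrA -exprMn hb0 expr1n mulr1.
Qed.

Lemma affine_space_sheaf : zariski_sheaf AN.
Proof.
move=> T r f Tf l x fE lf match_x.
have ex i j : exists2 n, (0 < n)%N & exists a, x i 0 j * l i (f i) ^+ n = l i a.
  have [[c hc] sur _] := lf i; have [n [a ha]] := sur (x i 0 j).
  exists n.+1 => //; exists (a * f i); by rewrite exprSr mulrA ha rmorphM.
have up i j n a m : x i 0 j * l i (f i) ^+ n = l i a -> (n <= m)%N ->
    x i 0 j * l i (f i) ^+ m = l i (a * f i ^+ (m - n)).
  by move=> h nm; rewrite -{1}(subnK nm) addnC exprD mulrA h rmorphM rmorphXn.
have [n hn] : exists n, forall i j, exists a, x i 0 j * l i (f i) ^+ n = l i a.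
  pose n i j := s2val (cid2 (ex i j)).
  exists (\max_i \max_j n i j)%N => i j; have [a ha] := s2valP' (cid2 (ex i j)).
  exists (a * f i ^+ ((\max_i \max_j n i j) - n i j)); apply: up ha _.
  apply: leq_trans (leq_bigmax (F := fun i => \max_j n i j)%N i).
  exact: (leq_bigmax (F := fun j => n i j) j).
pose a i j := projT1 (cid (hn i j)).
have aP i j : x i 0 j * l i (f i) ^+ n = l i (a i j) := projT2 (cid (hn i j)).
have glue i i' j : exists d, (f i * f i') ^+ d * (a i j * f i' ^+ n - a i' j * f i ^+ n) = 0.
  pose T' := loc_kalg (f i * f i'); pose L := loc_hom (f i * f i').
  have [[c hc] _ ker] := loc_homP (f i * f i').
  have [|g hg] := @localization_lift _ _ _ _ (l i) T' L (L (f i') * c) (lf i).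
    by rewrite mulrA -rmorphM.
  have [|g' hg'] := @localization_lift _ _ _ _ (l i') T' L (L (f i) * c) (lf i').
    by rewrite mulrA -rmorphM [f i' * _]mulrC.
  have /rowP/(_ j) := match_x i i' T' g g' (fun t => etrans (hg t) (esym (hg' t))).
  rewrite !mxE => E; apply: ker; apply/eqP; rewrite rmorphB subr_eq0; apply/eqP.
  have e1 : L (a i j) = g (x i 0 j) * L (f i) ^+ n by rewrite -hg -aP rmorphM rmorphXn hg.
  have e2 : L (a i' j) = g' (x i' 0 j) * L (f i') ^+ n by rewrite -hg' -aP rmorphM rmorphXn hg'.
  by rewrite !(rmorphM L) !(rmorphXn L) e1 e2 E mulrAC.
pose dd i i' j := projT1 (cid (glue i i' j)).
pose d := (\max_i \max_i' \max_j dd i i' j)%N.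
have glued i i' j : (f i * f i') ^+ d * (a i j * f i' ^+ n - a i' j * f i ^+ n) = 0.
  have h := projT2 (cid (glue i i' j)); have le : (dd i i' j <= d)%N.
    apply: leq_trans (leq_bigmax (F := fun i => \max_i' \max_j dd i i' j)%N i).
    apply: leq_trans (leq_bigmax (F := fun i' => \max_j dd i i' j)%N i').
    exact: (leq_bigmax (F := fun j => dd i i' j) j).
  by rewrite -(subnK le) exprD -mulrA h mulr0.
pose b i j := f i ^+ d * a i j; pose m := (n + d)%N.
have bP i j : x i 0 j * l i (f i) ^+ m = l i (b i j).
  by rewrite exprD mulrA aP rmorphM rmorphXn mulrC.
have bb i i' j : b i j * f i' ^+ m = b i' j * f i ^+ m.
  have := glued i i' j; rewrite mulrBr => /eqP; rewrite subr_eq0 => /eqP E.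
  rewrite /b /m !exprD; move: E; rewrite !exprMn => E.
  rewrite [f i' ^+ n * _]mulrC mulrACA E [f i ^+ n * _]mulrC [RHS]mulrACA.
  by rewrite [f i' ^+ d * f i ^+ d]mulrC.
have [c hc] : exists c : 'I_r -> T, \sum_i c i * f i ^+ m = 1.
  pose J y := exists c : 'I_r -> T, y = \sum_i c i * f i ^+ m.
  have [] // : J 1; last by move=> c ->; exists c.
  apply: (@unit_ideal_powers _ _ id J _ _ _ _ fE).
  - by exists (fun=> 0); rewrite big1 // => i _; rewrite mul0r.
  - move=> y z [c ->] [c' ->]; exists (fun i => c i + c' i); rewrite -big_split.
    by apply: eq_bigr => i _; rewrite mulrDl.
  - move=> y z [c ->]; exists (fun i => y * c i); rewrite mulr_sumr.
    by apply: eq_bigr => i _; rewrite mulrA.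
  - move=> _ [i ->]; exists m, (fun i' => (i' == i)%:R); rewrite (bigD1 i) //= eqxx mul1r.
    by rewrite big1 ?addr0 // => i' /negPf ->; rewrite mul0r.
have lX i k (y z : Tf i) : y * l i (f i) ^+ k = z * l i (f i) ^+ k -> y = z.
  have [[u hu] _ _] := lf i; move/(congr1 (fun w => w * u ^+ k)).
  by rewrite -!mulrA -exprMn hu expr1n !mulr1.
have patch i' j : l i' (\sum_i c i * b i j) * l i' (f i') ^+ m = x i' 0 j * l i' (f i') ^+ m.
  rewrite bP -rmorphXn -rmorphM mulr_suml; congr (l i' _).
  rewrite -[RHS]mul1r -hc mulr_suml; apply: eq_bigr => i _.
  by rewrite -[LHS]mulrA bb mulrA mulrAC.
exists (\row_j \sum_i c i * b i j); split.
  by move=> i'; apply/rowP => j; rewrite !mxE; apply: (lX i' m).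
move=> y hy; apply/rowP => j; rewrite mxE; apply/eqP; rewrite -subr_eq0; apply/eqP.
apply: (unit_ideal_kill fE) => _ [i' ->]; have [_ _ ker] := lf i'.
apply: ker; rewrite rmorphB; apply/eqP; rewrite subr_eq0; apply/eqP.
have /rowP/(_ j) := hy i'; rewrite mxE => ->.
by apply: (lX i' m); rewrite patch.
Qed.

Lemma affine_space_variety : is_variety AN.
Proof.
split; [|exact: affine_space_separated|exact: affine_space_reduced].
split; first exact: affine_space_sheaf.
exists 1%N, (fun=> mpoly_kalg), (fun=> generic_point); split.
- by move=> _; exact: generic_point_open.
- by move=> _; exact: mpoly_kalg_fg.
- by move=> L s x; exists ord0; exact: generic_point_eval.
Qed.
End AffineSpaceVariety.

Lemma tensor_null_eq (A B : comPzRingType) (h : A -> B) (M : lmodType A) (s s' : seq (B * M)) :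
  (forall (G : zmodType) (b : B -> M -> G),
    (forall x y m, b (x + y) m = b x m + b y m) ->
    (forall x m n, b x (m + n) = b x m + b x n) ->
    (forall a x m, b (h a * x) m = b x (a *: m)) ->
    \sum_(p <- s) b p.1 p.2 = \sum_(p <- s') b p.1 p.2) ->
  tensor_null h s -> tensor_null h s'.
Proof. by move=> E hs G b b1 b2 b3; rewrite -E // hs. Qed.

Section OpenImmersionFlat.
Variables (A B : comPzRingType) (h : {rmorphism B -> A}) (e : B) (Be : comPzRingType).
Variables (l : {rmorphism B -> Be}) (psi : {rmorphism A -> Be}).
Hypotheses (l_loc : is_localization e l) (psih : forall b, psi (h b) = l b).

Lemma localization_test_map (M : lmodType B) : exists b : A -> M -> locmod M e,
  [/\ forall x y m, b (x + y) m = b x m + b y m,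
      forall x m n, b x (m + n) = b x m + b x n,
      forall a x m, b (h a * x) m = b x (a *: m) &
      forall c m, b (h c) m = loc_pi e (c *: m) 0].
Proof.
have [_ sur ker] := l_loc.
have ex a : exists cn : B * nat, psi a * l e ^+ cn.2 = l cn.1.
  by have [n [c E]] := sur (psi a); exists (c, n).
pose num a := projT1 (cid (ex a)); have numP a := projT2 (cid (ex a)) : psi a * l e ^+ (num a).2 = l (num a).1.
pose b a (m : M) := loc_pi e ((num a).1 *: m) (num a).2.
have bE a c n m : psi a * l e ^+ n = l c -> b a m = loc_pi e (c *: m) n.
  move=> E; have : l ((num a).1 * e ^+ n - c * e ^+ (num a).2) = 0.
    by rewrite rmorphB !rmorphM !rmorphXn -numP -E mulrAC subrr.
  move/ker => [k Ek]; apply/loc_piE; exists k; rewrite !scalerA.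
  have : e ^+ k * ((num a).1 * e ^+ n) - e ^+ k * (c * e ^+ (num a).2) = 0 by rewrite -mulrBr.
  move/eqP; rewrite subr_eq0 => /eqP E'; congr (_ *: m).
  by rewrite !exprD -!mulrA [e ^+ n * _]mulrC [e ^+ (num a).2 * _]mulrC.
exists b; split.
- move=> x y m; rewrite (bE (x + y) ((num x).1 * e ^+ (num y).2 + (num y).1 * e ^+ (num x).2) ((num x).2 + (num y).2)%N).
    by rewrite loc_piD !scalerA -scalerDl; congr (loc_pi e (_ *: m) _); ring.
  rewrite (rmorphD psi) (rmorphD l) !(rmorphM l) !(rmorphXn l) -!numP exprD mulrDl.
  by congr (_ + _); rewrite mulrA // mulrAC.
- by move=> x m n; rewrite /b scalerDr loc_piDn.
- move=> a x m; rewrite (bE (h a * x) (a * (num x).1) (num x).2).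
    by rewrite /b scalerA mulrC.
  by rewrite !rmorphM psih -numP mulrA.
- by move=> c m; rewrite (bE (h c) c 0%N) // expr0 mulr1.
Qed.
End OpenImmersionFlat.

Lemma biadditive_sum (B M G : zmodType) (b : B -> M -> G) (I : Type) (r : seq I) (F : I -> M) x :
  (forall x m n, b x (m + n) = b x m + b x n) -> b x (\sum_(i <- r) F i) = \sum_(i <- r) b x (F i).
Proof.
move=> bD; have b0 : b x 0 = 0 by apply: (addrI (b x 0)); rewrite -bD !addr0.
by apply: (big_morph (b x)).
Qed.

Lemma flat_of_local_sections (A B : comPzRingType) (h : {rmorphism B -> A}) (E : B -> Prop) :
  unit_ideal h E ->
  (forall e, E e -> exists (Be : comPzRingType) (l : {rmorphism B -> Be}) (psi : {rmorphism A -> Be}),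
    [/\ is_localization e l, forall b, psi (h b) = l b &
        forall a, psi a = 0 -> exists n, h e ^+ n * a = 0]) ->
  flat_ring_map h.
Proof.
move=> hE loc M' M u u_inj s s_null.
pose J c := tensor_null h [seq (c * p.1, p.2) | p <- s].
suff : J 1.
  apply: tensor_null_eq => G b *; rewrite big_map; apply: eq_bigr => p _.
  by rewrite mul1r.
apply: (@unit_ideal_powers _ _ h J _ _ _ E hE).
- move=> G b b1 b2 b3; rewrite big_map big1 // => p _ /=.
  by rewrite mul0r; apply: (addrI (b 0 p.2)); rewrite -b1 !addr0.
- move=> x y hx hy G b b1 b2 b3; rewrite big_map.
  under eq_bigr => p _ do rewrite mulrDl b1.
  rewrite big_split /=; have := hx G b b1 b2 b3; have := hy G b b1 b2 b3.
  by rewrite !big_map /= => -> ->; rewrite addr0.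
- move=> a x hx G b b1 b2 b3; rewrite big_map /=.
  under eq_bigr => p _ do rewrite -mulrA.
  have := hx G (fun z m => b (a * z) m); rewrite big_map; apply.
  + by move=> z y m; rewrite mulrDr b1.
  + by move=> z m n; rewrite b2.
  + by move=> c z m; rewrite mulrCA b3.
move=> e Ee; have [Be [l [psi [l_loc psih kill]]]] := loc e Ee.
have [_ sur ker] := l_loc.
have ex (p : A * M') : exists nc : nat * B, h e ^+ nc.1 * p.1 = h nc.2.
  have [n [c hc]] := sur (psi p.1).
  have [k hk] : exists k, h e ^+ k * (p.1 * h e ^+ n - h c) = 0.
    by apply: kill; rewrite rmorphB rmorphM rmorphXn !psih hc subrr.
  exists ((k + n)%N, e ^+ k * c); rewrite rmorphM rmorphXn /=; apply/eqP.
  by rewrite -subr_eq0 -[X in _ == X]hk mulrBr exprD -mulrA [h e ^+ n * _]mulrC.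
pose n p := (projT1 (cid (ex p))).1.
pose N := (\sum_(p <- s) n p)%N.
pose c p := e ^+ (N - n p) * (projT1 (cid (ex p))).2.
have cP p : p \in s -> h e ^+ N * p.1 = h (c p).
  move=> ps; have le : (n p <= N)%N by rewrite /N (big_rem p) //= leq_addr.
  by rewrite /c rmorphM rmorphXn -(projT2 (cid (ex p))) mulrA -exprD subnK.
pose m := \sum_(p <- s) c p *: p.2.
have [bl [bl1 bl2 bl3 bl4]] := localization_test_map l_loc psih M.
have [d hd] : exists d, e ^+ d *: m = 0.
  have [d hd] : exists d, e ^+ d *: u m = 0.
    apply: (@loc_pi_eq0 _ _ e _ 0%N).
    have := s_null _ (fun z y => bl z (e ^+ N *: y)); rewrite big_map /= => H.
    rewrite -[RHS]H.
    + rewrite -[u m]scale1r -bl4 rmorph1 linear_sum (@biadditive_sum A M) //.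
      rewrite big_seq [RHS]big_seq; apply: eq_bigr => p ps.
      by rewrite linearZ -!bl3 mulr1 (rmorphXn h) cP.
    + by move=> *; exact: bl1.
    + by move=> x y z; rewrite scalerDr bl2.
    + by move=> a x y; rewrite bl3 !scalerA mulrC.
  by exists d; apply: u_inj; rewrite linear0 -[RHS]hd linearZ.
exists (d + N)%N => G b b1 b2 b3; rewrite big_map big_seq.
rewrite (eq_bigr (fun p => b 1 (e ^+ d *: (c p *: p.2)))) => [|p ps]; last first.
  rewrite scalerA -b3 mulr1 rmorphM -cP // rmorphXn /= exprD -mulrA //.
rewrite -big_seq -(@biadditive_sum A M') // -scaler_sumr -/m hd.
by apply: (addrI (b 1 0)); rewrite -b2 !addr0.
Qed.

Section AffineSpaceFlat.
Variables (K : fieldType) (N : nat).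

Definition affine_space_id : kmor (affine_space K N) (affine_space K N) :=
  @KMor K _ _ (fun _ y => y) (fun _ _ _ _ => erefl).

Lemma affine_space_id_flat : flat_morphism affine_space_id.
Proof.
move=> A B u v uo vo h hv; have [E hE loc] := affine_open_local uo vo hv.
apply: flat_of_local_sections hE _ => e /loc [Be [l [psi [h1 h2 h3]]]].
by exists Be, l, psi.
Qed.
End AffineSpaceFlat.

(** * Finite extensions inside [k] *)

Lemma finite_extension_span (F E : fieldType) (j : {rmorphism F -> E}) (I : finType) (i0 : I)
    (w : I -> E) : (forall x, exists c : I -> F, x = \sum_i j (c i) * w i) -> finite_extension j.
Proof.
move=> H; exists [seq w i | i <- index_enum I] => x; have [c ->] := H x.
exists (fun i => c (nth i0 (index_enum I) i)).
rewrite -[RHS](big_mkord xpredT (fun i => j (c (nth i0 (index_enum I) i)) * [seq w i | i <- index_enum I]`_i)).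
rewrite [LHS](big_nth i0) size_map; apply: eq_big_nat => i /andP[_ lt].
by rewrite (nth_map i0).
Qed.

Lemma adjoin_element (F0 F k : fieldType) (j0 : {rmorphism F0 -> F}) (i : {rmorphism F -> k}) (z : k) :
  finite_extension j0 -> algebraicOver i z ->
  exists (E : fieldType) (j : {rmorphism F -> E}) (iota : {rmorphism E -> k}),
    [/\ forall a, iota (j a) = i a, finite_extension (j \o j0) & exists y, iota y = z].
Proof.
move=> [s hs] [p p0 pz]; pose E : fieldType := subFExtend i z p.
pose j : {rmorphism F -> E} := inj_subfx i z p.
pose iota : {rmorphism E -> k} := @subfx_inj F k i z p.
have iotaE q : iota (subfx_eval i z p q) = (map_poly i q).[z] by exact: subfx_inj_eval.
have iotaj a : iota (j a) = i a by rewrite iotaE map_polyC hornerC.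
pose y : E := subfx_root i z p.
have iy : iota y = z by rewrite iotaE map_polyX hornerX.
exists E, j, iota; split=> //; last by exists y.
have s0 : (0 < size s)%N.
  rewrite lt0n; apply/eqP => h; have [c] := hs 1; rewrite big1; last first.
    by case=> m ml _; exfalso; move: ml; rewrite h.
  by move/eqP; rewrite oner_eq0.
have sp : (0 < size p)%N by rewrite size_poly_gt0.
apply: (@finite_extension_span _ _ _ ('I_(size p) * 'I_(size s))%type (Ordinal sp, Ordinal s0)
  (fun l => y ^+ l.1 * j s`_l.2)) => x.
have [q xq] := subfxE x.
pose r := q %% p.
have xr : x = \sum_(l < size p) j r`_l * y ^+ l.
  apply: (fmorph_inj iota); rewrite rmorph_sum xq iotaE [in LHS](divp_eq q p) rmorphD rmorphM.
  rewrite hornerD hornerM (rootP pz) mulr0 add0r (@horner_coef_wide _ (size p)); last first.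
    by rewrite size_map_poly ltnW // ltn_modp.
  by apply: eq_bigr => l _; rewrite rmorphM rmorphXn /= iy iotaj coef_map.
pose c l m := projT1 (cid (hs r`_l)) m.
have cP l : r`_l = \sum_m j0 (c l m) * s`_m := projT2 (cid (hs r`_l)).
exists (fun lm : 'I_(size p) * 'I_(size s) => c lm.1 lm.2).
rewrite xr -(pair_bigA _ (fun (l : 'I_(size p)) m => (j \o j0) (c l m) * (y ^+ l * j s`_m))) /=.
apply: eq_bigr => l _; rewrite {1}cP rmorph_sum mulr_suml; apply: eq_bigr => m _.
by rewrite rmorphM mulrAC mulrA.
Qed.

Lemma adjoin_finite (F0 k : fieldType) (i0 : {rmorphism F0 -> k}) (S : seq k) :
  (forall x, algebraicOver i0 x) ->
  exists (E : fieldType) (j : {rmorphism F0 -> E}) (iota : {rmorphism E -> k}),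
    [/\ forall a, iota (j a) = i0 a, finite_extension j & forall z, z \in S -> exists y, iota y = z].
Proof.
move=> alg; elim: S => [|z S [F [j [iota [h1 h2 h3]]]]].
  exists F0, idfun, i0; split=> //.
  by apply: (@finite_extension_span _ _ _ unit tt (fun=> 1)) => x; exists (fun=> x); rewrite big_const card_unit /= addr0 mulr1.
have zalg : algebraicOver iota z.
  have [p p0 pz] := alg z; exists (map_poly j p); first by rewrite map_poly_eq0.
  by rewrite -map_poly_comp (eq_map_poly (g := i0)) // => a; rewrite /= h1.
have [E [j' [iota' [g1 g2 [y gy]]]]] := adjoin_element h2 zalg.
exists E, (j' \o j), iota'; split=> //; first by move=> a; rewrite /= g1 h1.
move=> w; rewrite inE => /orP[/eqP ->|/h3 [u <-]]; first by exists y.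
by exists (j' u).
Qed.

(** * Recurrence of near-isometries *)

Section Recurrence.
Variables (R : realType) (k : fieldType) (w : k -> R).
Hypothesis wU : ultrametric_absval w.
Let wA := ultrametric_is_absval wU.
Variables (D : k -> Prop) (g : k -> k) (lam : k) (s : R).
Hypotheses (gD : forall y, D y -> D (g y)) (lam1 : w lam = 1) (s1 : s < 1).
Hypothesis glin : forall y z, D y -> D z -> w (g y - g z - lam * (y - z)) <= s * w (y - z).

Lemma iter_stable n y : D y -> D (iter n g y).
Proof. by elim: n => //= n IH /IH; exact: gD. Qed.

Lemma near_isometry y z : D y -> D z -> w (g y - g z) <= w (y - z).
Proof.
move=> Dy Dz; rewrite -(subrK (lam * (y - z)) (g y - g z)).
apply: (ultraD_le wU).
  by apply: le_trans (glin Dy Dz) _; rewrite ler_piMl ?(absval_ge0 wA) // ltW.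
by rewrite (absvalM wA) lam1 mul1r.
Qed.

Lemma iter_contract n y z : D y -> D z -> w (iter n g y - iter n g z) <= w (y - z).
Proof.
move=> Dy Dz; elim: n => //= n IH; apply: le_trans IH.
by apply: near_isometry; exact: iter_stable.
Qed.

Lemma iter_linear n y z : D y -> D z ->
  w (iter n g y - iter n g z - lam ^+ n * (y - z)) <= Num.max 0 s * w (y - z).
Proof.
move=> Dy Dz; have s0 : 0 <= Num.max 0 s by rewrite le_max lexx.
elim: n => [|n IH]; first by rewrite expr0 mul1r subrr (absval0 wA) mulr_ge0 ?(absval_ge0 wA).
rewrite !iterS; set Y := iter n g y in IH *; set Z := iter n g z in IH *.
have -> : g Y - g Z - lam ^+ n.+1 * (y - z) =
  (g Y - g Z - lam * (Y - Z)) + lam * (Y - Z - lam ^+ n * (y - z)) by rewrite exprS; ring.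
apply: (ultraD_le wU); last by rewrite (absvalM wA) lam1 mul1r.
apply: le_trans (glin (iter_stable n Dy) (iter_stable n Dz)) _.
apply: (@le_trans _ _ (Num.max 0 s * w (Y - Z))).
  by rewrite ler_wpM2r ?(absval_ge0 wA) // le_max lexx orbT.
by rewrite ler_wpM2l // iter_contract.
Qed.
End Recurrence.

Section NearIdentity.
Variables (R : realType) (k : fieldType) (w : k -> R) (p : nat) (p_pr : prime p).
Hypothesis (wU : ultrametric_absval w) (wp : w p%:R = p%:R^-1).
Let wA := ultrametric_is_absval wU.
Variables (D : k -> Prop) (rho : R).
Hypotheses (rho0 : 0 <= rho) (rho1 : rho < 1) (prho : p%:R^-1 <= rho).

Definition near_identity (G : k -> k) (c : R) :=
  [/\ forall y, D y -> D (G y), forall y, D y -> w (G y - y) <= c &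
      forall y z, D y -> D z -> w ((G y - y) - (G z - z)) <= rho * w (y - z)].

Lemma near_identity_iter G c n : 0 <= c -> near_identity G c -> near_identity (iter n G) c.
Proof.
move=> c0 [GD Gc Gl]; have stab m y : D y -> D (iter m G y) by elim: m => //= m IH /IH; exact: GD.
elim: n => [|n [IHD IHc IHl]].
  split=> // [y _|y z _ _]; first by rewrite subrr (absval0 wA).
  by rewrite !subrr (absval0 wA) mulr_ge0 ?(absval_ge0 wA).
have contr y z : D y -> D z -> w (iter n G y - iter n G z) <= w (y - z).
  move=> Dy Dz; have -> : iter n G y - iter n G z = ((iter n G y - y) - (iter n G z - z)) + (y - z) by ring.
  apply: (ultraD_le wU) => //; apply: le_trans (IHl _ _ Dy Dz) _.
  by rewrite ler_piMl ?(absval_ge0 wA) // ltW.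
split=> [y Dy|y Dy|y z Dy Dz]; rewrite !iterS; first by apply: GD; exact: stab.
  have -> : G (iter n G y) - y = (G (iter n G y) - iter n G y) + (iter n G y - y) by ring.
  by apply: (ultraD_le wU); [apply: Gc; exact: stab | exact: IHc].
set Y := iter n G y in contr IHl *; set Z := iter n G z in contr IHl *.
have -> : G Y - y - (G Z - z) = ((G Y - Y) - (G Z - Z)) + ((Y - y) - (Z - z)) by ring.
apply: (ultraD_le wU); last exact: IHl.
apply: le_trans (Gl _ _ (stab n _ Dy) (stab n _ Dz)) _.
by rewrite ler_wpM2l //; exact: contr.
Qed.

(* Telescoping, the displacement of [G^p] is [p] times that of [G] up to [rho c]. *)
Lemma near_identity_pow G c : 0 <= c -> near_identity G c -> near_identity (iter p G) (rho * c).
Proof.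
move=> c0 Gni; have [GpD _ Gpl] := near_identity_iter p c0 Gni; split=> // y Dy.
have [GD Gc Gl] := Gni.
have -> : iter p G y - y = (G y - y) *+ p + \sum_(i < p) ((G (iter i G y) - iter i G y) - (G y - y)).
  rewrite sumrB sumr_const card_ord addrCA subrr addr0.
  elim: (p) => [|n IH]; first by rewrite big_ord0 subrr.
  by rewrite big_ord_recr /= -IH; ring.
apply: (ultraD_le wU).
  rewrite -mulr_natl (absvalM wA) wp; apply: ler_pM; rewrite ?(absval_ge0 wA) ?invr_ge0 ?ler0n //.
  exact: Gc.
apply: (ultra_sum_le wU) => [|i _]; first exact: mulr_ge0.
have [iD ic _] := near_identity_iter i c0 Gni.
apply: le_trans (Gl _ _ (iD _ Dy) Dy) _; rewrite ler_wpM2l //; exact: ic.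
Qed.

Lemma near_identity_ppow G m : near_identity G 1 -> near_identity (iter (p ^ m) G) (rho ^+ m).
Proof.
move=> Gni; elim: m => [|m IH]; first by rewrite expn0 expr0.
have E : iter (p ^ m.+1) G =1 iter p (iter (p ^ m) G).
  by move=> y; rewrite expnS iterM.
have [h1 h2 h3] := near_identity_pow (exprn_ge0 m rho0) IH.
split=> [y|y|y z]; rewrite ?E ?exprS; [exact: h1|exact: h2|exact: h3].
Qed.
End NearIdentity.

Lemma unity_mult (R : realType) (k : fieldType) (w : k -> R) (a : k) n m :
  ultrametric_absval w -> w a = 1 -> w (a ^+ n - 1) < 1 -> w (a ^+ (n * m) - 1) < 1.
Proof.
move=> wU a1 h; have wA := ultrametric_is_absval wU.
elim: m => [|m IH]; first by rewrite muln0 expr0 subrr (absval0 wA).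
rewrite mulnS exprD (_ : _ - 1 = a ^+ n * (a ^+ (n * m) - 1) + (a ^+ n - 1)); last by ring.
by apply: (ultraD_lt wU) => //; rewrite (absvalM wA) (absvalX wA) a1 expr1n mul1r.
Qed.

Lemma recurrence (R : realType) (k : fieldType) (w : k -> R) (p : nat)
    (D : k -> Prop) (g : k -> k) (lam : k) (s : R) (r : nat) (x : k) :
  ultrametric_absval w -> prime p -> w p%:R = p%:R^-1 ->
  (forall y, D y -> D (g y)) -> w lam = 1 -> w (lam ^+ r - 1) < 1 -> s < 1 ->
  (forall y z, D y -> D z -> w (y - z) <= 1) ->
  (forall y z, D y -> D z -> w (g y - g z - lam * (y - z)) <= s * w (y - z)) ->
  D x -> forall e, 0 < e -> exists M, forall m n, (M <= m)%N ->
    w (iter (n + r * p ^ m) g x - iter n g x) < e.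
Proof.
move=> wU p_pr wp gD lam1 lamr s1 D1 glin Dx e e0; have wA := ultrametric_is_absval wU.
pose rho := Num.max (Num.max 0 s) (Num.max (w (lam ^+ r - 1)) p%:R^-1).
have p1 : p%:R^-1 < 1 :> R by rewrite invf_lt1 ?ltr1n ?ltr0n ?prime_gt0 ?prime_gt1.
have rho0 : 0 <= rho by rewrite !le_max lexx.
have rho1 : rho < 1 by rewrite !gt_max ltr01 s1 lamr p1.
have prho : p%:R^-1 <= rho by rewrite !le_max lexx !orbT.
have ni : near_identity w D rho (iter r g) 1.
  split=> [y Dy|y Dy|y z Dy Dz]; first exact: iter_stable.
    by apply: D1 => //; exact: iter_stable.
  have -> : iter r g y - y - (iter r g z - z) =
    (iter r g y - iter r g z - lam ^+ r * (y - z)) + (lam ^+ r - 1) * (y - z) by ring.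
  apply: (ultraD_le wU).
    apply: le_trans (iter_linear wU gD lam1 s1 glin r Dy Dz) _.
    by rewrite ler_wpM2r ?(absval_ge0 wA) // le_max lexx.
  by rewrite (absvalM wA) ler_wpM2r ?(absval_ge0 wA) // !le_max lexx !orbT.
have [M hM] := geometric_small rho0 rho1 e0.
exists M => m n Mm; rewrite iterD.
have [h1 h2 _] := near_identity_ppow wU wp rho0 rho1 prho m ni.
apply: le_lt_trans (iter_contract wU gD lam1 s1 glin n _ Dx) _; first exact: iter_stable.
rewrite mulnC iterM; apply: le_lt_trans (h2 _ Dx) _; apply: le_lt_trans hM.
by apply: ler_wiXn2l => //; exact: ltW.
Qed.

Section PolynomialLocal.
Variables (R : realType) (k : fieldType) (w : k -> R).
Hypothesis wU : ultrametric_absval w.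
Let wA := ultrametric_is_absval wU.

Lemma ultraX_near (y z q : k) (s : R) i : 0 <= s -> s <= 1 -> w y <= 1 -> w z <= 1 -> w q <= 1 ->
  w (y - q) <= s -> w (z - q) <= s ->
  w (y ^+ i - z ^+ i - (q ^+ i.-1 *+ i) * (y - z)) <= s * w (y - z).
Proof.
move=> s0 s1 y1 z1 q1 hy hz; have d0 := absval_ge0 wA (y - z).
have qX n : w (q ^+ n) <= 1 by exact: absvalX_le1.
elim: i => [|i IH]; first by rewrite !expr0 mulr0n mul0r subrr subr0 (absval0 wA) mulr_ge0.
have -> : y ^+ i.+1 - z ^+ i.+1 - (q ^+ i.+1.-1 *+ i.+1) * (y - z) =
  y * (y ^+ i - z ^+ i - (q ^+ i.-1 *+ i) * (y - z)) +
  ((y - q) * (q ^+ i.-1 *+ i) + (z ^+ i - q ^+ i)) * (y - z).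
  have e : q * (q ^+ i.-1 *+ i) = q ^+ i *+ i.
    by case: (i) => [|n]; rewrite ?mulr0n ?mulr0 // mulrnAr -exprS.
  rewrite !exprS /= mulrSr mulrDl [(y - q) * _]mulrBl e.
  by move: (q ^+ i *+ i) (q ^+ i.-1 *+ i) (q ^+ i) (y ^+ i) (z ^+ i) => a b c d f; ring.
apply: (ultraD_le wU); rewrite (absvalM wA).
  by apply: le_trans IH; rewrite ler_piMl ?(absval_ge0 wA).
rewrite ler_wpM2r //; apply: (ultraD_le wU); last exact: ultraX_lip.
rewrite (absvalM wA) -[leRHS]mulr1; apply: ler_pM; rewrite ?(absval_ge0 wA) //.
by rewrite -mulr_natl (absvalM wA) mulr_ile1 ?(absval_ge0 wA) // ultra_nat_le1.
Qed.

Variable f : {poly k}.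
Hypothesis f1 : forall i, w f`_i <= 1.

Lemma poly_near (y z q : k) (s : R) : 0 <= s -> s <= 1 -> w y <= 1 -> w z <= 1 -> w q <= 1 ->
  w (y - q) <= s -> w (z - q) <= s ->
  w (f.[y] - f.[z] - f^`().[q] * (y - z)) <= s * w (y - z).
Proof.
move=> s0 s1 y1 z1 q1 hy hz.
have fd : f^`().[q] = \sum_(i < size f) f`_i * (q ^+ i.-1 *+ i).
  rewrite -{1}[f]coefK poly_def raddf_sum /= horner_sum; apply: eq_bigr => i _.
  by rewrite derivZ derivXn hornerZ hornerMn hornerXn.
rewrite fd !horner_coef mulr_suml -!sumrB; apply: (ultra_sum_le wU) => [|i _].
  by rewrite mulr_ge0 ?(absval_ge0 wA).
rewrite -mulrBr -mulrA -mulrBr (absvalM wA).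
apply: le_trans (_ : 1 * (s * w (y - z)) <= _); last by rewrite mul1r.
by apply: ler_pM; rewrite ?(absval_ge0 wA) //; exact: ultraX_near.
Qed.

Lemma poly_int (y : k) : w y <= 1 -> w f.[y] <= 1.
Proof.
move=> y1; rewrite horner_coef; apply: (ultra_sum_le wU) => // i _.
by rewrite (absvalM wA) mulr_ile1 ?(absval_ge0 wA) //; exact: absvalX_le1.
Qed.

Lemma poly_escape (y : k) : w (lead_coef f) = 1 -> 1 < w y -> f != 0 ->
  w f.[y] = w y ^+ (size f).-1.
Proof.
move=> l1 y1 f0; have y0 : 0 < w y by apply: lt_trans y1.
have sf : size f = (size f).-1.+1 by rewrite prednK // size_poly_gt0.
have e : w (lead_coef f * y ^+ (size f).-1) = w y ^+ (size f).-1.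
  by rewrite (absvalM wA) l1 mul1r (absvalX wA).
rewrite -e; apply: (ultra_eq wU).
have sl : (size f <= (size f).-1.+1)%N by rewrite -sf.
rewrite (horner_coef_wide y sl) big_ord_recr /= -lead_coefE addrK e.
case E: (size f).-1 => [|n]; first by rewrite big_ord0 (absval0 wA) expr0 ltr01.
apply: le_lt_trans (_ : w y ^+ n < _); last by rewrite exprS ltr_pMl ?exprn_gt0.
apply: (ultra_sum_le wU) => [|i _]; first by rewrite exprn_ge0 // ltW.
rewrite (absvalM wA) (absvalX wA); apply: le_trans (_ : 1 * w y ^+ i <= _).
  by rewrite ler_wpM2r // exprn_ge0 // ltW.
by rewrite mul1r; apply: ler_weXn2l; [exact: ltW | rewrite -ltnS].
Qed.

Lemma iter_escape (y : k) n : w (lead_coef f) = 1 -> 1 < w y -> (2 < size f)%N ->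
  w y ^+ n.+1 <= w (iter n (horner f) y).
Proof.
move=> l1 y1 sf; have f0 : f != 0 by rewrite -size_poly_gt0 (ltn_trans _ sf).
have y0 : 0 < w y by apply: lt_trans y1.
elim: n => [|n IH]; first by rewrite expr1.
have big : 1 < w (iter n (horner f) y).
  by apply: lt_le_trans IH; apply: exprn_egt1.
rewrite iterS poly_escape //; apply: le_trans (_ : w (iter n (horner f) y) ^+ 2 <= _); last first.
  by apply: ler_weXn2l; [exact: ltW | rewrite -ltnS prednK // (ltn_trans _ sf)].
rewrite exprSr expr2; apply: ler_pM => //; [by rewrite exprn_ge0 // ltW | exact: ltW |].
by apply: le_trans IH; rewrite exprS ler_peMr ?exprn_ege1 // ltW.
Qed.

Lemma escape_to_infinity (y : k) B : w (lead_coef f) = 1 -> 1 < w y -> (2 < size f)%N ->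
  exists M, forall n, (M <= n)%N -> B < w (iter n (horner f) y).
Proof.
move=> l1 y1 sf; have y0 : 0 < w y by apply: lt_trans y1.
have B0 : 0 < (Num.max 1 B)^-1 by rewrite invr_gt0 lt_max ltr01.
have [||M hM] := @geometric_small R (w y)^-1 _ _ _ B0; first by rewrite invr_ge0 ltW.
  by rewrite invf_lt1.
exists M => n Mn; apply: lt_le_trans (iter_escape n l1 y1 sf).
apply: le_lt_trans (_ : Num.max 1 B < _); first by rewrite le_max lexx orbT.
move: hM; rewrite exprVn ltf_pV2 ?posrE ?exprn_gt0 // ?lt_max ?ltr01 // => h.
by apply: lt_le_trans h _; apply: ler_weXn2l; [exact: ltW | exact: leqW].
Qed.

Lemma coordinate_recurrence (p r : nat) (q x : k) : prime p -> w p%:R = p%:R^-1 ->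
  w q <= 1 -> w f^`().[q] = 1 -> w (f^`().[q] ^+ r - 1) < 1 ->
  size f = 2%N \/ f.[q] = q -> w (x - q) < 1 ->
  (forall n, w (iter n (horner f) x) <= 1) /\
  forall e, 0 < e -> exists M, forall m n, (M <= m)%N ->
    w (iter (n + r * p ^ m) (horner f) x - iter n (horner f) x) < e.
Proof.
move=> p_pr wp q1 l1 lr fq xq.
have x1 : w x <= 1.
  by rewrite -[x](subrK q); apply: (ultraD_le wU) => //; exact: ltW.
split; first by elim=> //= n IH; exact: poly_int.
move=> e e0; case: fq => [sf|fq].
  apply: (@recurrence R k w p (fun y => w y <= 1) (horner f) f^`().[q] 0 r x) => //.
  - by move=> y; exact: poly_int.
  - by move=> y z hy hz; exact: (ultraB_le wU).
  - move=> y z _ _; rewrite mul0r (_ : _ - _ = 0) ?(absval0 wA) //.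
    have -> : f = f`_1 *: 'X + (f`_0)%:P.
      apply/polyP => -[|[|i]]; rewrite coefD coefZ coefX coefC /= ?mulr0 ?mulr1 ?add0r ?addr0 //.
      by rewrite nth_default // sf.
    by rewrite derivD derivZ derivX derivC addr0 !hornerE; ring.
pose s := w (x - q).
have D1 y : w (y - q) <= s -> w y <= 1.
  move=> h; rewrite -[y](subrK q); apply: (ultraD_le wU) => //.
  by apply: le_trans h _; exact: ltW.
have s0 : 0 <= s by exact: (absval_ge0 wA).
have qs : w (q - q) <= s by rewrite subrr (absval0 wA).
apply: (@recurrence R k w p (fun y => w (y - q) <= s) (horner f) f^`().[q] s r x) => //.
- move=> y hy; rewrite -[in X in w X]fq -(subrK (f^`().[q] * (y - q)) (f.[y] - _)).
  apply: (ultraD_le wU); last by rewrite (absvalM wA) l1 mul1r.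
  apply: le_trans (poly_near s0 (ltW xq) (D1 _ hy) q1 q1 hy qs) _.
  by rewrite -[leRHS]mul1r; apply: ler_pM => //; [exact: (absval_ge0 wA) | exact: ltW].
- by move=> y z hy hz; apply: (ultraB_le wU); exact: D1.
- by move=> y z hy hz; apply: poly_near => //; [exact: ltW | exact: D1 | exact: D1].
Qed.
End PolynomialLocal.

Lemma nonsuperattracting_fixed_point (k : closedFieldType) (k0 : [pchar k] =i pred0) (f : {poly k}) :
  (2 < size f)%N -> exists q, f.[q] = q /\ f^`().[q] != 0.
Proof.
move=> sf; apply: contrapT => no.
have [s fs] := closed_field_poly_normal (f - 'X).
have sg : size (f - 'X) = size f by rewrite size_polyDl // size_polyN size_polyX.
have g0 : f - 'X != 0 by rewrite -size_poly_gt0 sg (ltn_trans _ sf).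
have rt z : z \in s -> f.[z] = z /\ f^`().[z] = 0.
  move=> zs; have fz : f.[z] = z.
    have : root (f - 'X) z by rewrite fs rootZ ?lead_coef_eq0 // root_prod_XsubC.
    by move/rootP; rewrite hornerD hornerN hornerX => /eqP; rewrite subr_eq0 => /eqP.
  split=> //; apply/eqP/negPn/negP => h; apply: no; by exists z.
have ss : size s = (size f).-1.
  by rewrite -sg fs size_scale ?lead_coef_eq0 // size_prod_XsubC.
have us : uniq s.
  rewrite -separable_prod_XsubC separable_poly.unlock; apply/Pdiv.ClosedField.coprimepP => z.
  rewrite root_prod_XsubC => /rt[_ fz]; apply/negP => /rootP pz.
  have := congr1 (fun g : {poly k} => g^`().[z]) fs.
  rewrite derivB derivX derivZ hornerD hornerN hornerZ pz mulr0 fz hornerC sub0r => /eqP.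
  by rewrite oppr_eq0 oner_eq0.
have fd0 : f^`() != 0.
  apply/eqP => /polyP /(_ (size f).-2); rewrite coef_deriv coef0 -mulr_natr => /eqP.
  have -> : (size f).-2.+1 = (size f).-1 by case: (size f) sf => [|[|n]].
  rewrite mulf_eq0 -lead_coefE lead_coef_eq0 -size_poly_eq0.
  by rewrite (natf_eq0 k0); case: (size f) sf => [|[|n]].
have : ((size f).-1 < size f^`())%N.
  by rewrite -ss; apply: max_poly_roots => //; apply/allP => z /rt [_ h]; apply/rootP.
have : (size f^`() < size f)%N by apply: lt_size_deriv; rewrite -size_poly_gt0 (ltn_trans _ sf).
by case: (size f) => // n; rewrite /= ltnS => h1 h2; have := leq_trans h2 h1; rewrite ltnn.
Qed.

(** * Vanishing along orbits *)

Section ExponentialPolynomials.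
Variables (k : fieldType) (k0 : [pchar k] =i pred0).

Lemma natf_inj : injective (fun n => n%:R : k).
Proof.
move=> m n /eqP; wlog le : m n / (m <= n)%N => [H|].
  by case: (leqP m n) => [/H//|/ltnW le]; rewrite eq_sym => /H ->.
rewrite eq_sym -subr_eq0 -natrB // (natf_eq0 k0) subn_eq0 => le'.
by apply/eqP; rewrite eqn_leq le.
Qed.

Lemma poly_nat_roots (p : {poly k}) : (forall n, p.[n%:R] = 0) -> p = 0.
Proof.
move=> h; apply: (@roots_geq_poly_eq0 _ p [seq n%:R | n <- iota 0 (size p)]).
- by apply/allP => _ /mapP[n _ ->]; apply/rootP.
- rewrite map_inj_uniq ?iota_uniq //; exact: natf_inj.
- by rewrite size_map size_iota.
Qed.

(* The operator [E - b] lowers the degree of the coefficient of [b ^+ n] and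
   preserves the degrees of the others. *)
Lemma exp_poly_indep (s : seq k) (p : k -> {poly k}) : uniq s -> 0 \notin s ->
  (forall n, \sum_(a <- s) (p a).[n%:R] * a ^+ n = 0) -> forall a, a \in s -> p a = 0.
Proof.
have [b] := ubnP (\sum_(a <- s) size (p a) + size s)%N.
elim: b s p => // b IH [|c s] p //= bnd /andP[cs us]; rewrite inE eq_sym negb_or => /andP[c0 s0] H.
move: bnd; rewrite big_cons => bnd.
have [pc0|pc] := eqVneq (p c) 0.
  have {}IH : forall a, a \in s -> p a = 0.
    apply: IH => // [|n]; last by have := H n; rewrite big_cons pc0 horner0 mul0r add0r.
    by rewrite pc0 size_poly0 add0n addnS ltnS in bnd.
  by move=> a; rewrite inE => /predU1P[->|/IH].
have X1 : size ('X + 1%:P : {poly k}) = 2%N by rewrite size_XaddC.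
pose q a := a *: (p a \Po ('X + 1)) - c *: p a.
have lcp a : lead_coef (p a \Po ('X + 1)) = lead_coef (p a).
  by rewrite lead_coef_comp ?X1 // lead_coefDl ?size_polyX ?size_poly1 // lead_coefX expr1n mulr1.
have szp a : size (p a \Po ('X + 1)) = size (p a) by rewrite size_comp_poly2 // X1.
have qle a : (size (q a) <= size (p a))%N.
  rewrite /q; apply: leq_trans (size_polyD _ _) _; rewrite size_polyN geq_max.
  by rewrite (leq_trans (size_scale_leq _ _)) ?szp // size_scale_leq.
have qtop a : (q a)`_(size (p a)).-1 = (a - c) * lead_coef (p a).
  by rewrite coefB !coefZ mulrBl -{1}lcp !lead_coefE szp.
have qc : (size (q c) < size (p c))%N.
  have sc : (0 < size (p c))%N by rewrite size_poly_gt0.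
  rewrite -(prednK sc) ltnS; apply/leq_sizeP => j; rewrite leq_eqVlt => /predU1P[<-|lt].
    by rewrite qtop subrr mul0r.
  by rewrite nth_default // (leq_trans (qle c)) // -(prednK sc).
have q0 a : a \in c :: s -> q a = 0.
  apply: IH; [|by rewrite /= cs|by rewrite inE eq_sym negb_or c0|move=> n].
    rewrite big_cons -ltnS; apply: leq_trans bnd; rewrite ltnS ltn_add2r -addSn.
    by apply: leq_add => //; apply: leq_sum.
  transitivity (\sum_(a <- c :: s) (p a).[n.+1%:R] * a ^+ n.+1 -
                c * \sum_(a <- c :: s) (p a).[n%:R] * a ^+ n); last by rewrite !H mulr0 subr0.
  rewrite mulr_sumr -sumrB; apply: eq_bigr => d _; rewrite /q.
  rewrite hornerD hornerN !hornerZ horner_comp hornerD hornerX hornerC exprS -natr1.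
  by move: (d ^+ n) (p d).[n%:R] (p d).[n%:R + 1] => x y z; ring.
have ps a : a \in s -> p a = 0.
  move=> sa; apply/eqP; rewrite -lead_coef_eq0; have := qtop a.
  rewrite q0 ?inE ?sa ?orbT // coef0 => /esym /eqP; rewrite mulf_eq0 subr_eq0 => /orP[/eqP ac|//].
  by rewrite -ac sa in cs.
move=> a; rewrite inE => /predU1P[->|]; last exact: ps.
apply: poly_nat_roots => n; have := H n; rewrite big_cons big_seq big1 => [|d /ps ->].
  by move/eqP; rewrite addr0 mulf_eq0 expf_eq0 (negPf c0) andbF orbF => /eqP.
by rewrite horner0 mul0r.
Qed.

Lemma exp_monomials_indep (I : eqType) (r : seq I) (c a : I -> k) (e : I -> nat) :
  uniq r -> (forall i, i \in r -> a i != 0) ->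
  {in r &, forall i j, a i = a j -> e i = e j -> i = j} ->
  (forall n, \sum_(i <- r) c i * (a i ^+ n * n%:R ^+ e i) = 0) ->
  forall i, i \in r -> c i = 0.
Proof.
move=> ur a0 inj H i ir.
pose p b : {poly k} := \sum_(j <- r | a j == b) c j *: 'X^(e j).
have : p (a i) = 0.
  apply: (@exp_poly_indep (undup (map a r)) p); rewrite ?undup_uniq ?mem_undup ?map_f //.
    by apply/negP => /mapP[j jr aj]; have := a0 j jr; rewrite -aj eqxx.
  move=> n; rewrite -[RHS](H n).
  transitivity (\sum_(b <- undup (map a r)) \sum_(j <- r | a j == b) c j * (a j ^+ n * n%:R ^+ e j)).
    apply: eq_bigr => b _; rewrite horner_sum mulr_suml; apply: eq_bigr => j /eqP <-.
    by rewrite hornerZ hornerXn -mulrA [a j ^+ n * _]mulrC.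
  rewrite (exchange_big_dep xpredT) //= [LHS]big_seq [RHS]big_seq; apply: eq_bigr => j jr.
  rewrite -big_filter; have -> : [seq b <- undup (map a r) | a j == b] = [:: a j].
    rewrite (eq_filter (a2 := pred1 (a j))) => [|b /=]; last by rewrite eq_sym.
    by apply: filter_pred1_uniq; rewrite ?undup_uniq // mem_undup map_f.
  by rewrite big_seq1.
move/polyP/(_ (e i)); rewrite coef0 coef_sum big_mkcond (bigD1_seq i) //= eqxx.
rewrite coefZ coefXn eqxx mulr1 big1_seq ?addr0 // => j /andP[ji jr].
case: eqP => // aj; rewrite coefZ coefXn; case: eqP => [ej|_]; last by rewrite mulr0.
by rewrite (inj _ _ jr ir aj (esym ej)) eqxx in ji.
Qed.
End ExponentialPolynomials.

Section Supported.
Variables (k : fieldType) (N : nat) (T : {set 'I_N}).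

Definition supported (P : {mpoly k[N]}) :=
  forall m, m \in msupp P -> forall i, i \notin T -> m i = 0%N.

Lemma supported0 : supported 0.
Proof. by move=> m; rewrite msupp0. Qed.

Lemma supportedD P Q : supported P -> supported Q -> supported (P + Q).
Proof. by move=> hP hQ m /msuppD_le; rewrite mem_cat => /orP[/hP|/hQ]. Qed.

Lemma supportedM P Q : supported P -> supported Q -> supported (P * Q).
Proof.
move=> hP hQ m /msuppM_le /allpairsP[[m1 m2] /= [h1 h2 ->]] i iT.
by rewrite mnmDE (hP _ h1) ?(hQ _ h2).
Qed.

Lemma supportedC c : supported c%:MP.
Proof. by move=> m; rewrite msuppC; case: eqP => // _; rewrite inE => /eqP -> i _; rewrite mnm0E. Qed.

Lemma supportedX i : i \in T -> supported 'X_i.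
Proof.
move=> iT m; rewrite msuppX inE => /eqP -> j jT; rewrite mnm1E; case: eqP => // ij.
by rewrite -ij iT in jT.
Qed.

Lemma supportedZ c P : supported P -> supported (c *: P).
Proof. by move=> hP m /msuppZ_le; exact: hP. Qed.

Lemma supported_sum (I : eqType) (r : seq I) (F : I -> {mpoly k[N]}) :
  (forall i, i \in r -> supported (F i)) -> supported (\sum_(i <- r) F i).
Proof.
move=> H; rewrite big_seq; elim/big_ind: _ => //; [exact: supported0 | exact: supportedD].
Qed.

Lemma supported_comp P (A : N.-tuple {mpoly k[N]}) :
  (forall i, supported (tnth A i)) -> supported (P \mPo A).
Proof.
move=> hA; rewrite comp_mpolyE; apply: supported_sum => m _; apply: supportedZ.
elim/big_ind: _ => [||i _]; [exact: supportedC|exact: supportedM|].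
by elim: (m i) => [|n IH]; rewrite ?expr0 ?exprS; [exact: supportedC|exact: supportedM].
Qed.

Lemma supported_eval P (y z : 'I_N -> k) : supported P ->
  (forall i, i \in T -> y i = z i) -> P.@[y] = P.@[z].
Proof.
move=> hP yz; rewrite !mevalE; apply: eq_big_seq => m /hP hm; congr (_ * _).
apply: eq_bigr => i _; case: (boolP (i \in T)) => [/yz -> //|/hm ->].
by rewrite !expr0.
Qed.
End Supported.

Section OrbitDensity.
Variables (k : fieldType) (R : realType) (N : nat) (L : {set 'I_N}) (orb : nat -> 'I_N -> k).

Definition recurrent (w : k -> R) (y : nat -> k) (h : nat -> nat) :=
  (forall n, w (y n) <= 1) /\
  forall e, 0 < e -> exists M, forall m n, (M <= m)%N -> w (y (n + h m)%N - y n) < e.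

Hypothesis escape : forall i, i \notin L -> exists (w : k -> R) (h : nat -> nat),
  [/\ ultrametric_absval w, forall m, (m <= h m)%N,
      forall B, exists M, forall n, (M <= n)%N -> B < w (orb n i) &
      forall j, j != i -> recurrent w (fun n => orb n j) h].
Hypothesis indep : forall P, supported L P -> (forall n, P.@[orb n] = 0) -> P = 0.

(* At the place where the coordinate [i] escapes and the others stay bounded,
   the leading coefficient [Q] of [P] in ['X_i] tends to 0 along the orbit;
   since the other coordinates are recurrent, [Q] vanishes on the orbit. *)
Lemma orbit_vanishing P : (forall n, P.@[orb n] = 0) -> P = 0.
Proof.
have : supported [set: 'I_N] P by move=> m _ i; rewrite inE.
have [b] := ubnP #|[set: 'I_N]|; move: [set: 'I_N] => T.
elim: b T P => // b IH T P bT sP PO.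
have [TL|/subsetPn[i iT iL]] := boolP (T \subset L).
  by apply: indep => // m mP i iL; apply: (sP m mP); apply: contra iL; exact: (subsetP TL).
apply/eqP/negPn/negP => P0.
have [w [h [wU hge esc rec]]] := escape iL; have wA := ultrametric_is_absval wU.
have [m0 m0P m0max] : exists2 m0, m0 \in msupp P & forall m, m \in msupp P -> (m i <= m0 i)%N.
  have : msupp P != [::] by rewrite msupp_eq0.
  elim: (msupp P) => // m s IHs _; have [->|/IHs [m1 m1s m1max]] := eqVneq s [::].
    by exists m; rewrite ?mem_head // => m'; rewrite inE => /eqP ->.
  have [le|lt] := leqP (m i) (m1 i).
    by exists m1; rewrite ?inE ?m1s ?orbT // => m'; rewrite inE => /predU1P[->|/m1max].
  exists m; rewrite ?mem_head // => m'; rewrite inE => /predU1P[->//|/m1max le].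
  exact: leq_trans le (ltnW lt).
pose d := m0 i.
pose drop (m : 'X_{1..N}) : 'X_{1..N} := [multinom if j == i then 0%N else m j | j < N].
pose Q := \sum_(m <- msupp P | m i == d) P@_m *: 'X_[drop m].
have sQ : supported (T :\ i) Q.
  rewrite /Q -big_filter; apply: supported_sum => m; rewrite mem_filter => /andP[_ mP].
  apply: supportedZ => m'; rewrite msuppX inE => /eqP -> j; rewrite mnmE in_setD1 negb_and negbK.
  by case: eqP => // _ /=; exact: sP.
have QE y : y i = 0 -> Q.@[y] = \sum_(m <- msupp P | m i == d) P@_m * \prod_(j | j != i) y j ^+ m j.
  move=> _; rewrite /Q raddf_sum; apply: eq_bigr => m _; rewrite /= mevalZ mevalX; congr (_ * _).
  rewrite (bigD1 i) //= mnmE eqxx expr0 mul1r; apply: eq_bigr => j ji.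
  by rewrite mnmE (negPf ji).
pose y n j := if j == i then 0 else orb n j.
have y1 n j : w (y n j) <= 1.
  rewrite /y; case: eqP => [_|/eqP ji]; first by rewrite (absval0 wA).
  by have [h1 _] := rec j ji; exact: h1.
have [M M0 MP] := @mcoeff_bound _ _ _ wU _ _ idfun P erefl.
have [MQ MQ0 MQP] := @mcoeff_bound _ _ _ wU _ _ idfun Q erefl.
have bigQ n : 1 < w (orb n i) -> w (Q.@[y n]) <= M / w (orb n i).
  set X := orb n i => X1; have X0 : 0 < w X by apply: lt_trans X1.
  have Xd : \sum_(m <- msupp P | m i != d) P@_m * (X ^+ m i * \prod_(j | j != i) y n j ^+ m j) =
            - (X ^+ d * Q.@[y n]).
    apply/eqP; rewrite -addr_eq0 QE; last by rewrite /y eqxx.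
    rewrite addrC mulr_sumr; apply/eqP; rewrite -[RHS](PO n) mevalE.
    rewrite [RHS](bigID (fun m : 'X_{1..N} => m i == d)) /=; congr (_ + _); apply: eq_bigr => m.
      move=> /eqP md; rewrite mulrCA; congr (_ * _); rewrite [RHS](bigD1 i) //= -/X md; congr (_ * _).
      by apply: eq_bigr => j /negPf ji; rewrite /y ji.
    move=> _; congr (_ * _); rewrite [RHS](bigD1 i) //= -/X; congr (_ * _).
    by apply: eq_bigr => j /negPf ji; rewrite /y ji.
  have : w (X ^+ d * Q.@[y n]) <= M * w X ^+ d / w X.
    rewrite -(absvalN wA) -Xd -big_filter big_seq; apply: (ultra_sum_le wU) => [|m].
      by rewrite mulr_ge0 ?invr_ge0 ?mulr_ge0 ?exprn_ge0 // ltW.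
    rewrite mem_filter => /andP[md mP]; rewrite (absvalM wA) -mulrA.
    apply: ler_pM; rewrite ?(absval_ge0 wA) //; first exact: MP.
    have lt : (m i < d)%N by rewrite ltn_neqAle md m0max.
    rewrite (absvalM wA) (absvalX wA); apply: (@le_trans _ _ (w X ^+ m i)).
      rewrite ler_piMr ?exprn_ge0 ?(ltW X0) //.
      elim/big_rec: _ => [|j z _ z1]; first by rewrite (absval1 wA).
      by rewrite (absvalM wA) mulr_ile1 ?(absval_ge0 wA) //; exact: absvalX_le1.
    rewrite ler_pdivlMr // -exprSr; apply: ler_weXn2l => //; exact: ltW.
  rewrite (absvalM wA) (absvalX wA) mulrAC [_ * w X ^+ d]mulrC ler_pM2l ?exprn_gt0 //.
have Qorb n : Q.@[orb n] = Q.@[y n].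
  by apply: supported_eval sQ _ => j; rewrite in_setD1 /y => /andP[/negPf ->].
have Q0 : Q = 0.
  apply: IH sQ _.
    by move: bT; rewrite (cardsD1 i) iT add1n ltnS.
  move=> n; rewrite Qorb; apply/eqP; rewrite -(absval_eq0 wA) eq_le (absval_ge0 wA) andbT leNgt.
  apply/negP; set e := w _ => e0.
  have rec' j : exists Mj, j != i -> forall m, (Mj <= m)%N -> w (orb (n + h m)%N j - orb n j) < e / MQ.
    have [->|ji] := eqVneq j i; first by exists 0%N.
    have [_ /(_ (e / MQ))[|Mj hMj]] := rec j ji; first by rewrite divr_gt0.
    by exists Mj => _ m; exact: hMj.
  have [Mr hMr] := choice rec'.
  have [Me hMe] := esc (Num.max 1 (M / e)).
  pose m := (Me + \max_j Mr j)%N.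
  have big : 1 < w (orb (n + h m)%N i) /\ M / e < w (orb (n + h m)%N i).
    have /hMe : (Me <= n + h m)%N.
      by apply: leq_trans (leq_addl _ _); apply: leq_trans (hge m); exact: leq_addr.
    by rewrite gt_max => /andP[].
  have : e < e; last by rewrite ltxx.
  rewrite {1}/e -(subrK (Q.@[y (n + h m)%N]) Q.@[y n]); apply: (ultraD_lt wU).
    have [e' e'0 [e'e He']] : exists2 e', 0 <= e' & e' < e / MQ /\ forall j, w (y n j - y (n + h m)%N j) <= e'.
      exists (\big[Num.max/0]_j w (y n j - y (n + h m)%N j)).
        by elim/big_rec: _ => // j z _ z0; rewrite le_max z0 orbT.
      split=> [|j]; last by rewrite (bigD1 j) //= le_max lexx.
      elim/big_rec: _ => [|j z _ z0]; first by rewrite divr_gt0.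
      rewrite gt_max z0 andbT /y; case: eqP => [_|/eqP ji].
        by rewrite subrr (absval0 wA) divr_gt0.
      rewrite -(absvalN wA) opprB; apply: hMr => //.
      by apply: leq_trans (leq_addl _ _); exact: leq_bigmax.
    apply: le_lt_trans (mmap_lip wU e'0 (ltW MQ0) MQP (y1 n) (y1 _) He') _.
    by rewrite mulrC -ltr_pdivlMr.
  case: big => big1 big2; apply: le_lt_trans (bigQ _ big1) _.
  have w0 : 0 < w (orb (n + h m)%N i) by apply: lt_trans big1.
  by rewrite ltr_pdivrMr // mulrC -ltr_pdivrMr.
have : Q@_(drop m0) = P@_m0.
  rewrite /Q raddf_sum /= big_mkcond (bigD1_seq m0) ?msupp_uniq //= eqxx.
  rewrite mcoeffZ mcoeffX eqxx mulr1 big1_seq ?addr0 // => m /andP[mm0 mP].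
  case: eqP => // md; rewrite mcoeffZ mcoeffX; case: eqP => [E|_]; last by rewrite mulr0.
  case/eqP: mm0; apply/mnmP => j; have := congr1 (fun u : 'X_{1..N} => u j) E.
  by rewrite !mnmE; case: eqP => // ->.
by rewrite Q0 mcoeff0 => /esym /eqP; apply/negP; rewrite -mcoeff_msupp.
Qed.
End OrbitDensity.

(* Distinct monomials in the linear coordinates restrict to distinct monomials
   [a ^ n * n ^ e] along an orbit of an affine map. *)
Definition multiplicatively_free (k : fieldType) (N : nat) (L : {set 'I_N}) (a : 'I_N -> k) :=
  forall m m' : 'X_{1..N},
    (forall i, i \notin L -> m i = 0%N /\ m' i = 0%N) ->
    \prod_(i in L) a i ^+ m i = \prod_(i in L) a i ^+ m' i ->
    (\sum_(i in L | a i == 1%R) m i = \sum_(i in L | a i == 1%R) m' i)%N ->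
    m = m'.

Section LinearCoordinates.
Variables (k : fieldType) (k0 : [pchar k] =i pred0) (N : nat) (L : {set 'I_N}).
Variables (a c d : 'I_N -> k) (orb : nat -> 'I_N -> k).
Hypotheses (a0 : forall i, i \in L -> a i != 0) (d0 : forall i, i \in L -> d i != 0).
Hypothesis orbE : forall n i, i \in L ->
  orb n i = c i + d i * (if a i == 1 then n%:R else a i ^+ n).
Hypothesis free : multiplicatively_free L a.

Lemma linear_orbit_vanishing P : supported L P -> (forall n, P.@[orb n] = 0) -> P = 0.
Proof.
move=> sP PO.
pose A := [tuple if i \in L then (c i)%:MP + d i *: 'X_i else 0 : {mpoly k[N]} | i < N].
have AE i z : (tnth A i).@[z] = if i \in L then c i + d i * z i else 0.
  rewrite tnth_mktuple; case: ifP => _; last by rewrite meval0.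
  by rewrite mevalD mevalC mevalZ mevalXU.
pose Q := P \mPo A.
have QE z : Q.@[z] = P.@[fun i => c i + d i * z i].
  rewrite comp_mpoly_meval; apply: supported_eval sP _ => i iL; by rewrite AE iL.
have sQ : supported L Q.
  apply: supported_comp => i; rewrite tnth_mktuple; case: ifP => iL; last exact: supported0.
  by apply: supportedD; [exact: supportedC | apply: supportedZ; exact: supportedX].
pose y n i : k := if a i == 1 then n%:R else a i ^+ n.
have Qy n : Q.@[y n] = 0.
  rewrite QE -[RHS](PO n); apply: supported_eval sP _ => i iL; by rewrite orbE.
have yE n m : m \in msupp Q -> \prod_i y n i ^+ m i =
    (\prod_(i in L) a i ^+ m i) ^+ n * n%:R ^+ (\sum_(i in L | a i == 1%R) m i)%N.
  move=> mQ; rewrite (bigID (fun i => i \in L)) /= [X in _ * X]big1 ?mulr1 => [|i iL]; last first.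
    by rewrite (sQ m mQ i iL) expr0.
  rewrite -prodrXl -prodrXr big_mkcondr /= -big_split /=; apply: eq_bigr => i iL.
  rewrite /y; case: eqP => [->|_]; first by rewrite !expr1n mul1r.
  by rewrite mulr1 -!exprM mulnC.
have Q0 : Q = 0.
  apply/eqP; rewrite -msupp_eq0; case E: (msupp Q) => [//|m s].
  have mQ : m \in msupp Q by rewrite E mem_head.
  have : Q@_m = 0.
    apply: (@exp_monomials_indep k k0 _ (msupp Q) (fun m => Q@_m)
      (fun m : 'X_{1..N} => \prod_(i in L) a i ^+ m i)
      (fun m : 'X_{1..N} => (\sum_(i in L | a i == 1%R) m i)%N)) => //.
    - by move=> m' _; apply/prodf_neq0 => i iL; rewrite expf_neq0 // a0.
    - by move=> m1 m2 h1 h2; apply: free => i iL; rewrite (sQ _ h1) ?(sQ _ h2).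
    - by move=> n; rewrite -[RHS](Qy n) mevalE; apply: eq_big_seq => m' /(yE n) ->.
  by move/eqP; rewrite mcoeff_eq0 mQ.
apply/eqP/negPn/negP => P0.
have ni (i : 'I_N) : injective (fun n => n%:R : k) := natf_inj k0.
have [z /eqP] := mpoly_nonvanishing ni P0; apply.
have := QE (fun i => ((z i)%:R - c i) / d i); rewrite Q0 meval0 => /esym; apply: etrans.
by apply: supported_eval sP _ => i iL; rewrite [d i * _]mulrC divfK ?d0 // addrC subrK.
Qed.
End LinearCoordinates.

Lemma affine_orbit (k : fieldType) (f : {poly k}) (x : k) n : size f = 2%N ->
  iter n (horner f) x =
    if f`_1 == 1 then x + f`_0 * n%:R
    else f`_0 / (1 - f`_1) + (x - f`_0 / (1 - f`_1)) * f`_1 ^+ n.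
Proof.
move=> sf; have fE y : f.[y] = f`_0 + f`_1 * y.
  by rewrite horner_coef sf big_ord_recl big_ord1 /= expr0 mulr1 expr1.
elim: n => [|n IH]; first by rewrite mulr0 expr0 mulr1 addr0 addrC subrK if_same.
rewrite iterS fE IH; case: eqP => [->|/eqP f1]; first by rewrite mul1r -natr1; ring.
rewrite exprS; have : 1 - f`_1 != 0 by rewrite subr_eq0 eq_sym.
by move: f`_0 f`_1 (f`_1 ^+ n) => b a e ab; field.
Qed.

Section SplitOrbits.
Variables (k : fieldType) (N : nat) (f : 'I_N -> {poly k}).

Lemma split_endo_eval i (z : 'I_N -> k) : (tnth (split_endo f) i).@[z] = (f i).[z i].
Proof.
rewrite tnth_mktuple horner_poly raddf_sum horner_coef; apply: eq_bigr => j _ /=.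
by rewrite mevalM mevalC rmorphXn /= mevalXU.
Qed.

Lemma split_endo_iter n (x : 'rV[k]_N) i :
  iter n (endo_map (split_endo f)) x 0 i = iter n (horner (f i)) (x 0 i).
Proof. by elim: n => //= n <-; rewrite mxE split_endo_eval. Qed.

Lemma orbit_dense (x : 'rV[k]_N) :
  (forall P, (forall n, P.@[fun i => iter n (horner (f i)) (x 0 i)] = 0) -> P = 0) ->
  zariski_dense (orbit_of (split_endo f) x).
Proof.
move=> H Z [E ZE] OZ z; apply/ZE => P EP; rewrite (H P) ?meval0 // => n.
have /ZE /(_ P EP) := OZ _ (ex_intro _ n erefl); apply: etrans; apply: meval_eq => i.
by rewrite split_endo_iter.
Qed.
End SplitOrbits.

(** * The adelic open set *)

Definition adapted_place (R : realType) (k : fieldType) (S : seq k) (p : nat) (w : k -> R) :=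
  [/\ prime p, ultrametric_absval w, w p%:R = p%:R^-1 &
      forall s, s \in S -> w s = 1 /\ exists2 r, (0 < r)%N & w (s ^+ r - 1) < 1].

Section AdaptedOrbits.
Variables (R : realType) (k : fieldType) (k0 : [pchar k] =i pred0) (N : nat).
Variables (f : 'I_N -> {poly k}) (q : 'I_N -> k).
Hypothesis sz : forall i, (1 < size (f i))%N.
Hypothesis q_multiplier : forall i, (f i)^`().[q i] != 0.
Hypothesis q_fixed : forall i, (f i).[q i] = q i \/ size (f i) = 2%N /\ (f i)`_1 = 1.

Definition place_conditions : seq k :=
  [seq z <- flatten [seq q i :: (f i)^`().[q i] :: polyseq (f i) | i <- enum 'I_N] | z != 0].

Lemma mem_place_conditions i z : z \in q i :: (f i)^`().[q i] :: polyseq (f i) -> z != 0 ->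
  z \in place_conditions.
Proof.
move=> zi z0; rewrite mem_filter z0 /=; apply/flattenP.
by exists (q i :: (f i)^`().[q i] :: polyseq (f i)); rewrite // map_f // mem_enum.
Qed.

Lemma place_conditions_neq0 : 0 \notin place_conditions.
Proof. by rewrite mem_filter eqxx. Qed.

Let linear : {set 'I_N} := [set i | size (f i) == 2%N].

Lemma adapted_orbit_vanishing (x : 'I_N -> k) :
  (forall i, exists p (w : k -> R), adapted_place place_conditions p w /\
     1 < w (x i - q i) /\ forall j, j != i -> w (x j - q j) < 1) ->
  multiplicatively_free linear (fun i => (f i)`_1) ->
  (forall i, i \in linear -> (f i)`_1 = 1 -> (f i)`_0 != 0) ->
  forall P, (forall n, P.@[fun i => iter n (horner (f i)) (x i)] = 0) -> P = 0.
Proof.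
move=> places free transl.
have bounded p (w : k -> R) i z : adapted_place place_conditions p w ->
    z \in q i :: (f i)^`().[q i] :: polyseq (f i) -> w z <= 1.
  move=> [_ wU _ wS] zi; have [->|z0] := eqVneq z 0.
    by rewrite (absval0 (ultrametric_is_absval wU)) ler01.
  by have [-> _] := wS z (mem_place_conditions zi z0).
have coefs p (w : k -> R) i j : adapted_place place_conditions p w -> w (f i)`_j <= 1.
  move=> wS; have [lt|le] := ltnP j (size (f i)).
    by apply: (bounded p w i) => //; rewrite !inE mem_nth ?orbT.
  by rewrite nth_default // (absval0 (ultrametric_is_absval _)) ?ler01 //; case: wS.
have qint p (w : k -> R) i : adapted_place place_conditions p w -> w (q i) <= 1.
  by move=> wS; apply: (bounded p w i) => //; rewrite mem_head.
have lead1 p (w : k -> R) i : adapted_place place_conditions p w -> w (lead_coef (f i)) = 1.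
  have l0 : lead_coef (f i) != 0 by rewrite lead_coef_eq0 -size_poly_gt0 ltnW.
  move=> [_ _ _ /(_ (lead_coef (f i)))[]] //.
  by apply: (@mem_place_conditions i _ _ l0); rewrite !inE lead_coefE mem_nth ?orbT // prednK // ltnW.
have mult1 p (w : k -> R) i : adapted_place place_conditions p w -> w (f i)^`().[q i] = 1 /\
    exists2 r, (0 < r)%N & w ((f i)^`().[q i] ^+ r - 1) < 1.
  by move=> [_ _ _]; apply; apply: (@mem_place_conditions i _ _ (q_multiplier i)); rewrite !inE eqxx orbT.
apply: (@orbit_vanishing _ R _ linear).
  move=> i iL; have [p [w [wS [xi xj]]]] := places i.
  have [p_pr wU wp _] := wS; have wA := ultrametric_is_absval wU.
  have /choice[r rP] : forall j, exists r, (0 < r)%N /\ w ((f j)^`().[q j] ^+ r - 1) < 1.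
    by move=> j; have [_ [r r0 hr]] := mult1 p w j wS; exists r.
  pose R0 := (\prod_j r j)%N.
  have R00 : (0 < R0)%N by apply: prodn_gt0 => j; case: (rP j).
  exists w, (fun m => (R0 * p ^ m)%N); split=> // [m|B|j ji].
  - by apply: leq_trans (leq_pmull _ R00); apply: ltnW; rewrite ltn_expl ?prime_gt1.
  - apply: escape_to_infinity => //; [by move=> j; exact: coefs wS|exact: lead1 wS| |].
      rewrite ltNge; apply/negP => xi1; move: xi; rewrite ltNge => /negP; apply.
      by apply: (ultraB_le wU) => //; exact: qint wS.
    rewrite ltn_neqAle sz andbT eq_sym; by rewrite inE in iL.
  - have [h1 h2] := mult1 p w j wS.
    apply: (@coordinate_recurrence R k w wU (f j) _ p R0 (q j)) => //.
    + by move=> l; exact: coefs wS.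
    + exact: qint wS.
    + have [_ rj] := rP j; rewrite /R0 (bigD1 j) //=; exact: unity_mult.
    + by case: (q_fixed j) => [?|[? _]]; [right|left].
    + exact: xj.
pose a i := (f i)`_1; pose b i := (f i)`_0.
apply: (@linear_orbit_vanishing k k0 N linear a
  (fun i => if a i == 1 then x i else b i / (1 - a i))
  (fun i => if a i == 1 then b i else x i - b i / (1 - a i))) => // [i|i iL|n i].
- rewrite inE => /eqP sf; have : lead_coef (f i) != 0.
    by rewrite lead_coef_eq0 -size_poly_gt0 ltnW.
  by rewrite lead_coefE sf.
- case: (eqVneq (a i) 1) => [ai|ai]; first exact: transl.
  have [p [w [[_ wU _ _] [xi _]]]] := places i; have wA := ultrametric_is_absval wU.
  suff -> : b i / (1 - a i) = q i.
    by rewrite -(absval_gt0 wA); apply: lt_trans xi.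
  rewrite inE in iL; have fE : (f i).[q i] = b i + a i * q i.
    by rewrite horner_coef (eqP iL) big_ord_recl big_ord1 /= expr0 mulr1 expr1.
  case: (q_fixed i) => [fq|[_ ha]]; last by rewrite /a ha eqxx in ai.
  have ai' : 1 - a i != 0 by rewrite subr_eq0 eq_sym.
  apply: (mulIf ai'); rewrite divfK //.
  by rewrite mulrBr mulr1 [q i * _]mulrC; apply/eqP; rewrite eq_sym subr_eq -fE fq.
- by rewrite inE => /eqP sf; rewrite affine_orbit // /a /b; case: ifP.
Qed.
End AdaptedOrbits.

Lemma adapted_places (R : realType) (k : closedFieldType) (k0 : [pchar k] =i pred0)
    (trdeg : finite_trdeg k) (S : seq k) : 0 \notin S ->
  exists (p : nat -> nat) (M : forall n, Cp_tower R (p n))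
    (tau : forall n, {rmorphism k -> Cp (M n)}),
  forall n, [/\ (p n < p n.+1)%N, ultrametric_absval (@Cp_abs _ _ (M n)) &
    adapted_place S (p n) (fun x => Cp_abs (tau n x))].
Proof.
move=> S0; pose place := {p : nat & {M : Cp_tower R p & {rmorphism k -> Cp M}}}.
pose tw (d : place) : Cp_tower R (projT1 d) := projT1 (projT2 d).
pose mp (d : place) : {rmorphism k -> Cp (tw d)} := projT2 (projT2 d).
have /choice[g gP] : forall B : nat, exists d : place, [/\ (B < projT1 d)%N,
    ultrametric_absval (@Cp_abs _ _ (tw d)) &
    adapted_place S (projT1 d) (fun x => Cp_abs (mp d x))].
  move=> B; have [p [M [tau [p_pr Bp MU Mp MS]]]] := padic_place R k0 trdeg B S0.
  exists (existT _ p (existT _ M tau)); split=> //; split=> //.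
  exact: (ultrametric_comp tau MU).
pose d n := iter n (fun e => g (projT1 e)) (g 0%N).
exists (fun n => projT1 (d n)), (fun n => tw (d n)), (fun n => mp (d n)) => n.
have [h1 _ _] := gP (projT1 (d n)); split=> //.
  by case: n {h1} => [|n]; [have [] := gP 0%N | have [] := gP (projT1 (d n))].
by case: n {h1} => [|n]; [have [] := gP 0%N | have [] := gP (projT1 (d n))].
Qed.

Lemma SAZD_criterion (R : realType) (k : closedFieldType) (k0 : [pchar k] =i pred0)
    (trdeg : finite_trdeg k) (K0 : fieldType) (i0 : {rmorphism K0 -> k})
    (K0_alg : forall x : k, algebraicOver i0 x) (N : nat) (f : 'I_N -> {poly k})
    (L : {set 'I_N} := [set i | size (f i) == 2%N]) :
  (forall i, (1 < size (f i))%N) -> multiplicatively_free L (fun i => (f i)`_1) ->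
  (forall i, i \in L -> (f i)`_1 = 1 -> (f i)`_0 != 0) -> SAZD R i0 (split_endo f).
Proof.
move=> sz free transl.
have /choice[q qP] : forall i, exists q, (f i)^`().[q] != 0 /\
    ((f i).[q] = q \/ size (f i) = 2%N /\ (f i)`_1 = 1).
  move=> i; have := sz i; rewrite leq_eqVlt => /predU1P[/esym sf|/(nonsuperattracting_fixed_point k0)]; last first.
    by case=> q [fq dq]; exists q; split=> //; left.
  have l0 : (f i)`_1 != 0.
    by have := lead_coef_eq0 (f i); rewrite lead_coefE -size_poly_eq0 sf => ->.
  have dE z : (f i)^`().[z] = (f i)`_1.
    have s1 : (size (f i)^`() <= 1)%N by rewrite (leq_trans (size_poly _ _)) // sf.
    by rewrite (horner_coef_wide _ s1) big_ord1 coef_deriv mulr1n expr0 mulr1.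
  have [f1|f1] := eqVneq (f i)`_1 1; first by exists 0; rewrite dE; split=> //; right.
  exists ((f i)`_0 / (1 - (f i)`_1)); rewrite dE; split=> //; left.
  rewrite horner_coef sf big_ord_recl big_ord1 /= expr0 mulr1 expr1.
  have : 1 - (f i)`_1 != 0 by rewrite subr_eq0 eq_sym.
  by move: (f i)`_0 (f i)`_1 => b a ab; field.
have q1 i : (f i)^`().[q i] != 0 by case: (qP i).
have q2 i : (f i).[q i] = q i \/ size (f i) = 2%N /\ (f i)`_1 = 1 by case: (qP i).
pose S := place_conditions f q.
have [p [M [tau Mp]]] := adapted_places R k0 trdeg (place_conditions_neq0 f q).
have [K [j [iota [iotaj jfin iotaS]]]] := adjoin_finite ([seq q i | i <- enum 'I_N] ++ S) K0_alg.
have /choice[q' q'E] : forall i, exists y, iota y = q i.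
  by move=> i; apply: iotaS; rewrite mem_cat map_f // mem_enum.
have pr n : prime (p n) by have [_ _ []] := Mp n.
have MU n : ultrametric_absval (@Cp_abs _ _ (M n)) by have [] := Mp n.
pose c (i : 'I_N) : target R := TargetPrime (pr i) (M i).
pose t (i : 'I_N) : {rmorphism K -> target_field (c i)} := (tau i \o iota)%FUN.
pose U (i : 'I_N) (y : affine_space K N (KAlg (t i))) :=
  1 < @Cp_abs _ _ (M i) (y 0 i - t i (q' i)) /\
  forall l, l != i -> @Cp_abs _ _ (M i) (y 0 l - t i (q' l)) < 1.
pose A (x : 'rV[k]_N) := forall i, @adelic_piece R k K iota (affine_space K N) (c i) (t i) (@U i) x.
exists A; split.
- exists (\row_l (q l + (\prod_(m < N | m != l) p m)%:R / (p l)%:R)) => i.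
  exists (@KHom K (KAlg iota) (KAlg (t i)) (tau i) (fun c => erefl)).
  have [_ _ [_ wU wp _]] := Mp i; pose w z := Cp_abs (tau i z).
  have wA : is_absval w := ultrametric_is_absval wU.
  have ti l : t i (q' l) = tau i (q l) by rewrite /= q'E.
  have wE l : @Cp_abs _ _ (M i) (tau i (q l + (\prod_(m < N | m != l) p m)%:R / (p l)%:R) - t i (q' l)) =
      w (\prod_(m < N | m != l) p m)%:R / w (p l)%:R.
    by rewrite ti -rmorphB addrAC subrr add0r -(absvalV wA) -(absvalM wA).
  have wcop n : coprime (p i) n -> w n%:R = 1 by exact: (ultra_coprime (pr i) wU wp).
  have copr l : l != i -> coprime (p i) (p l).
    move=> li; rewrite prime_coprime // dvdn_prime2 //; apply: contra li => /eqP pil.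
    apply/eqP/val_inj; have mono := homo_ltn ltn_trans (fun n => let: And3 h _ _ := Mp n in h).
    by case: (ltngtP l i) => // /mono; rewrite pil ltnn.
  split=> [|l li]; rewrite !mxE /= wE.
    rewrite wcop; last by elim/big_ind: _ => [|m n hm hn|m /copr //]; rewrite ?coprimen1 // coprimeMr hm.
    by rewrite div1r /w wp invrK ltr1n prime_gt1.
  rewrite (wcop _ (copr l li)) divr1 (bigD1 i) 1?eq_sym //= natrM (absvalM wA).
  apply: le_lt_trans (_ : (p i)%:R^-1 * 1 < 1).
    rewrite /w wp ler_wpM2l ?invr_ge0 ?ler0n //; exact: (ultra_nat_le1 wU).
  by rewrite mulr1 invf_lt1 ?ltr1n ?ltr0n ?prime_gt1 ?prime_gt0.
- move=> x Ax; exists K, j, iota, A; split=> //.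
  exists (affine_space K N), (affine_space_id K N), A; split.
  + exact: affine_space_variety.
  + exact: affine_space_id_flat.
  + exists N, c, t, U; split=> // i B u uo h [h1 h2].
    exists [seq u 0 l | l <- enum 'I_N], 1; split=> // h' hh'.
    have near l : @Cp_abs _ _ (M i) (h' (u 0 l) - h (u 0 l)) < 1.
      by apply: hh'; rewrite map_f // mem_enum.
    split=> [|l li]; rewrite !mxE.
      rewrite ltNge; apply/negP => le1; move: h1; rewrite !mxE ltNge => /negP; apply.
      rewrite -(subrK (h' (u 0 i)) (h (u 0 i))) -addrA; apply: (ultraD_le (MU i)) => //.
      by rewrite -(absvalN (ultrametric_is_absval (MU i))) opprB ltW.
    rewrite -(subrK (h (u 0 l)) (h' (u 0 l))) -addrA; apply: (ultraD_lt (MU i)) => //.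
    by move: (h2 l li); rewrite mxE.
  + by move=> y; split=> [Ay|[z Az <-]] //; exists y.
- move=> x Ax; apply: orbit_dense; apply: (@adapted_orbit_vanishing R k k0 N f q sz q1 q2 (fun i => x 0 i)) free transl.
  move=> i; have [tbar [h1 h2]] := Ax i.
  exists (p i), (fun z => @Cp_abs _ _ (M i) (tbar z)).
  have tbarK z : tbar (iota z) = tau i (iota z) by exact: (kmapK tbar z).
  have [_ _ [_ wU wp wS]] := Mp i.
  split; [split=> //|split].
  - exact: (ultrametric_comp tbar (MU i)).
  - by have := tbarK (p i)%:R; rewrite !rmorph_nat => ->; rewrite -wp rmorph_nat.
  - move=> s sS; have [y yE] : exists y, iota y = s by apply: iotaS; rewrite mem_cat sS orbT.
    have [w1 [r r0 wr]] := wS s sS; rewrite -yE tbarK yE; split=> //; exists r => //.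
    by rewrite -yE -(rmorphXn iota) -(rmorph1 iota) -rmorphB tbarK rmorphB rmorphXn rmorph1 yE.
  - by move: h1; rewrite mxE rmorphB /= -q'E tbarK.
  - by move=> l li; move: (h2 l li); rewrite mxE rmorphB /= -(q'E l) tbarK.
Qed.

(** * Invariant rational functions *)

Lemma frac_repr (D : idomainType) (H : {fraction D}) :
  H = tofrac \n_(repr H) / tofrac \d_(repr H).
Proof.
have d0 : tofrac \d_(repr H) != 0 by rewrite tofrac_eq0 denom_ratioP.
apply: (mulIf d0); rewrite divfK //; rewrite -{1}[H]reprK; set x := repr H.
rewrite !piE; apply/eqmodP.
rewrite /= FracField.equivfE /FracField.mulf !numden_Ratio ?mulr1 ?oner_neq0 ?denom_ratioP //.
by rewrite mulrC.
Qed.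

Section Invariants.
Variables (k : fieldType) (k0 : [pchar k] =i pred0) (N : nat).

Lemma dominant_comp_eq0 (F : N.-tuple {mpoly k[N]}) (P : {mpoly k[N]}) :
  dominant F -> P \mPo F = 0 -> P = 0.
Proof.
move=> domF PF0; apply/eqP/negPn/negP => P0.
have [z /eqP] := mpoly_nonvanishing (fun=> natf_inj k0) P0; apply.
pose Z (x : 'rV[k]_N) := P.@[x 0] = 0.
have ZC : zariski_closed Z by exists (eq P) => x; split=> [h _ <-|/(_ P erefl)].
have ZF y : (exists x, endo_map F x = y) -> Z y.
  case=> x <-; have := congr1 (meval (x 0)) PF0; rewrite meval0 comp_mpoly_meval.
  by apply: etrans; apply: meval_eq => i; rewrite mxE.
rewrite -(domF Z ZC ZF (\row_i (z i)%:R)); apply: meval_eq => i; by rewrite mxE.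
Qed.

Lemma frac_comp_div (F : N.-tuple {mpoly k[N]}) (P Q : {mpoly k[N]}) : dominant F -> Q != 0 ->
  frac_comp F (tofrac P / tofrac Q) = tofrac (P \mPo F) / tofrac (Q \mPo F).
Proof.
move=> domF Q0; set H := tofrac P / tofrac Q.
have compN0 D : D != 0 -> tofrac (D \mPo F) != 0.
  by rewrite tofrac_eq0; apply: contra => /eqP /(dominant_comp_eq0 domF) ->.
have d0 := denom_ratioP (repr H).
have : \n_(repr H) * Q = P * \d_(repr H).
  apply/eqP; rewrite -tofrac_eq !tofracM -eqr_div ?tofrac_eq0 //; apply/eqP.
  exact: esym (frac_repr H).
move/(congr1 (comp_mpoly F)); rewrite !rmorphM => /= E.
by apply/eqP; rewrite /frac_comp eqr_div ?compN0 // -!tofracM E.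
Qed.

Lemma invariant_fraction (F : N.-tuple {mpoly k[N]}) (P Q : {mpoly k[N]}) (y z : 'I_N -> k) :
  dominant F -> (P \mPo F) * Q = P * (Q \mPo F) -> Q.@[y] != 0 ->
  P.@[y] * Q.@[z] <> P.@[z] * Q.@[y] -> has_nonconstant_invariant F.
Proof.
move=> domF PQ Qy nc; have Q0 : Q != 0 by apply: contraNneq Qy => ->; rewrite meval0.
have QF0 : Q \mPo F != 0 by apply: contra Q0 => /eqP /(dominant_comp_eq0 domF) ->.
exists (tofrac P / tofrac Q).
  rewrite frac_comp_div //; apply/eqP; rewrite eqr_div ?tofrac_eq0 // -!tofracM tofrac_eq.
  exact/eqP.
move=> c E; have PE : P = c%:MP * Q.
  by apply/eqP; rewrite -tofrac_eq tofracM -E divfK // tofrac_eq0.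
by apply: nc; rewrite PE !mevalM !mevalC -!mulrA [Q.@[y] * _]mulrC.
Qed.

Variable f : 'I_N -> {poly k}.
Hypothesis f_dom : dominant (split_endo f).

Lemma dominant_split_size i : (1 < size (f i))%N.
Proof.
rewrite ltnNge; apply/negP => /size1_polyC fi.
have := @dominant_comp_eq0 _ ('X_i - ((f i)`_0)%:MP) f_dom.
rewrite rmorphB /= comp_mpolyC comp_mpolyXU -tnth_nth tnth_mktuple {1}fi map_polyC hornerC /= subrr.
move=> /(_ erefl) /(congr1 (meval (fun=> (f i)`_0 + 1))) /eqP.
by rewrite mevalB mevalXU mevalC meval0 addrAC subrr add0r oner_eq0.
Qed.

Lemma split_endo_affine i : size (f i) = 2%N ->
  'X_i \mPo split_endo f = (f i)`_1 *: 'X_i + ((f i)`_0)%:MP.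
Proof.
move=> sf; rewrite comp_mpolyXU -tnth_nth tnth_mktuple horner_poly sf.
by rewrite big_ord_recl big_ord1 /= expr0 mulr1 expr1 mul_mpolyC addrC.
Qed.

Let L : {set 'I_N} := [set i | size (f i) == 2%N].

Lemma identity_invariant i : i \in L -> (f i)`_1 = 1 -> (f i)`_0 = 0 ->
  has_nonconstant_invariant (split_endo f).
Proof.
rewrite inE => /eqP sf a b; apply: (@invariant_fraction _ 'X_i 1 (fun=> 0) (fun=> 1)) => //.
- by rewrite rmorph1 split_endo_affine // a b scale1r addr0.
- by rewrite meval1 oner_neq0.
- by rewrite !meval1 !mevalXU mul0r mulr1 => /eqP; rewrite eq_sym oner_eq0.
Qed.

Lemma translations_invariant i j : i \in L -> j \in L -> i != j -> (f i)`_1 = 1 -> (f j)`_1 = 1 ->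
  (f j)`_0 != 0 -> has_nonconstant_invariant (split_endo f).
Proof.
rewrite !inE => /eqP si /eqP sj ij ai aj bj.
apply: (@invariant_fraction _ ((f j)`_0 *: 'X_i - (f i)`_0 *: 'X_j) 1 (fun=> 0) (fun l => (l == i)%:R)) => //.
- rewrite rmorph1 !mulr1 rmorphB /= !linearZ /= !split_endo_affine // ai aj !scale1r.
  rewrite -!mul_mpolyC; move: ('X_i : {mpoly k[N]}) ('X_j : {mpoly k[N]}) (_%:MP) (_%:MP) => x y b c; ring.
- by rewrite meval1 oner_neq0.
- rewrite !meval1 !mevalB !mevalZ !mevalXU eqxx eq_sym (negPf ij) !mulr0 subrr !mulr1 subr0 => /eqP.
  by rewrite eq_sym (negPf bj).
Qed.

Lemma multiplicative_invariant i (m m' : 'I_N -> nat) : i \in L -> (f i)`_1 != 1 -> m i != m' i ->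
  \prod_(j in L | (f j)`_1 != 1) (f j)`_1 ^+ m j = \prod_(j in L | (f j)`_1 != 1) (f j)`_1 ^+ m' j ->
  has_nonconstant_invariant (split_endo f).
Proof.
move=> iL ai mi E; pose q j := (f j)`_0 / (1 - (f j)`_1).
pose P m : {mpoly k[N]} := \prod_(j in L | (f j)`_1 != 1) ('X_j - (q j)%:MP) ^+ m j.
have Pe (e : 'I_N -> nat) z : (P e).@[z] = \prod_(j in L | (f j)`_1 != 1) (z j - q j) ^+ e j.
  by rewrite /P rmorph_prod; apply: eq_bigr => j _ /=; rewrite rmorphXn /= mevalB mevalXU mevalC.
have PF (e : 'I_N -> nat) : P e \mPo split_endo f =
    (\prod_(j in L | (f j)`_1 != 1) (f j)`_1 ^+ e j)%:MP * P e.
  rewrite /P !rmorph_prod -big_split /=; apply: eq_bigr => j /andP[]; rewrite inE => /eqP sj aj.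
  rewrite !rmorphXn -exprMn /=; congr (_ ^+ _).
  rewrite rmorphB /= comp_mpolyC split_endo_affine // -mul_mpolyC mulrBr -addrA; congr (_ + _).
  rewrite -mpolyCM -mpolyCB -mpolyCN; congr (_%:MP); rewrite /q.
  have : 1 - (f j)`_1 != 0 by rewrite subr_eq0 eq_sym.
  by move: (f j)`_0 (f j)`_1 => b a ab; field.
have P1 (e : 'I_N -> nat) : (P e).@[fun j => q j + 1] = 1.
  by rewrite Pe big1 // => j _; rewrite addrAC subrr add0r expr1n.
have P2 (e : 'I_N -> nat) : (P e).@[fun j => q j + (if j == i then 2 else 1)] = 2 ^+ e i.
  rewrite Pe (bigD1 i) ?iL //= eqxx addrAC subrr add0r big1 ?mulr1 // => j /andP[_ /negPf ->].
  by rewrite addrAC subrr add0r expr1n.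
apply: (@invariant_fraction _ (P m) (P m') (fun j => q j + 1) (fun j => q j + (if j == i then 2 else 1))) => //.
- by rewrite !PF E; ring.
- by rewrite P1 oner_neq0.
- rewrite !P1 !P2 mul1r mulr1 -!natrX => /(natf_inj k0) /eqP.
  by rewrite eqn_exp2l // eq_sym (negPf mi).
Qed.

(* If the monomials [a ^ n * n ^ e] of the linear coordinates are not distinct,
   a multiplicative relation, two translations or an identity coordinate
   gives an invariant function. *)
Lemma free_or_invariant :
  multiplicatively_free L (fun i => (f i)`_1) /\ (forall i, i \in L -> (f i)`_1 = 1 -> (f i)`_0 != 0) \/
  has_nonconstant_invariant (split_endo f).
Proof.
have [|noinv] := pselect (has_nonconstant_invariant (split_endo f)); [by right | left].
have transl i : i \in L -> (f i)`_1 = 1 -> (f i)`_0 != 0.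
  by move=> iL ai; apply/eqP => bi; apply: noinv; exact: identity_invariant iL ai bi.
split=> // m m' supp; set a := fun i => (f i)`_1 => E S.
have split1 (e : 'X_{1..N}) : \prod_(j in L) a j ^+ e j = \prod_(j in L | a j != 1) a j ^+ e j.
  rewrite (bigID (fun j => a j == 1)) /= big1 ?mul1r // => j /andP[_ /eqP ->].
  by rewrite expr1n.
have eqNt i : i \in L -> a i != 1 -> m i = m' i.
  move=> iL ai; apply/eqP/negPn/negP => mi; apply: noinv.
  by apply: (multiplicative_invariant iL ai mi); rewrite -!split1.
apply/mnmP => i; have [iL|/supp[-> ->] //] := boolP (i \in L).
have [ai|ai] := eqVneq (a i) 1; last exact: eqNt.
have [j /andP[jL /andP[aj ji]]|no] := pickP (fun j => (j \in L) && ((a j == 1) && (j != i))).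
  case: noinv; apply: (translations_invariant jL iL ji (eqP aj) ai); exact: transl.
have sum1 (e : 'X_{1..N}) : (\sum_(j in L | a j == 1%R) e j)%N = e i.
  rewrite (bigD1 i) /= ?iL ?ai ?eqxx // big1 ?addn0 // => j /andP[/andP[jL aj] ji].
  by have := no j; rewrite jL aj ji.
by rewrite -(sum1 m) -(sum1 m').
Qed.
End Invariants.

Theorem theorem1p13 (R : realType)
    (k : closedFieldType) (char0 : [pchar k] =i pred0) (trdeg : finite_trdeg k)
    (K0 : fieldType) (i0 : {rmorphism K0 -> k}) (K0_fg : fg_field K0)
    (K0_alg : forall x : k, algebraicOver i0 x)
    (N : nat) (N_gt0 : (0 < N)%N) (f : 'I_N -> {poly k})
    (f_dom : dominant (split_endo f)) :
  AZD R i0 (split_endo f) /\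
  ((forall i, (2 < size (f i))%N) -> SAZD R i0 (split_endo f)).
Proof.
have sz := dominant_split_size char0 f_dom; split=> [|sz2].
  have [[free transl]|] := free_or_invariant char0 f_dom; last by left.
  by right; apply: SAZD_criterion.
have L0 i : i \notin [set i | size (f i) == 2%N] by rewrite inE gtn_eqF.
apply: SAZD_criterion => // [m m' supp _ _|i]; last by rewrite (negPf (L0 i)).
by apply/mnmP => i; have [-> ->] := supp i (L0 i).
Qed.
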